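(* Let $\beta>0$ be a real number and let $f\in C^{1}([0,1])$. For every $\varepsilon\in(0,1)$ let $$m(\varepsilon,\beta,f):=\min\left\{\mathrm{PMF}_{\varepsilon}(\beta,f,(0,1),u):u\in H^{2}((0,1))\right\}.$$ Then $$\lim_{\varepsilon\to 0^{+}}\frac{m(\varepsilon,\beta,f)}{\omega(\varepsilon)^{2}}=10\left(\frac{2\beta}{27}\right)^{1/5}\int_{0}^{1}|f'(x)|^{4/5}\,dx.$$
   Context: For every $\varepsilon\in(0,1)$ set $\omega(\varepsilon):=\varepsilon|\log\varepsilon|^{1/2}$. For $\beta>0$, an open set $\Omega\subseteq\mathbb{R}$, $f\in L^{2}(\Omega)$ and $u\in H^{2}(\Omega)$ set $$\mathrm{PMF}_{\varepsilon}(\beta,f,\Omega,u):=\int_{\Omega}\left\{\varepsilon^{6}\omega(\varepsilon)^{4}u''(x)^{2}+\log\left(1+u'(x)^{2}\right)+\beta(u(x)-f(x))^{2}\right\}dx.$$ The minimum defining $m(\varepsilon,\beta,f)$ is attained for every $\varepsilon\in(0,1)$, $\beta>0$ and $f\in L^{2}((0,1))$. *)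

(* Defs.v *)
From HB Require Import structures.
From mathcomp Require Import all_boot all_order all_algebra.
From mathcomp Require Import all_classical all_reals all_analysis.
Set Implicit Arguments.
Unset Strict Implicit.
Unset Printing Implicit Defensive.
Import Order.TTheory GRing.Theory Num.Theory.
Import numFieldNormedType.Exports.
Local Open Scope classical_set_scope.
Local Open Scope ring_scope.

Section Definitions.
Variable R : realType.
Implicit Types (Omega : set R) (u v f phi : R -> R) (eps beta a b : R).
Local Notation mu := (@lebesgue_measure R).

(* Functions on Omega are represented by total functions on R of which only the
   restriction to Omega matters; measurability is Borel measurability, which
   every class modulo a.e. equality satisfies for some representative. *)

Definition square_integrable Omega u : Prop :=
  measurable_fun Omega u /\ mu.-integrable Omega (fun x => (u x ^+ 2)%:E).

Definition test_function Omega phi : Prop :=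
  [/\ forall n x, derivable (derive1n n phi) x 1,
      compact (closure [set x | phi x != 0]) &
      closure [set x | phi x != 0] `<=` Omega].

Definition is_weak_derivative Omega (k : nat) u v : Prop :=
  [/\ locally_integrable Omega u, locally_integrable Omega v &
      forall phi, test_function Omega phi ->
        \int[mu]_(x in Omega) (u x * derive1n k phi x) =
        (-1) ^+ k * \int[mu]_(x in Omega) (v x * phi x)].

Definition sobolev_H2 Omega : set (R -> R) :=
  [set u | square_integrable Omega u /\
     forall k : nat, (1 <= k <= 2)%N ->
       exists2 v, square_integrable Omega v & is_weak_derivative Omega k u v].

(* A weak derivative is unique up to a.e. equality, so the choice made by [get]
   does not affect integrals; this is a junk value if there is none. *)
Definition weak_derivative Omega (k : nat) u : R -> R :=
  get [set v | is_weak_derivative Omega k u v].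

Definition omega eps : R := eps * Num.sqrt `|ln eps|.

Definition PMF eps beta f Omega u : \bar R :=
  (\int[mu]_(x in Omega)
    (eps ^+ 6 * omega eps ^+ 4 * weak_derivative Omega 2 u x ^+ 2
     + ln (1 + weak_derivative Omega 1 u x ^+ 2)
     + beta * (u x - f x) ^+ 2)%:E)%E.

(* The infimum is a minimum when it is attained, see [minPMF_minimum]. *)
Definition minPMF eps beta f : \bar R :=
  ereal_inf (PMF eps beta f `]0, 1[ @` sobolev_H2 `]0, 1[).

Lemma minPMF_minimum eps beta f u0 :
  sobolev_H2 `]0, 1[ u0 ->
  (forall u, sobolev_H2 `]0, 1[ u ->
    (PMF eps beta f `]0%R, 1%R[ u0 <= PMF eps beta f `]0%R, 1%R[ u)%E) ->
  minPMF eps beta f = PMF eps beta f `]0, 1[ u0.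
Proof.
move=> Hu0 min_u0; apply/eqP; rewrite eq_le; apply/andP; split.
  by apply: ereal_inf_lbound; exists u0.
by apply: le_ereal_inf_tmp => _ [u Hu <-]; exact: min_u0.
Qed.

(* f is continuous on [a, b], differentiable on ]a, b[, and its derivative
   extends continuously to [a, b]; values of f outside [a, b] are irrelevant. *)
Definition C1_segment a b f : Prop :=
  [/\ {within `[a, b], continuous f},
      forall x, x \in `]a, b[ -> derivable f x 1 &
      exists2 g : R -> R, {within `[a, b], continuous g} &
        {in `]a, b[, forall x, derive1 f x = g x}].

End Definitions.

(* Main.v *)
Require Import Defs.
From HB Require Import structures.
From mathcomp Require Import all_boot all_order all_algebra.
From mathcomp Require Import all_classical all_reals all_analysis.
From mathcomp Require Import measurable_realfun.
From mathcomp Require Import ring lra.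
Set Implicit Arguments.
Unset Strict Implicit.
Unset Printing Implicit Defensive.
Import Order.TTheory GRing.Theory Num.Theory.
Import numFieldNormedType.Exports.
Local Open Scope classical_set_scope.
Local Open Scope ring_scope.

(** Below, L stands for |log eps| and omega for omega(eps) = eps L^(1/2).

    A function of almost minimal energy is a staircase: it is almost constant,
    except for transitions of length comparable to eps^2 omega between plateaus
    at distance comparable to omega, both in height and in position. In a
    transition of height J and length d the slope is of order eps^-2, so that the
    logarithm costs about 4 L d; the second derivative costs at least
    12 eps^6 omega^4 J^2 / d^3, with equality for a cubic. Minimizing in d, a
    jump costs (16 / sqrt 3) omega^(5/2) J^(1/2). If f has slope p, the best
    staircase with steps of length l omega has, per unit length and divided by
    omega^2, the energy (16 / sqrt 3) (p / l)^(1/2) + beta p^2 l^2 / 12, and the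
    minimum over l is 10 (2 beta / 27)^(1/5) p^(4/5). In the code t^2 = p l is
    the optimal height of a jump, and this minimum is [cost beta t].

    Upper bound. In each cell of length l omega, the competitor joins the values
    of f at the two ends by a transition in the middle ([admissible_cell]). The
    competitors of adjacent cells are glued, which gives the bound on a segment
    where |f'| <= P ([upper_bound_slope]).

    Lower bound. Instead of looking for the steps of an arbitrary u, one uses a
    calibration. Let c be the cost for the slope p > 0, and let H be a primitive
    of g(y) = max(c omega^2 - beta y^2, 0) / p, the barrier. Then
    beta y^2 >= c omega^2 - p g(y), so that, if f' >= p, the fidelity term for
    y = u - f is at least c omega^2 - f' g(y), that is
    c omega^2 + (H(y))' - u' g(y), and H is bounded by a multiple of omega^3. It
    remains to see that the two other terms of the energy absorb u' g(y)
    ([gain_ge]). Where u' is at most eps^-(1 + k), with k < 1, the logarithm is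
    enough. On a maximal interval where u' is larger, the integral of u' g(y) is
    about the increment of H, and what makes the argument work is that
    H(y + J) - H(y) is at most the cost of a jump J ([barrier_jump],
    [jump_cost]): the same optimization as above.

    Both bounds pass from short segments to the unit interval by additivity,
    thanks to the continuity of f' ([lower_bound_segment],
    [upper_bound_segment]).

    The functional involves weak derivatives, so that functions of class H2 are
    first replaced by representatives of class C1 whose derivative is a primitive
    of a square integrable function ([sobolev_H2_rep]). This rests on the lemma of du
    Bois-Reymond, hence on the construction of smooth functions with compact
    support approximating the indicators of intervals. *)

(** * Integrals over segments *)

Section Segment_integral.
Variable R : realType.
Local Notation mu := (@lebesgue_measure R).
Implicit Types (f g h F v : R -> R) (a b c k x : R).

Definition Int a b f : R := \int[mu]_(x in `[a, b]) f x.

Definition Itg a b f : Prop := mu.-integrable `[a, b] (EFin \o f).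

Definition locint f : Prop := forall a b, Itg a b f.

Definition derives F f : Prop := forall x, is_derive x (1 : R) F (f x).

Lemma Itg_cont a b f : continuous f -> Itg a b f.
Proof.
move=> cf; apply: continuous_compact_integrable; first exact: segment_compact.
exact: continuous_subspaceT.
Qed.

Lemma ItgS a b c d f : a <= c -> d <= b -> Itg a b f -> Itg c d f.
Proof.
move=> ac db; apply: integrableS => //.
by apply: subset_itv; rewrite bnd_simp.
Qed.

Lemma eq_Itg a b f g : f =1 g -> Itg a b f -> Itg a b g.
Proof. by move=> /funext ->. Qed.

Lemma ItgD a b f g : Itg a b f -> Itg a b g -> Itg a b (fun x => f x + g x).
Proof. by move=> fi gi; apply: (integrableD _ fi gi). Qed.

Lemma ItgZ a b k f : Itg a b f -> Itg a b (fun x => k * f x).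
Proof. by move=> fi; apply: (integrableZl _ k fi). Qed.

Lemma ItgN a b f : Itg a b f -> Itg a b (fun x => - f x).
Proof. by move=> /(ItgZ (-1)); apply: eq_Itg => x; rewrite mulN1r. Qed.

Lemma ItgB a b f g : Itg a b f -> Itg a b g -> Itg a b (fun x => f x - g x).
Proof. by move=> fi gi; apply: (ItgD fi (ItgN gi)). Qed.

Lemma ItgM a b f g : continuous f -> Itg a b g -> Itg a b (fun x => f x * g x).
Proof.
move=> cf gi.
have mI : measurable (`[a, b]%classic : set R) by [].
apply: (@integrableMr _ _ _ mu _ mI f (EFin \o g)) => //.
  apply: (measurable_funS measurableT) => //.
  exact: continuous_measurable_fun.
have /compact_bounded[M [_ mrt]] :=
  continuous_compact (continuous_subspaceT cf) (@segment_compact R a b).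
by exists M; split; rewrite ?num_real // => ? ? ? ?; exact: mrt.
Qed.

Lemma Itg_cst a b k : Itg a b (fun=> k).
Proof. by apply: Itg_cont => x; exact: cvg_cst. Qed.

Lemma ler_Int a b f g : Itg a b f -> Itg a b g ->
  (forall x, a <= x <= b -> f x <= g x) -> Int a b f <= Int a b g.
Proof.
by move=> fi gi fg; apply: le_Rintegral => // x /=; rewrite in_itv/= => /fg.
Qed.

Lemma Int_ge0 a b f : (forall x, a <= x <= b -> 0 <= f x) -> 0 <= Int a b f.
Proof.
by move=> f0; apply: Rintegral_ge0 => x /=; rewrite in_itv/= => /f0.
Qed.

Lemma eq_Int a b f g :
  (forall x, a <= x <= b -> f x = g x) -> Int a b f = Int a b g.
Proof.
by move=> fg; apply: eq_Rintegral => x; rewrite inE/= in_itv/= => /fg.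
Qed.

Lemma IntD a b f g : Itg a b f -> Itg a b g ->
  Int a b (fun x => f x + g x) = Int a b f + Int a b g.
Proof. by move=> fi gi; apply: RintegralD. Qed.

Lemma IntZ a b k f : Itg a b f -> Int a b (fun x => k * f x) = k * Int a b f.
Proof. by move=> fi; apply: RintegralZl. Qed.

Lemma IntB a b f g : Itg a b f -> Itg a b g ->
  Int a b (fun x => f x - g x) = Int a b f - Int a b g.
Proof. by move=> fi gi; apply: RintegralB. Qed.

Lemma IntN a b f : Itg a b f -> Int a b (fun x => - f x) = - Int a b f.
Proof.
by move=> fi; rewrite -mulN1r -IntZ//; apply: eq_Int => x _; rewrite mulN1r.
Qed.

Lemma Int_cst a b k : a <= b -> Int a b (fun=> k) = k * (b - a).
Proof.
move=> ab; rewrite /Int Rintegral_cst//= lebesgue_measure_itv/= lte_fin.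
case: ltP => // ba; suff -> : a = b by rewrite /= subrr.
by apply/eqP; rewrite eq_le ab.
Qed.

Lemma Int_aa a f : Int a a f = 0.
Proof. by rewrite /Int set_itv1 Rintegral_set1. Qed.

Lemma Int_lt a b f : b < a -> Int a b f = 0.
Proof. by move=> ba; rewrite /Int set_itv_ge ?Rintegral_set0// -leNgt bnd_simp. Qed.

Lemma Int_split c a b f : a <= c -> c <= b -> Itg a b f ->
  Int a b f = Int a c f + Int c b f.
Proof.
move=> ac cb fi.
have := @Rintegral_itvB R f (BLeft a) (BRight b) c fi.
rewrite !bnd_simp => /(_ ac cb) /eqP; rewrite subr_eq => /eqP h.
rewrite [LHS]h addrC; congr (_ + _); rewrite /Int.
rewrite Rintegral_itv_obnd_cbnd//; apply: integrableS fi => //.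
by apply: subset_itv; rewrite bnd_simp.
Qed.

Lemma Int_norm a b f : Itg a b f -> `|Int a b f| <= Int a b (fun x => `|f x|).
Proof. by move=> fi; apply: le_normr_Rintegral. Qed.

Lemma Itg_norm a b f : Itg a b f -> Itg a b (fun x => `|f x|).
Proof. by move=> fi; exact: (integrable_norm fi). Qed.

Lemma derives_continuous F f : derives F f -> continuous F.
Proof.
move=> Ff x; apply: differentiable_continuous.
by apply/derivable1_diffP; apply: (@ex_derive _ _ _ _ _ _ _ (Ff x)).
Qed.

Lemma Int_derives F f a b : a <= b -> continuous f -> derives F f ->
  Int a b f = F b - F a.
Proof.
rewrite le_eqVlt => /predU1P[<-|ab] cf Ff; first by rewrite Int_aa subrr.
rewrite /Int /Rintegral (continuous_FTC2 ab (F := F))//.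
- exact: continuous_subspaceT.
- have cF := derives_continuous Ff.
  split => [x _||].
  + exact: (@ex_derive _ _ _ _ _ _ _ (Ff x)).
  + exact: cvg_at_right_filter (cF a).
  + exact: cvg_at_left_filter (cF b).
- by move=> x _; rewrite derive1E; apply: (@derive_val _ _ _ _ _ _ _ (Ff x)).
Qed.

(** One of the two terms vanishes, its segment being empty or reduced to a
    point; this makes [prim f] a primitive on both sides of the origin. *)
Definition prim f x : R := Int 0 x f - Int x 0 f.

Lemma primB f a b : locint f -> a <= b -> prim f b - prim f a = Int a b f.
Proof.
move=> fi ab; rewrite /prim.
have [a0|a0] := leP 0 a.
  have Z x : 0 <= x -> Int x 0 f = 0.
    by rewrite le_eqVlt => /predU1P[<-|/Int_lt//]; rewrite Int_aa.
  rewrite (Z a)// (Z b) ?(le_trans a0)//.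
  by rewrite (Int_split (c := a) a0 ab (fi _ _)); ring.
have [b0|b0] := leP b 0.
  have Z x : x <= 0 -> Int 0 x f = 0.
    by rewrite le_eqVlt => /predU1P[->|/Int_lt//]; rewrite Int_aa.
  rewrite (Z a) ?(ltW a0)// (Z b)//.
  by rewrite (Int_split (c := b) ab b0 (fi _ _)); ring.
rewrite (Int_lt _ b0) (Int_lt _ a0).
by rewrite (Int_split (c := 0) (ltW a0) (ltW b0) (fi _ _)); ring.
Qed.

Lemma continuous_prim f : locint f -> continuous (prim f).
Proof.
move=> fi; suff H (x : R) : {for x, continuous (prim f)} by move=> x; exact: H.
have xI : x \in `]x - 1, x + 1[ by rewrite in_itv/=; apply/andP; split; lra.
have ab : x - 1 < x + 1 by lra.
have := @parameterized_integral_continuous R (x - 1) (x + 1) f (ltW ab) (fi _ _).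
move=> /(continuous_within_itvP _ ab)[+ _ _] => /(_ x xI) cx.
rewrite /prop_for /continuous_at.
have -> : prim f x = prim f (x - 1) +
    parameterized_integral mu (x - 1) x f.
  by rewrite -[parameterized_integral _ _ _ _]/(Int (x - 1) x f) -primB//; lra.
have : (prim f (x - 1) + parameterized_integral mu (x - 1) y f) @[y --> x]
   --> prim f (x - 1) + parameterized_integral mu (x - 1) x f.
  by apply: cvgD => //; exact: cvg_cst.
apply: cvg_trans; apply: near_eq_cvg; near=> y.
rewrite -[parameterized_integral _ _ _ _]/(Int (x - 1) y f) -primB//; first by ring.
by near: y; apply: lt_le_nbhsr; rewrite ltrBlDr ltrDl.
Unshelve. all: by end_near. Qed.

Lemma derives_prim f : continuous f -> derives (prim f) f.
Proof.
move=> cf x.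
have fi : locint f by move=> a b; exact: Itg_cont.
have [xu ax] : x < x + 1 /\ x - 1 < x by split; lra.
have [d1 d2] := @continuous_FTC1_closed R f (x - 1) x (x + 1) xu (fi _ _) ax (cf x).
have E : \forall y \near x, Int (x - 1) y f + prim f (x - 1) = prim f y.
  near=> y; rewrite -primB//; first by ring.
  by near: y; apply: lt_le_nbhsr; rewrite ltrBlDr ltrDl.
have D : is_derive x (1 : R) (fun y => Int (x - 1) y f + prim f (x - 1)) (f x).
  have D0 : is_derive x (1 : R) (fun y => Int (x - 1) y f) (f x).
    by apply: DeriveDef; [exact: d1|rewrite -derive1E].
  have := is_deriveD D0 (is_derive_cst (prim f (x - 1)) x 1).
  by rewrite addr0.
exact: near_eq_is_derive E D.
Unshelve. all: by end_near. Qed.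

End Segment_integral.

(** * Absolutely continuous functions: integration by parts *)

Section By_parts.
Variable R : realType.
Local Notation mu := (@lebesgue_measure R).
Implicit Types (f g h v W phi psi : R -> R) (a b c k x : R).

Lemma continuous_bounded f a b : continuous f ->
  exists2 M : R, 0 < M & forall x, a <= x <= b -> `|f x| <= M.
Proof.
move=> cf; have /compact_bounded[M [Mr mrt]] :=
  continuous_compact (continuous_subspaceT cf) (@segment_compact R a b).
exists (Num.max M 0 + 1).
  by rewrite ltr_wpDl// le_max lexx orbT.
move=> x xab; apply: (mrt (Num.max M 0 + 1)).
  by rewrite ltr_pwDr// le_max lexx.
by exists x => //=; rewrite in_itv.
Qed.

Lemma derivesD f f' g g' : derives f f' -> derives g g' ->
  derives (fun x => f x + g x) (fun x => f' x + g' x).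
Proof. by move=> ff' gg' x; exact: is_deriveD (ff' x) (gg' x). Qed.

Lemma derivesM f f' g g' : derives f f' -> derives g g' ->
  derives (fun x => f x * g x) (fun x => f' x * g x + f x * g' x).
Proof.
move=> ff' gg' x; apply: is_derive_eq (is_deriveM (ff' x) (gg' x)) _.
by rewrite /GRing.scale/=; ring.
Qed.

Lemma derivesZ k f f' : derives f f' ->
  derives (fun x => k * f x) (fun x => k * f' x).
Proof. by move=> ff' x; exact: is_deriveZ (ff' x). Qed.

Lemma derives_cst k : derives (fun _ : R => k) (fun=> 0).
Proof. by move=> x; exact: is_derive_cst. Qed.

Lemma derives_id : derives (fun x : R => x) (fun=> 1).
Proof. by move=> x; exact: is_derive_id. Qed.

Lemma derives_comp f f' g g' : derives f f' -> derives g g' ->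
  derives (fun x => f (g x)) (fun x => f' (g x) * g' x).
Proof. by move=> ff' gg' x; exact: is_derive1_comp (ff' _) (gg' x). Qed.

Lemma eq_derives f g f' g' : f =1 g -> f' =1 g' -> derives f f' -> derives g g'.
Proof. by move=> /funext -> /funext ->. Qed.

Lemma continuous_approx a b v (e : R) : a <= b -> Itg a b v -> 0 < e ->
  exists2 h, continuous h & Int a b (fun x => `|v x - h x|) <= e.
Proof.
move=> ab vi e0.
have mI : measurable (`[a, b]%classic : set R) by [].
have fI : (mu `[a, b]%classic < +oo)%E.
  by rewrite lebesgue_measure_itv/=; case: ifP => // _; rewrite -EFinB ltry.
have [h_ [hc hi hcv]] := approximation_continuous_integrable mI fI vi.
have : (fun n => Int a b (fun x => `|v x - h_ n x|)) @ \oo --> (0 : R).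
  exact: (fine_cvg hcv).
move=> /cvgrPdist_le /(_ _ e0) [n _ /(_ n (leqnn n))] /=.
rewrite sub0r normrN => hn; exists (h_ n); first exact: hc.
exact: le_trans (ler_norm _) hn.
Qed.

(** The two sides are continuous in [v] for the norm of integrable functions,
    so the formula follows from the case where [v] is continuous. *)
Lemma Int_by_parts W v phi psi a b : a <= b -> continuous W -> Itg a b v ->
  (forall x, a <= x <= b -> W x = W a + Int a x v) ->
  derives phi psi -> continuous psi ->
  Int a b (fun x => W x * psi x) + Int a b (fun x => v x * phi x) =
  W b * phi b - W a * phi a.
Proof.
move=> ab cW vi Wv dphi cpsi; have cphi := derives_continuous dphi.
have [M1 M10 hM1] := @continuous_bounded psi a b cpsi.
have [M2 M20 hM2] := @continuous_bounded phi a b cphi.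
set D := (X in X + _ = _); set E := (X in _ + X = _).
apply/eqP; rewrite -subr_eq0 -normr_le0; apply/ler_addgt0Pr => /= e e0.
have ba : 0 <= b - a by rewrite subr_ge0.
rewrite add0r.
pose K := M1 * (b - a) + M2 + M2.
have K0 : 0 < K by rewrite /K; have := mulr_ge0 (ltW M10) ba; lra.
have [h ch hv] := continuous_approx ab vi (divr_gt0 e0 K0).
have hi : locint h by move=> ? ?; exact: Itg_cont.
pose H x := W a + (prim h x - prim h a).
have dH : derives H h.
  have := derivesD (derives_cst (W a - prim h a)) (derives_prim ch).
  by apply: eq_derives => x; rewrite /H; ring.
have cH := derives_continuous dH.
have HW x : a <= x <= b -> `|W x - H x| <= e / K.
  move=> /[dup] /andP[ax xb] xab; rewrite Wv// /H primB//.
  have vx := ItgS (lexx a) xb vi.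
  rewrite [X in `|X|](_ : _ = Int a x (fun x => v x - h x)); last first.
    by rewrite IntB//; ring.
  apply: le_trans (Int_norm (ItgB vx (hi _ _))) (le_trans _ hv).
  have vhi := Itg_norm (ItgB vi (hi a b)).
  by rewrite (Int_split ax xb)// lerDl Int_ge0.
have smooth_case : Int a b (fun x => H x * psi x) + Int a b (fun x => h x * phi x) =
    H b * phi b - H a * phi a.
  rewrite -IntD; [|exact/ItgM/Itg_cont|exact/ItgM/Itg_cont].
  rewrite -(Int_derives ab _ (derivesM dH dphi)).
    by apply: eq_Int => x _; ring.
  by move=> x; apply: cvgD; apply: cvgM; solve[exact: ch|exact: cphi|exact: cH|exact: cpsi].
have -> : D + E - (W b * phi b - W a * phi a) =
    Int a b (fun x => (W x - H x) * psi x) + Int a b (fun x => (v x - h x) * phi x)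
    - (W b - H b) * phi b.
  rewrite /D /E.
  have -> : Int a b (fun x => (W x - H x) * psi x) =
     Int a b (fun x => W x * psi x) - Int a b (fun x => H x * psi x).
    rewrite -IntB; [|exact/ItgM/Itg_cont|exact/ItgM/Itg_cont].
    by apply: eq_Int => x _; ring.
  have vphi : Itg a b (fun x => v x * phi x).
    by apply: eq_Itg (ItgM cphi vi) => x; rewrite mulrC.
  have -> : Int a b (fun x => (v x - h x) * phi x) =
     Int a b (fun x => v x * phi x) - Int a b (fun x => h x * phi x).
    rewrite -IntB//; last exact/ItgM/Itg_cont.
    by apply: eq_Int => x _; ring.
  have HaWa : H a = W a by rewrite /H; ring.
  have -> : W a * phi a = H b * phi b -
      (Int a b (fun x => H x * psi x) + Int a b (fun x => h x * phi x)).
    by rewrite smooth_case HaWa; ring.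
  by ring.
have ea : 0 <= e / K by rewrite divr_ge0// ltW.
have B1 : `|Int a b (fun x => (W x - H x) * psi x)| <= e / K * M1 * (b - a).
  rewrite -Int_cst//; apply: le_trans (Int_norm _) _.
    apply: ItgM; last exact: Itg_cont.
    by move=> x; apply: cvgB; [exact: cW|exact: cH].
  apply: ler_Int; [|exact: Itg_cst|].
    apply: Itg_norm; apply: ItgM; last exact: Itg_cont.
    by move=> x; apply: cvgB; [exact: cW|exact: cH].
  by move=> x xab; rewrite normrM ler_pM// ?HW ?hM1.
have B2 : `|Int a b (fun x => (v x - h x) * phi x)| <= e / K * M2.
  have vhi := ItgB vi (hi a b).
  have vhp : Itg a b (fun x => (v x - h x) * phi x).
    by apply: eq_Itg (ItgM cphi vhi) => x; rewrite mulrC.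
  apply: le_trans (Int_norm vhp) _.
  rewrite mulrC; apply: le_trans (_ : Int a b (fun x => M2 * `|v x - h x|) <= _).
    apply: ler_Int; [exact: Itg_norm|exact/ItgZ/Itg_norm|].
    by move=> x xab; rewrite normrM mulrC ler_wpM2r// hM2.
  by rewrite IntZ ?ler_wpM2l// ?(ltW M20)//; exact: Itg_norm.
have B3 : `|(W b - H b) * phi b| <= e / K * M2.
  by rewrite normrM ler_pM ?HW ?hM2// ab lexx.
have eK : e / K * K = e by rewrite divfK// gt_eqF.
have {}eK : e / K * M1 * (b - a) + e / K * M2 + e / K * M2 = e by rewrite -[RHS]eK /K; ring.
rewrite -eK; apply: le_trans (ler_normB _ _) _; rewrite lerD//.
by apply: le_trans (ler_normD _ _) _; rewrite lerD.
Qed.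

End By_parts.

(** * Smooth functions with compact support *)

Section Smooth.
Variable R : realType.
Implicit Types (f g h phi psi : R -> R) (a b c k x s t : R).

Lemma is_derive_epsP (f : R -> R) (x d : R) :
  is_derive x (1 : R) f d <-> forall e : R, 0 < e -> exists2 dl : R, 0 < dl &
    forall h : R, `|h| < dl -> `|f (x + h) - f x - d * h| <= e * `|h|.
Proof.
have key (h : R) : h != 0 ->
    `|f (x + h) - f x - d * h| = `|d - h^-1 * (f (x + h) - f x)| * `|h|.
  by move=> h0; rewrite -normrM -normrN; congr `|_|; field.
have quotE : (fun h : R => h^-1 *: ((f \o shift x) (h *: 1) - f x)) =
    (fun h : R => h^-1 * (f (x + h) - f x)).
  by apply/funext => h; rewrite /= [h *: _]mulr1 [h + x]addrC.
split=> [fd e e0|H].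
  have : ((h : R)^-1 * (f (x + h) - f x)) @[h --> 0^'] --> d.
    rewrite -quotE -(@derive_val _ _ _ _ _ _ _ fd).
    exact: (@ex_derive _ _ _ _ _ _ _ fd).
  move=> /cvgrPdist_le /(_ _ e0); rewrite /= near_withinE => -[dl /= dl0 hdl].
  exists dl => // h hd; have [->|h0] := eqVneq h 0.
    by rewrite addr0 subrr mulr0 subr0 normr0 mulr0.
  rewrite key// ler_wpM2r//.
  by have := hdl h; rewrite /ball_/= sub0r normrN => /(_ hd h0).
have C : ((h : R)^-1 * (f (x + h) - f x)) @[h --> 0^'] --> d.
  apply/cvgrPdist_le => e e0; have [dl dl0 hdl] := H _ e0.
  rewrite /= near_withinE; exists dl => //= h; rewrite /ball_/= sub0r normrN => hd h0.
  by have := hdl _ hd; rewrite key// ler_pM2r// normr_gt0.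
rewrite -quotE in C; apply: DeriveDef; first by apply/cvg_ex; exists d.
exact/cvg_lim.
Qed.

Lemma is_derive_glue (f g1 g2 : R -> R) (x d : R) :
  (forall y, y <= x -> f y = g1 y) -> (forall y, x <= y -> f y = g2 y) ->
  is_derive x (1 : R) g1 d -> is_derive x (1 : R) g2 d ->
  is_derive x (1 : R) f d.
Proof.
move=> f1 f2 /is_derive_epsP d1 /is_derive_epsP d2; apply/is_derive_epsP => e e0.
have [e1 e10 h1] := d1 _ e0; have [e2 e20 h2] := d2 _ e0.
exists (Num.min e1 e2); first by rewrite lt_min e10.
move=> h; rewrite lt_min => /andP[he1 he2]; have [h0|h0] := leP h 0.
  by rewrite !f1 ?gerDl//; exact: h1.
by have hW := ltW h0; rewrite !f2 ?lerDl//; exact: h2.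
Qed.

Definition smooth f : Prop := forall n x, derivable (derive1n n f) x 1.

Lemma derives_derive1 f g : derives f g -> (derive1 f) = g.
Proof.
move=> fg; apply/funext => x.
by rewrite derive1E; apply: (@derive_val _ _ _ _ _ _ _ (fg x)).
Qed.

Lemma derives_derivable f g x : derives f g -> derivable f x 1.
Proof. by move=> fg; apply: (@ex_derive _ _ _ _ _ _ _ (fg x)). Qed.

(** Smoothness by coinduction: membership in a class of functions whose
    derivatives stay in the class. *)
Lemma smooth_class (S : (R -> R) -> Prop) :
  (forall f, S f -> exists2 g, derives f g & S g) -> forall f, S f -> smooth f.
Proof.
move=> HS f Sf n; elim: n f Sf => [|n IH] f /HS[g fg Sg] x.
  by rewrite derive1n0; exact: derives_derivable fg.
by rewrite derive1Sn (derives_derive1 fg); exact: IH.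
Qed.

Lemma smooth_derives f : smooth f -> derives f (derive1 f).
Proof.
move=> sf x; apply: DeriveDef; last by rewrite derive1E.
by have := sf 0%N x; rewrite derive1n0.
Qed.

Lemma smooth_derive f : smooth f -> smooth (derive1 f).
Proof. by move=> sf n x; rewrite -derive1Sn; exact: sf. Qed.

Lemma smooth_continuous f : smooth f -> continuous f.
Proof. by move=> /smooth_derives/derives_continuous. Qed.

Lemma smooth_of_derives f g : derives f g -> smooth g -> smooth f.
Proof.
move=> fg sg [|n] x; first by rewrite derive1n0; exact: derives_derivable fg.
by rewrite derive1Sn (derives_derive1 fg).
Qed.

Inductive smooth_products : (R -> R) -> Prop :=
| SPmul f g : smooth f -> smooth g -> smooth_products (fun x => f x * g x)
| SPadd f g : smooth_products f -> smooth_products g ->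
    smooth_products (fun x => f x + g x).

Lemma smoothM f g : smooth f -> smooth g -> smooth (fun x => f x * g x).
Proof.
move=> sf sg; apply: (smooth_class (S := smooth_products)); last exact: SPmul.
move=> {sf sg f g} h; elim=> [f g sf sg|f g _ [f' ff' Sf'] _ [g' gg' Sg']].
  eexists; first exact: derivesM (smooth_derives sf) (smooth_derives sg).
  apply: SPadd; apply: SPmul.
  - exact: smooth_derive sf.
  - exact: sg.
  - exact: sf.
  - exact: smooth_derive sg.
by eexists; [exact: derivesD ff' gg'|exact: SPadd].
Qed.

Lemma smoothD f g : smooth f -> smooth g -> smooth (fun x => f x + g x).
Proof.
move=> sf sg; apply: (smooth_class (S := fun h => exists f g,
  [/\ smooth f, smooth g & h = fun x => f x + g x])); last by exists f, g.
move=> {sf sg f g} _ [f [g [sf sg ->]]].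
eexists; first exact: derivesD (smooth_derives sf) (smooth_derives sg).
exists (derive1 f), (derive1 g); split.
- exact: smooth_derive sf.
- exact: smooth_derive sg.
- by [].
Qed.

Lemma smooth_affine k f a c : smooth f -> smooth (fun x => k * f (a * x + c)).
Proof.
move=> sf; apply: (smooth_class (S := fun h => exists k f,
  smooth f /\ h = fun x => k * f (a * x + c))); last by exists k, f.
move=> {sf f k} _ [k [f [sf ->]]].
have da : derives (fun x => a * x + c) (fun=> a).
  have := derivesD (derivesZ a (@derives_id R)) (derives_cst c).
  by apply: eq_derives => // x; ring.
exists (fun x => (k * a) * (derive1 f) (a * x + c)).
  have := derivesZ k (derives_comp (smooth_derives sf) da).
  by apply: eq_derives => x //; ring.
exists (k * a), (derive1 f); split; last by [].
exact: smooth_derive sf.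
Qed.

Lemma smoothZ k f : smooth f -> smooth (fun x => k * f x).
Proof.
move=> sf; have := @smooth_affine k f 1 0 sf.
by congr (smooth _); apply/funext => x; congr (_ * f _); ring.
Qed.

(** A class stable under derivation, because 1/x has a polynomial in 1/x as its
    derivative; at the origin all the derivatives vanish, so that translates and
    reflections have products that are smooth with compact support. *)
Definition flat (p : {poly R}) x : R :=
  if 0 < x then p.[x^-1] * expR (- x^-1) else 0.

Lemma poly_expR_bounded (p : {poly R}) :
  exists2 C : R, 0 <= C & forall y, 0 < y -> `|p.[y]| * expR (- y) <= C.
Proof.
suff [C C0 HC] : exists2 C : R, 0 <= C & forall y, 0 < y -> `|p.[y]| <= C * expR y.
  exists C => // y /HC; rewrite expRN => h.
  by rewrite ler_pdivrMr// expR_gt0.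
suff H : forall m : nat, exists2 C : R, 0 <= C &
    forall y, 0 < y -> `|p.[y]| <= C * expR (y / m.+1%:R).
  by have [C C0 HC] := H 0%N; exists C => // y /HC; rewrite divr1.
elim/poly_ind: p => [|p c IH] m.
  by exists 0 => // y _; rewrite horner0 normr0 mul0r.
have [C C0 HC] := IH (m.+1.*2.-1).
pose d : R := m.+1.*2%:R.
have d0 : 0 < d by rewrite /d ltr0n.
exists (C * d + `|c|); first by rewrite addr_ge0 ?mulr_ge0 ?normr_ge0// ltW.
move=> y y0; rewrite hornerD hornerM hornerX hornerC mulrDl.
apply: le_trans (ler_normD _ _) _; rewrite lerD//; last first.
  rewrite ler_peMr ?normr_ge0//.
  apply: le_trans (expR_ge1Dx _); rewrite lerDl divr_ge0 ?ltW//.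
  (* half of the exponential absorbs the factor y, the other half bounds p *)
rewrite normrM (gtr0_norm y0).
have h : y <= d * expR (y / d).
  have := expR_ge1Dx (y / d).
  rewrite -(ler_pM2l d0) => /(le_trans _); apply.
  by rewrite mulrDr mulr1 mulrCA divff ?gt_eqF// mulr1 lerDr ltW.
have -> : y / m.+1%:R = y / d + y / d.
  have : m.+1%:R != 0 :> R by rewrite pnatr_eq0.
  by rewrite /d -muln2 natrM; move: (m.+1%:R) => M M0; field.
rewrite expRD -mulrA [d * _]mulrCA !mulrA -mulrA.
by apply: ler_pM => //; [exact: ltW|have := HC _ y0; rewrite prednK].
Qed.

Lemma flat_derives (p : {poly R}) : derives (flat p) (flat ('X^2 * (p - p^`()))).
Proof.
move=> x; have [x0|x0|->] := ltgtP x 0.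
- rewrite [X in is_derive _ _ _ X]/flat ltNge (ltW x0)/=.
  apply: near_eq_is_derive (is_derive_cst 0 x 1).
  near=> y; rewrite /flat ltNge; suff -> : y <= 0 by [].
  by near: y; exact: lt_le_nbhsl.
- rewrite [X in is_derive _ _ _ X]/flat x0.
  have dV : is_derive x (1 : R) (fun y : R => y^-1) (- x ^- 2).
    apply: is_derive_eq (is_deriveV (f := id) _ (is_derive_id _ _)) _.
      by rewrite gt_eqF.
    by rewrite /GRing.scale/= mulr1.
  have d1 := is_derive1_comp (is_derive_poly p x^-1) dV.
  have d2 := is_derive1_comp (is_derive_expR _) (is_deriveN dV).
  have D : is_derive x (1 : R) (fun y : R => p.[y^-1] * expR (- y^-1))
      (('X^2 * (p - p^`())).[x^-1] * expR (- x^-1)).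
    apply: is_derive_eq (is_deriveM d1 d2) _.
    rewrite /GRing.scale/= !(hornerE, hornerXn).
    by rewrite -exprVn /=; ring.
  apply: near_eq_is_derive D; near=> y; rewrite /flat.
  suff -> : 0 < y by [].
  by near: y; exact: lt_nbhsr.
- rewrite [X in is_derive _ _ _ X]/flat ltxx; apply/is_derive_epsP => e e0.
  have [C C0 HC] := poly_expR_bounded ('X^2 * p).
  exists (e / (C + 1)); first by rewrite divr_gt0// ltr_wpDl.
  move=> h he; rewrite mul0r add0r subr0 {2}/flat ltxx subr0 /flat.
  case: ifPn => [h0|_]; last by rewrite normr0 mulr_ge0// ltW.
  have hV : 0 < h^-1 by rewrite invr_gt0.
  have := HC _ hV; rewrite hornerM hornerXn normrM (ger0_norm (sqr_ge0 _)) => hC.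
  rewrite normrM (gtr0_norm (expR_gt0 _)) (gtr0_norm h0).
  have -> : `|p.[h^-1]| * expR (- h^-1) =
      h ^+ 2 * (h^-1 ^+ 2 * `|p.[h^-1]| * expR (- h^-1)).
    by field; rewrite gt_eqF.
  apply: le_trans (_ : h ^+ 2 * (C + 1) <= _).
    rewrite ler_wpM2l ?sqr_ge0//; lra.
  rewrite expr2 mulrAC ler_pM2r// -ler_pdivlMr ?ltr_wpDl//.
  by rewrite ltW// -(gtr0_norm h0).
Unshelve. all: by end_near. Qed.

Lemma smooth_flat (p : {poly R}) : smooth (flat p).
Proof.
apply: (smooth_class (S := fun f => exists p, f = flat p)); last by exists p.
move=> _ [q ->]; exists (flat ('X^2 * (q - q^`()))); first exact: flat_derives.
by eexists.
Qed.

(** As [n] grows, these increase to the indicator of ]s, t[ without leaving its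
    support. *)
Definition hump s t (n : nat) x : R :=
  flat 1 (n.+1%:R * (x - s)) * flat 1 (n.+1%:R * (t - x)).

Lemma smooth_hump s t n : smooth (hump s t n).
Proof.
rewrite /hump; apply: smoothM.
  have := @smooth_affine 1 (flat 1) n.+1%:R (- (n.+1%:R * s)) (@smooth_flat 1).
  by congr (smooth _); apply/funext => x; rewrite mul1r mulrBr.
have := @smooth_affine 1 (flat 1) (- n.+1%:R) (n.+1%:R * t) (@smooth_flat 1).
by congr (smooth _); apply/funext => x; rewrite mul1r mulrBr mulNr addrC.
Qed.

Lemma flat1_itv x : 0 <= flat 1 x <= 1.
Proof.
rewrite /flat; case: ifPn => [x0|_]; last by rewrite lexx ler01.
by rewrite hornerC mul1r expR_ge0/= -expR0 ler_expR oppr_le0 invr_ge0 ltW.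
Qed.

Lemma flat1_gt0 x : 0 < x -> 0 < flat 1 x.
Proof. by rewrite /flat => ->; rewrite hornerC mul1r expR_gt0. Qed.

Lemma flat1_le0 x : x <= 0 -> flat 1 x = 0.
Proof. by rewrite /flat leNgt => /negbTE ->. Qed.

Lemma hump_itv s t n x : 0 <= hump s t n x <= 1.
Proof.
rewrite /hump; have /andP[a0 a1] := flat1_itv (n.+1%:R * (x - s)).
have /andP[b0 b1] := flat1_itv (n.+1%:R * (t - x)).
by rewrite mulr_ge0//= mulr_ile1.
Qed.

Lemma hump_gt0 s t n x : s < x < t -> 0 < hump s t n x.
Proof. by move=> /andP[sx xt]; rewrite mulr_gt0// flat1_gt0// mulr_gt0// subr_gt0. Qed.

Lemma hump_out s t n x : ~~ (s < x < t) -> hump s t n x = 0.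
Proof.
rewrite negb_and -!leNgt /hump => /orP[xs|tx].
  by rewrite flat1_le0 ?mul0r// pmulr_rle0// subr_le0.
by rewrite (flat1_le0 (x := _ * (t - x))) ?mulr0// pmulr_rle0// subr_le0.
Qed.

Lemma cvg_flat1 x : 0 < x -> flat 1 (n.+1%:R * x) @[n --> \oo] --> (1 : R).
Proof.
move=> x0.
have -> : (fun n : nat => flat 1 (n.+1%:R * x)) =
    (fun n : nat => expR (- (x^-1 * n.+1%:R^-1))).
  apply/funext => n; rewrite /flat mulr_gt0// hornerC mul1r.
  by rewrite invfM mulrC.
rewrite -[X in _ --> X]expR0; apply: continuous_cvg; first exact: continuous_expR.
rewrite -[X in _ --> X]oppr0 -[X in _ --> - X](mulr0 x^-1).
apply: cvgN; apply: cvgM; first exact: cvg_cst.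
exact: cvg_harmonic.
Qed.

Lemma cvg_hump s t x : s < x < t -> hump s t n x @[n --> \oo] --> (1 : R).
Proof.
move=> /andP[sx xt]; rewrite -[X in _ --> X]mulr1.
by apply: cvgM; apply: cvg_flat1; rewrite subr_gt0.
Qed.

End Smooth.

(** * Weak derivatives on the unit interval *)

Section Weak_derivatives.
Variable R : realType.
Local Notation mu := (@lebesgue_measure R).
Local Notation I01 := (`]0, 1[%classic : set R).
Implicit Types (f g phi psi u v w z : R -> R) (a b c k x s t : R).

Lemma ae_imp (P Q : R -> Prop) : (forall x, P x -> Q x) ->
  {ae mu, forall x, P x} -> {ae mu, forall x, Q x}.
Proof. move=> PQ; apply: filterS => //; exact: (ae_filter_ringOfSetsType mu). Qed.

Definition tst phi : Prop := smooth phi /\ exists s t,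
  [/\ 0 < s, s < t, t < 1 & forall x, ~~ (s <= x <= t) -> phi x = 0].

Definition locint01 z : Prop := forall s t, 0 < s -> t < 1 -> Itg s t z.

Lemma closed_avoid (K : set R) x : closed K -> ~ K x ->
  exists2 e : R, 0 < e & forall y, K y -> e <= `|y - x|.
Proof.
move=> cK Kx; have oK := closed_openC cK.
have /nbhs_ballP[e /= e0 he] : nbhs x (~` K) by exact: open_nbhs_nbhs.
exists e => // y Ky; rewrite leNgt; apply/negP => yx.
by apply: (he y) => //; rewrite /ball/= distrC.
Qed.

Lemma test_functionP phi : test_function I01 phi <-> tst phi.
Proof.
split=> [[sphi cK K01]|[sphi [s [t [s0 st t1 out]]]]].
  split=> //; have cl := @closed_closure R [set x | phi x != 0].
  have [e e0 he] : exists2 e : R, 0 < e &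
      forall y, closure [set x | phi x != 0] y -> e <= `|y - 0|.
    by apply: closed_avoid => // /K01 /=; rewrite in_itv/= ltxx.
  have [d d0 hd] : exists2 e : R, 0 < e &
      forall y, closure [set x | phi x != 0] y -> e <= `|y - 1|.
    by apply: closed_avoid => // /K01 /=; rewrite in_itv/= ltxx andbF.
  exists (Num.min (e / 2) (1/4)), (1 - Num.min (d / 2) (1/4)).
  have e2 : 0 < Num.min (e / 2) (1 / 4) by rewrite lt_min; lra.
  have d2 : 0 < Num.min (d / 2) (1 / 4) by rewrite lt_min; lra.
  have e3 : Num.min (e / 2) (1 / 4) <= 1/4 by rewrite ge_min lexx orbT.
  have d3 : Num.min (d / 2) (1 / 4) <= 1/4 by rewrite ge_min lexx orbT.
  have e4 : Num.min (e / 2) (1 / 4) <= e / 2 by rewrite ge_min lexx.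
  have d4 : Num.min (d / 2) (1 / 4) <= d / 2 by rewrite ge_min lexx.
  split; [lra|lra|lra|move=> x; apply: contraNeq => px].
  have Kx : closure [set x | phi x != 0] x by apply: subset_closure.
  have := K01 _ Kx; rewrite /= in_itv/= => /andP[x0 x1].
  have := he _ Kx; have := hd _ Kx.
  by rewrite subr0 (gtr0_norm x0) ltr0_norm; [move=> h1 h2; apply/andP; split; lra|lra].
have sub : closure [set x | phi x != 0] `<=` `[s, t]%classic.
  have /closure_id -> : closed (`[s, t]%classic : set R) by exact: interval_closed.
  apply: closure_subset => x /=; rewrite in_itv/=; apply: contraNT => nx.
  by rewrite out.
split => //.
- apply: subclosed_compact sub; first exact: closed_closure.
  exact: segment_compact.
- move=> x /sub /=; rewrite !in_itv/= => /andP[sx xt].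
  by rewrite (lt_le_trans s0)//= (le_lt_trans xt).
Qed.

Lemma tst_smooth phi : tst phi -> smooth phi. Proof. by case. Qed.

Lemma tst_continuous phi : tst phi -> continuous phi.
Proof. by move=> [/smooth_continuous]. Qed.

Lemma is_derive_outside phi s t x :
  (forall y, ~~ (s <= y <= t) -> phi y = 0) -> ~~ (s <= x <= t) ->
  is_derive x (1 : R) phi 0.
Proof.
rewrite negb_and -!ltNge => out xst.
apply: near_eq_is_derive (is_derive_cst (0 : R) x 1).
case/orP: xst => [xs|tx]; near=> y; rewrite out// negb_and -!ltNge.
  by apply/orP; left; near: y; exact: lt_nbhsl.
by apply/orP; right; near: y; exact: lt_nbhsr.
Unshelve. all: by end_near. Qed.

Lemma tst_derive phi : tst phi -> tst (derive1 phi).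
Proof.
move=> [sphi [s [t [s0 st t1 out]]]]; split; first exact: smooth_derive.
exists s, t; split => // x xst; have D := is_derive_outside out xst.
by rewrite derive1E; apply: (@derive_val _ _ _ _ _ _ _ D).
Qed.

Lemma tst_hump s t n : 0 < s -> s < t -> t < 1 -> tst (hump s t n).
Proof.
move=> s0 st t1; split; first exact: smooth_hump.
exists s, t; split => // x sxt; apply: hump_out; apply: contra sxt.
by move=> /andP[/ltW -> /ltW ->].
Qed.

Lemma tst_lin k phi psi : tst phi -> tst psi -> tst (fun x => phi x + k * psi x).
Proof.
move=> [sp [s [t [s0 st t1 out]]]] [sp' [s' [t' [s0' st' t1' out']]]].
split.
  by apply: smoothD; [exact: sp|apply: smoothZ; exact: sp'].
exists (Num.min s s'), (Num.max t t'); split.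
- by rewrite lt_min s0.
- by rewrite lt_max gt_min st.
- by rewrite gt_max t1.
- move=> x nx; rewrite out ?out' ?mulr0 ?addr0//; apply: contra nx.
    by move=> /andP[a b]; rewrite ge_min le_max a b !orbT.
  by move=> /andP[a b]; rewrite ge_min le_max a b.
Qed.

(** The support is enlarged a little, so that integrations by parts over the
    segment leave no boundary terms. *)
Lemma tst_segments phi : tst phi -> exists s t,
  [/\ 0 < s, s < t, t < 1 &
      forall n x, ~~ (s < x < t) -> derive1n n phi x = 0].
Proof.
move=> [sp [s [t [s0 st t1 out]]]]; exists (s / 2), ((t + 1) / 2).
split; [lra|lra|lra|move=> n x nx].
have {nx} : ~~ (s <= x <= t).
  by apply: contra nx => /andP[? ?]; apply/andP; split; lra.
elim: n x => [|n IH] x xst; first by rewrite derive1n0 out.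
rewrite derive1nS derive1E.
suff D : is_derive x (1 : R) (derive1n n phi) 0 by apply: (@derive_val _ _ _ _ _ _ _ D).
exact: is_derive_outside xst.
Qed.

Lemma tst_segment phi : tst phi -> exists s t,
  [/\ 0 < s, s < t, t < 1 & forall x, ~~ (s < x < t) -> phi x = 0].
Proof.
move=> /tst_segments[s [t [s0 st t1 out]]]; exists s, t; split => // x nx.
by rewrite -(out 0%N x nx) derive1n0.
Qed.

Lemma Rintegral_support (A D : set R) g : A `<=` D ->
  (forall x, ~ A x -> g x = 0) ->
  \int[mu]_(x in D) g x = \int[mu]_(x in A) g x.
Proof.
move=> AD g0; rewrite Rintegral_mkcond [RHS]Rintegral_mkcond.
congr (Rintegral _ _ _); apply/funext => x; rewrite !patchE.
have [xA|xA] := pselect (A x); first by rewrite !mem_set//; exact: AD.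
by rewrite (memNset xA) g0//; case: ifP.
Qed.

Lemma Int_support z phi s t : 0 < s -> t < 1 ->
  (forall x, ~~ (s < x < t) -> phi x = 0) ->
  \int[mu]_(x in I01) (z x * phi x) = Int s t (fun x => z x * phi x).
Proof.
move=> s0 t1 out; apply: Rintegral_support.
  move=> x /=; rewrite !in_itv/= => /andP[sx xt].
  by rewrite (lt_le_trans s0)//= (le_lt_trans xt).
move=> x /=; rewrite in_itv/= => /negP nx; rewrite out ?mulr0//.
by apply: contra nx => /andP[/ltW -> /ltW ->].
Qed.

Lemma Int_open s t f : Itg s t f -> Int s t f = \int[mu]_(x in `]s, t[) f x.
Proof.
move=> fi; rewrite /Int -Rintegral_itv_obnd_cbnd; last first.
  by apply: integrableS fi => //; apply: subset_itv; rewrite bnd_simp.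
rewrite -Rintegral_itv_bndo_bndc//.
by apply: integrableS fi => //; apply: subset_itv; rewrite bnd_simp.
Qed.

Lemma measurable_locint01 z s t : locint01 z -> 0 < s -> t < 1 ->
  measurable_fun `]s, t[ z.
Proof.
move=> zi s0 t1; have /integrableP[/measurable_EFinP + _] := zi _ _ s0 t1.
apply: measurable_funS => //; apply: subset_itv; rewrite bnd_simp//.
Qed.

(** By dominated convergence along the bumps of ]s, t[. *)
Lemma Int_null_of_tst z s t : locint01 z ->
  (forall phi, tst phi -> \int[mu]_(x in I01) (z x * phi x) = 0) ->
  0 < s -> s < t -> t < 1 -> Int s t z = 0.
Proof.
move=> zi z0 s0 st t1; rewrite Int_open; last exact: zi.
pose D : set R := `]s, t[%classic.
have mD : measurable D by exact: measurable_itv.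
have DE x : D x = (s < x < t) by rewrite /D/= in_itv.
have mz : measurable_fun D z by exact: measurable_locint01.
have iz : mu.-integrable D (EFin \o z).
  by apply: integrableS (zi _ _ s0 t1) => //; apply: subset_itv; rewrite bnd_simp.
have mphi n : measurable_fun D (hump s t n).
  apply: (measurable_funS measurableT) => //.
  apply: continuous_measurable_fun.
  exact/smooth_continuous/smooth_hump.
have [] := @dominated_convergence _ _ _ mu D mD
  (fun n x => (z x * hump s t n x)%:E) (EFin \o z) (fun x => `|z x|%:E).
- by move=> n; apply/measurable_EFinP; exact: measurable_funM mz (mphi n).
- exact/measurable_EFinP.
- apply: aeW => x; rewrite DE => xst.
  apply/fine_cvgP; split; first by apply: nearW.
  rewrite -[X in _ --> X](mulr1 (z x)).
  by apply: cvgM; [exact: cvg_cst|exact: cvg_hump].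
- exact: (integrable_norm iz).
- apply: aeW => x n _; rewrite lee_fin normrM ler_piMr//.
  by have /andP[p0 p1] := hump_itv s t n x; rewrite ger0_norm.
move=> _ _ C; apply/eqP; rewrite -eqe; apply/eqP.
have -> : (\int[mu]_(x in `]s, t[) z x)%:E = (\int[mu]_(x in D) (EFin \o z) x)%E.
  by rewrite /Rintegral fineK//; exact: integrable_fin_num.
apply/esym; rewrite -(cvg_lim _ C)//; apply/esym/cvg_lim => //.
rewrite [X in X @ _](_ : _ = fun=> 0%E); first exact: cvg_cst.
apply/funext => n.
have iphi : mu.-integrable D (fun x => (z x * hump s t n x)%:E).
  apply: le_integrable iz => //.
    by apply/measurable_EFinP; exact: measurable_funM mz (mphi n).
  move=> x _ /=; rewrite lee_fin normrM ler_piMr//.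
  by have /andP[p0 p1] := hump_itv s t n x; rewrite ger0_norm.
rewrite -[LHS]fineK; last exact: integrable_fin_num.
rewrite -[fine _]/(Rintegral mu D (fun x => z x * hump s t n x)).
rewrite -(Rintegral_support (D := I01)) ?z0//; first exact: tst_hump.
  by apply: subset_itv; rewrite bnd_simp ltW.
by move=> x; rewrite DE => /negP/hump_out ->; rewrite mulr0.
Qed.

(** Every primitive of [z] is constant, so that the theorem of Lebesgue on the
    differentiation of integrals gives the value 0 almost everywhere. *)
Lemma ae_null_of_tst z : locint01 z ->
  (forall phi, tst phi -> \int[mu]_(x in I01) (z x * phi x) = 0) ->
  {ae mu, forall x, 0 < x < 1 -> z x = 0}.
Proof.
move=> zi z0; pose s (n : nat) : R := n.+3%:R^-1.
have s0 n : 0 < s n by rewrite invr_gt0.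
have s1 n : s n < 1 / 2.
  rewrite /s div1r ltf_pV2 ?posrE// ltr_nat//.
suff H n : {ae mu, forall x, s n < x < 1 - s n -> z x = 0}.
  have := ae_foralln H; apply: ae_imp => x Hx /andP[x0 x1].
  have m0 : 0 < Num.min x (1 - x) by rewrite lt_min x0 subr_gt0.
  have [n hn] : exists n, s n < Num.min x (1 - x).
    have /cvgrPdist_lt/(_ _ m0)[n _ /(_ n.+2)/=] := @cvg_harmonic R.
    rewrite sub0r normrN ger0_norm ?invr_ge0// => /(_ (leqW (leqnSn _))) hn.
    by exists n.
  move: hn; rewrite lt_min => /andP[h1 h2]; apply: (Hx n); rewrite h1/=; lra.
pose f := z \_ `[s n, 1 - s n].
have fi : Itg (s n) (1 - s n) z by apply: zi; rewrite ?ltrBlDr ?ltrDl.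
have intf y : mu.-integrable [set` Interval (BLeft (s n)) (BRight y)] (EFin \o f).
  rewrite -restrict_EFin; apply/integrable_restrict => //=.
  by apply: integrableS fi => //; exact: measurableI.
have lf : locally_integrable setT f by exact: integrable_locally_restrict.
have := FTC1 intf lf; apply: ae_imp => x /= Hx /andP[x0 x1].
have [|_] := Hx; first by rewrite lte_fin.
have xI : (x \in (`[s n, 1 - s n]%classic : set R)) = true.
  by apply/mem_set; rewrite /= in_itv/= !ltW.
rewrite {2}/f patchE xI => <-.
pose F0 y : R := \int[mu]_(t in [set` Interval (BLeft (s n)) (BRight y)]) f t.
rewrite -/F0 derive1E; suff D : is_derive x (1 : R) F0 0.
  by apply: (@derive_val _ _ _ _ _ _ _ D).
apply: near_eq_is_derive (is_derive_cst (0 : R) x 1).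
near=> y; have sy : s n < y by near: y; exact: lt_nbhsr.
have y1 : y < 1 - s n by near: y; exact: lt_nbhsl.
have y1' : y < 1 by have := s0 n; lra.
have <- : Int (s n) y z = F0 y.
  apply: eq_Rintegral => t; rewrite inE/= in_itv/= => /andP[st ty].
  by rewrite /f patchE mem_set//= in_itv/= st/= (le_trans ty)// ltW.
by rewrite (Int_null_of_tst zi z0).
Unshelve. all: by end_near. Qed.

Lemma locint01_continuous f : continuous f -> locint01 f.
Proof. by move=> cf s t _ _; exact: Itg_cont. Qed.

Lemma locint01B f g : locint01 f -> locint01 g -> locint01 (fun x => f x - g x).
Proof. by move=> fi gi s t s0 t1; apply: ItgB; [exact: fi|exact: gi]. Qed.

Lemma integral_tst_lin z k phi psi : locint01 z -> tst phi -> tst psi ->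
  \int[mu]_(x in I01) (z x * (phi x + k * psi x)) =
  \int[mu]_(x in I01) (z x * phi x) + k * \int[mu]_(x in I01) (z x * psi x).
Proof.
move=> zi tphi tpsi.
have [s [t [s0 st t1 out]]] := tst_segment tphi.
have [s' [t' [s0' st' t1' out']]] := tst_segment tpsi.
pose a := Num.min s s'; pose b := Num.max t t'.
have a0 : 0 < a by rewrite lt_min s0.
have b1 : b < 1 by rewrite gt_max t1.
have oa x : ~~ (a < x < b) -> phi x = 0.
  move=> nx; rewrite out//; apply: contra nx => /andP[? ?].
  by rewrite gt_min lt_max; apply/andP; split; apply/orP; left.
have ob x : ~~ (a < x < b) -> psi x = 0.
  move=> nx; rewrite out'//; apply: contra nx => /andP[? ?].
  by rewrite gt_min lt_max; apply/andP; split; apply/orP; right.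
rewrite !(@Int_support z _ a b)//; last first.
  by move=> x nx; rewrite oa// ob// mulr0 addr0.
have i1 f : tst f -> Itg a b (fun x => z x * f x).
  move=> tf; apply: eq_Itg (ItgM (tst_continuous tf) (zi _ _ a0 b1)) => x.
  by rewrite mulrC.
rewrite -IntZ -?IntD; [|exact: i1|exact/ItgZ/i1|exact: i1].
by apply: eq_Int => x _; ring.
Qed.

Lemma integral_tstB z w phi : locint01 z -> locint01 w -> tst phi ->
  \int[mu]_(x in I01) ((z x - w x) * phi x) =
  \int[mu]_(x in I01) (z x * phi x) - \int[mu]_(x in I01) (w x * phi x).
Proof.
move=> zi wi tphi; have [s [t [s0 st t1 out]]] := tst_segment tphi.
rewrite !(@Int_support _ _ s t)//.
have i1 f : locint01 f -> Itg s t (fun x => f x * phi x).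
  move=> fi; apply: eq_Itg (ItgM (tst_continuous tphi) (fi _ _ s0 t1)) => x.
  by rewrite mulrC.
rewrite -IntB; [|exact: i1|exact: i1].
by apply: eq_Int => x _; ring.
Qed.

Lemma tst_prim psi : tst psi -> \int[mu]_(x in I01) (1 * psi x) = 0 ->
  tst (prim psi).
Proof.
move=> tpsi; have [s [t [s0 st t1 out]]] := tst_segment tpsi.
rewrite (@Int_support (fun=> 1) _ s t)// => psi0.
have cpsi := tst_continuous tpsi.
have li : locint psi by move=> a b; exact: Itg_cont.
split; first exact: smooth_of_derives (derives_prim cpsi) (tst_smooth tpsi).
have null a b : a <= b -> (forall x, a <= x <= b -> psi x = 0) -> Int a b psi = 0.
  move=> ab p0; rewrite (eq_Int (g := fun=> 0)) ?Int_cst ?mul0r//.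
have pI : prim psi 0 = 0 by rewrite /prim subrr.
have le_s x : x <= s -> prim psi x = 0.
  have out_s y : y <= s -> psi y = 0.
    by move=> ys; rewrite out// negb_and -!leNgt ys.
  move=> xs; have [x0|x0] := leP x 0.
    have := primB li x0; rewrite pI null//; first by lra.
    by move=> y /andP[_ y0]; apply: out_s; rewrite (le_trans y0)// ltW.
  have := primB li (ltW x0); rewrite pI null//; [lra|exact: ltW|].
  by move=> y /andP[_ yx]; apply: out_s; rewrite (le_trans yx).
exists s, t; split => // x; rewrite negb_and -!ltNge => /orP[/ltW/le_s//|tx].
have := primB li (ltW (lt_trans st tx)); rewrite (le_s s)// subr0 => ->.
rewrite (Int_split (c := t)) ?ltW//.
have -> : Int s t psi = Int s t (fun x => 1 * psi x).
  by apply: eq_Int => y _; rewrite mul1r.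
rewrite psi0 add0r null ?ltW// => y /andP[ty _].
by rewrite out// negb_and -!leNgt ty orbT.
Qed.

(** Du Bois-Reymond: after subtraction of a multiple of a fixed test function
    of integral 1, every test function is the derivative of one. *)
Lemma ae_constant_of_tst z : locint01 z ->
  (forall phi, tst phi -> \int[mu]_(x in I01) (z x * derive1 phi x) = 0) ->
  exists k, {ae mu, forall x, 0 < x < 1 -> z x = k}.
Proof.
move=> zi z0.
pose I phi := \int[mu]_(x in I01) (1 * phi x : R).
have [h0 h1 h2] : [/\ 0 < 1/4 :> R, 1/4 < 1/2 :> R & 1/2 < 1 :> R] by split; lra.
pose h : R -> R := hump (1/4) (1/2) 0.
have th : tst h by exact: tst_hump.
have one1 : locint01 (fun=> 1) by apply: locint01_continuous => x; exact: cvg_cst.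
have Ih : 0 < I h.
  rewrite /I (@Int_support _ _ (1/4) (1/2))//; last by move=> x; exact: hump_out.
  rewrite lt0r; apply/andP; split; last first.
    apply: Int_ge0 => x _; rewrite mul1r.
    by have /andP[] := hump_itv (1/4) (1/2) 0 x.
  apply/eqP => hI.
  have ch := tst_continuous th.
  have ph : prim h (1/2) = prim h (1/4).
    apply/eqP; rewrite -subr_eq0 primB//; last 2 first.
    - by move=> a b; exact: Itg_cont.
    - exact: ltW.
    by apply/eqP; rewrite -[RHS]hI; apply: eq_Int => x _; rewrite mul1r.
  have [c] := MVT h1 (fun x _ => derives_prim ch x)
    (continuous_subspaceT (derives_continuous (derives_prim ch))).
  rewrite in_itv/= => cI; rewrite ph subrr => /esym/eqP.
  rewrite mulf_eq0 subr_eq0 (gt_eqF h1) orbF => /eqP hc.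
  by have := @hump_gt0 R (1/4) (1/2) 0 c cI; rewrite -/h hc ltxx.
pose k := (\int[mu]_(x in I01) (z x * h x)) / I h.
exists k.
have zki : locint01 (fun x => z x - k).
  by apply: locint01B => //; apply: locint01_continuous => x; exact: cvg_cst.
have ki : locint01 (fun=> k) by apply: locint01_continuous => x; exact: cvg_cst.
suff H phi : tst phi -> \int[mu]_(x in I01) ((z x - k) * phi x) = 0.
  have := ae_null_of_tst zki H; apply: ae_imp => x hx /hx/eqP.
  by rewrite subr_eq0 => /eqP.
move=> tphi; rewrite integral_tstB//.
pose c := - (I phi / I h).
pose psi x := phi x + c * h x.
have tpsi : tst psi by exact: tst_lin.
have Ipsi : I psi = 0.
  rewrite /I integral_tst_lin// -!/(I _) /c; field.
  by rewrite gt_eqF.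
have := z0 _ (tst_prim tpsi Ipsi).
rewrite (derives_derive1 (derives_prim (tst_continuous tpsi))).
rewrite integral_tst_lin// => zpsi.
have -> : \int[mu]_(x in I01) (k * phi x) = k * I phi.
  have [s [t [s0 st t1 out]]] := tst_segment tphi.
  rewrite /I !(@Int_support _ _ s t)// -IntZ; last first.
    by apply: ItgM; [move=> x; exact: cvg_cst|exact/Itg_cont/tst_continuous].
  by apply: eq_Int => x _; rewrite mul1r.
rewrite /k -[RHS]zpsi /c; field.
by rewrite gt_eqF.
Qed.

End Weak_derivatives.

(** * Functions of class H2 and the value of the functional *)

Section H2_representatives.
Variable R : realType.
Local Notation mu := (@lebesgue_measure R).
Local Notation I01 := (`]0, 1[%classic : set R).
Implicit Types (f F U W phi psi u v w z : R -> R) (a b c x s t : R).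

(** The continuous representatives of a function of class H2 and of its first
    derivative, with its second derivative [v]: unlike weak derivatives they can
    be evaluated at points. *)
Definition H2_rep U W v : Prop :=
  [/\ derives U W, continuous W, locint v, locint (fun x => v x ^+ 2) &
      forall a b, a <= b -> W b - W a = Int a b v].

Lemma locally_integrable_locint01 z : locally_integrable I01 z -> locint01 z.
Proof.
move=> [mz _ iz] s t s0 t1.
have sub : `[s, t]%classic `<=` I01.
  move=> x /=; rewrite !in_itv/= => /andP[sx xt].
  by rewrite (lt_le_trans s0)//= (le_lt_trans xt).
apply/integrableP; split; last by apply: iz => //; exact: segment_compact.
by apply/measurable_EFinP; apply: measurable_funS mz.
Qed.

Lemma Itg_locally_integrable z : Itg 0 1 z -> locally_integrable I01 z.
Proof.
move=> zi; apply: open_integrable_locally; first exact: interval_open.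
by apply: integrableS zi => //; apply: subset_itv; rewrite bnd_simp.
Qed.

Lemma weak_derivativeP k u v : is_weak_derivative I01 k u v <->
  [/\ locally_integrable I01 u, locally_integrable I01 v &
      forall phi, tst phi -> \int[mu]_(x in I01) (u x * derive1n k phi x) =
        (-1) ^+ k * \int[mu]_(x in I01) (v x * phi x)].
Proof.
by split=> -[lu lv H]; split => // phi /test_functionP/H.
Qed.

Lemma H2_rep_weak1 U W v : H2_rep U W v -> is_weak_derivative I01 1 U W.
Proof.
move=> [dU cW _ _ _]; have cU := derives_continuous dU.
apply/weak_derivativeP; split.
- exact/Itg_locally_integrable/Itg_cont.
- exact/Itg_locally_integrable/Itg_cont.
move=> phi tphi; have [s [t [s0 st t1 out]]] := tst_segments tphi.
have out0 x : ~~ (s < x < t) -> phi x = 0.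
  by move=> nx; rewrite -(out 0%N x nx) derive1n0.
rewrite !(@Int_support _ _ _ s t)//; last exact: out.
rewrite expr1 mulN1r; apply/eqP; rewrite -addr_eq0; apply/eqP.
rewrite (@Int_by_parts _ _ _ _ (derive1n 1 phi))//; first last.
- by rewrite derive1n1; exact/tst_continuous/tst_derive.
- by rewrite derive1n1; exact/smooth_derives/tst_smooth.
- by move=> x /andP[sx _]; rewrite (Int_derives sx cW dU); ring.
- exact: Itg_cont.
- exact: ltW.
by rewrite !out0 ?ltxx ?andbF//; ring.
Qed.

Lemma H2_rep_weak2 U W v : H2_rep U W v -> is_weak_derivative I01 2 U v.
Proof.
move=> r; have [dU cW vi _ Wv] := r; have cU := derives_continuous dU.
apply/weak_derivativeP; split.
- exact/Itg_locally_integrable/Itg_cont.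
- exact/Itg_locally_integrable/vi.
move=> phi tphi; have /weak_derivativeP[_ _ H] := H2_rep_weak1 r.
have := H _ (tst_derive tphi).
rewrite derive1n1 -(derive1n1 phi) -derive1nS => ->.
have [s [t [s0 st t1 out]]] := tst_segments tphi.
have out0 x : ~~ (s < x < t) -> phi x = 0.
  by move=> nx; rewrite -(out 0%N x nx) derive1n0.
rewrite !(@Int_support _ _ _ s t)//; last exact: out.
rewrite expr1 mulN1r sqrrN expr1n mul1r; apply/esym/eqP; rewrite -addr_eq0 addrC; apply/eqP.
rewrite (@Int_by_parts _ _ _ _ (derive1n 1 phi))//; first last.
- by rewrite derive1n1; exact/tst_continuous/tst_derive.
- by rewrite derive1n1; exact/smooth_derives/tst_smooth.
- by move=> x /andP[sx _]; rewrite -Wv//; ring.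
- exact: ltW.
by rewrite !out0 ?ltxx ?andbF//; ring.
Qed.

Lemma measurable_tst phi : tst phi -> measurable_fun I01 phi.
Proof.
move=> tphi; apply: (measurable_funS measurableT) => //.
by apply: continuous_measurable_fun; exact: tst_continuous tphi.
Qed.

Lemma eq_integral_tst u U phi : measurable_fun I01 u -> measurable_fun I01 U ->
  {ae mu, forall x, 0 < x < 1 -> u x = U x} -> tst phi ->
  \int[mu]_(x in I01) (u x * phi x) = \int[mu]_(x in I01) (U x * phi x).
Proof.
move=> mu_ mU uU tphi; congr fine; apply: ae_eq_integral => //.
- by apply/measurable_EFinP; exact: measurable_funM mu_ (measurable_tst tphi).
- by apply/measurable_EFinP; exact: measurable_funM mU (measurable_tst tphi).
- by apply: ae_imp uU => x + /=; rewrite in_itv/= => h /h ->.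
Qed.

Lemma tst_derive1n k phi : tst phi -> tst (derive1n k phi).
Proof.
by move=> tphi; elim: k => [|k IH]; [rewrite derive1n0|rewrite derive1nS; exact: tst_derive].
Qed.

Lemma ae_eq_weak_derivative k u U v : locally_integrable I01 u ->
  {ae mu, forall x, 0 < x < 1 -> u x = U x} ->
  is_weak_derivative I01 k U v -> is_weak_derivative I01 k u v.
Proof.
move=> lu uU /weak_derivativeP[lU lv H]; apply/weak_derivativeP; split => //.
move=> phi tphi; rewrite -H//; apply: eq_integral_tst => //; first by case: lu.
  by case: lU.
exact: tst_derive1n.
Qed.

Lemma weak_derivative_unique k u v w : is_weak_derivative I01 k u v ->
  is_weak_derivative I01 k u w -> {ae mu, forall x, 0 < x < 1 -> v x = w x}.
Proof.
move=> /weak_derivativeP[_ /locally_integrable_locint01 lv Hv].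
move=> /weak_derivativeP[_ /locally_integrable_locint01 lw Hw].
apply: ae_imp (@ae_null_of_tst _ (fun x => v x - w x) _ _) => [x h /h/eqP||phi tphi].
- by rewrite subr_eq0 => /eqP.
- exact: locint01B.
rewrite integral_tstB//; apply/eqP; rewrite subr_eq0; apply/eqP.
apply: (@mulfI _ ((-1) ^+ k)); first by rewrite signr_eq0.
by rewrite -Hv// Hw.
Qed.

Lemma locint_restrict v : mu.-integrable I01 (EFin \o v) -> locint (v \_ I01).
Proof.
move=> vi a b; rewrite /Itg -restrict_EFin.
have mI : measurable (I01 : set R) by [].
apply/integrable_restrict => //=.
by apply: integrableS vi => //; exact: measurableI.
Qed.

Lemma square_integrable_integrable v : square_integrable I01 v ->
  mu.-integrable I01 (EFin \o v).
Proof.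
move=> [mv iv]; have mI : measurable (I01 : set R) by [].
have i1 : mu.-integrable I01 (EFin \o (fun=> 1 : R)).
  have i1 : Itg 0 1 (fun=> 1 : R) by exact: Itg_cst.
  by apply: integrableS i1 => //; apply: subset_itv; rewrite bnd_simp.
have i2 : mu.-integrable I01 (EFin \o (fun x => 1 + v x ^+ 2)).
  by apply: (integrableD _ i1 iv).
apply: le_integrable i2 => //.
  exact/measurable_EFinP.
move=> x _ /=; rewrite lee_fin [leRHS]ger0_norm ?addr_ge0 ?sqr_ge0//.
rewrite ler_norml; apply/andP; split; nra.
Qed.

Lemma square_integrable_locint v : square_integrable I01 v ->
  locint (v \_ I01) /\ locint (fun x => (v \_ I01) x ^+ 2).
Proof.
move=> sv; split; first exact/locint_restrict/square_integrable_integrable.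
have [_ iv] := sv; have := @locint_restrict (fun x => v x ^+ 2) iv.
congr locint; apply/funext => x; rewrite !patchE.
by case: ifP => //; rewrite expr0n.
Qed.

(** Two applications of the lemma of du Bois-Reymond, to the first weak
    derivative and then to the function. *)
Lemma sobolev_H2_rep u : sobolev_H2 I01 u -> exists U W v,
  H2_rep U W v /\ {ae mu, forall x, 0 < x < 1 -> u x = U x}.
Proof.
move=> [su H].
have [v1 sv1 /weak_derivativeP[lu lv1 H1]] := H 1%N isT.
have [v2 sv2 /weak_derivativeP[_ lv2 H2]] := H 2%N isT.
have [vi vi2] := square_integrable_locint sv2.
pose v := v2 \_ I01; pose W0 := prim v.
have cW0 : continuous W0 by exact: continuous_prim.
have vphi phi : tst phi -> \int[mu]_(x in I01) (v2 x * phi x) =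
    \int[mu]_(x in I01) (v x * phi x).
  by move=> _; apply: eq_Rintegral => x xI; rewrite /v patchE xI.
have v1W phi : tst phi ->
    \int[mu]_(x in I01) ((v1 x - W0 x) * derive1 phi x) = 0.
  move=> tphi; have tphi' := tst_derive tphi.
  rewrite integral_tstB//; [|exact: locally_integrable_locint01|exact: locint01_continuous].
  have := H1 _ tphi'; rewrite expr1 mulN1r derive1n1.
  rewrite -(derive1n1 phi) -derive1nS H2// sqrrN expr1n mul1r derive1n1.
  rewrite -[LHS]opprK => /oppr_inj <-; rewrite vphi//.
  have [s [t [s0 st t1 out]]] := tst_segments tphi.
  have out0 x : ~~ (s < x < t) -> phi x = 0.
    by move=> nx; rewrite -(out 0%N x nx) derive1n0.
  rewrite !(@Int_support _ _ _ s t)//; last by move=> x /(out 1%N); rewrite derive1n1.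
  apply/eqP; rewrite -opprD oppr_eq0 addrC; apply/eqP.
  rewrite (@Int_by_parts _ _ _ _ (derive1 phi))//; first last.
  - exact: tst_continuous.
  - exact/smooth_derives/tst_smooth.
  - by move=> x /andP[sx _]; rewrite -primB// /W0; ring.
  - exact: ltW.
  by rewrite !out0 ?ltxx ?andbF//; ring.
have [k hk] : exists k, {ae mu, forall x, 0 < x < 1 -> v1 x - W0 x = k}.
  apply: ae_constant_of_tst v1W; apply: locint01B.
    exact: locally_integrable_locint01.
  exact: locint01_continuous.
pose W x := W0 x + k; pose U0 := prim W.
have cW : continuous W by move=> x; apply: cvgD; [exact: cW0|exact: cvg_cst].
have rep c : H2_rep (fun x => U0 x + c) W v.
  split => //.
    have := derivesD (derives_prim cW) (derives_cst c).
    by apply: eq_derives => x //; rewrite addr0.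
  by move=> a b ab; rewrite -primB// /W /W0; ring.
have rep0 : H2_rep U0 W v.
  by have := rep 0; congr H2_rep; apply/funext => x; rewrite addr0.
have cU0 : continuous U0 by exact: derives_continuous (derives_prim cW).
have v1E : {ae mu, forall x, 0 < x < 1 -> v1 x = W x}.
  by apply: ae_imp hk => x h /h hE; rewrite /W -hE; ring.
have mW : measurable_fun I01 W.
  by apply: (measurable_funS measurableT) => //; exact: continuous_measurable_fun.
have uU phi : tst phi ->
    \int[mu]_(x in I01) ((u x - U0 x) * derive1 phi x) = 0.
  move=> tphi; have tphi' := tst_derive tphi.
  rewrite integral_tstB//; [|exact: locally_integrable_locint01|exact: locint01_continuous].
  have := H1 _ tphi; rewrite derive1n1 => ->.
  have /weak_derivativeP[_ _ /(_ _ tphi)] := H2_rep_weak1 rep0.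
  rewrite derive1n1.
  have mv1 : measurable_fun I01 v1 by case: lv1.
  by rewrite (eq_integral_tst mv1 mW v1E tphi) => ->; rewrite subrr.
have [k' hk'] : exists k, {ae mu, forall x, 0 < x < 1 -> u x - U0 x = k}.
  apply: ae_constant_of_tst uU; apply: locint01B.
    exact: locally_integrable_locint01.
  exact: locint01_continuous.
exists (fun x => U0 x + k'), W, v; split; first exact: rep.
by apply: ae_imp hk' => x h /h <-; rewrite addrC subrK.
Qed.

(** The integrand of the functional; [A] stands for the coefficient
    eps^6 omega(eps)^4. *)
Definition density A beta F U W v x : R :=
  A * v x ^+ 2 + (ln (1 + W x ^+ 2) + beta * (U x - F x) ^+ 2).

Lemma continuous_sqr f : continuous f -> continuous (fun x => f x ^+ 2).
Proof. by move=> cf x; exact: (cvgM (cf x) (cf x)). Qed.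

Lemma continuous_ln1sq W : continuous W -> continuous (fun x => ln (1 + W x ^+ 2)).
Proof.
move=> cW x; apply: continuous_comp; last first.
  by apply: continuous_ln; have := sqr_ge0 (W x); lra.
by apply: cvgD; [exact: cvg_cst|exact: continuous_sqr].
Qed.

Lemma continuous_sqrB beta U F : continuous U -> continuous F ->
  continuous (fun x => beta * (U x - F x) ^+ 2).
Proof.
move=> cU cF x; apply: cvgM; first exact: cvg_cst.
by apply: (@continuous_sqr (fun y => U y - F y)) => y; exact: (cvgB (cU y) (cF y)).
Qed.

Lemma locint_density A beta F U W v : continuous F -> H2_rep U W v ->
  locint (density A beta F U W v).
Proof.
move=> cF [dU cW _ v2i _] a b; apply: ItgD; first exact: ItgZ.
apply: ItgD; apply: Itg_cont; first exact: continuous_ln1sq.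
exact: continuous_sqrB (derives_continuous dU) cF.
Qed.

(** Weak derivatives being unique up to null sets, the ones chosen in the
    functional can be replaced by [W] and [v]. *)
Lemma PMF_rep eps beta f F u U W v : locally_integrable I01 u ->
  {ae mu, forall x, 0 < x < 1 -> u x = U x} -> H2_rep U W v ->
  continuous F -> (forall x, 0 < x < 1 -> f x = F x) ->
  PMF eps beta f I01 u =
    (Int 0 1 (density (eps ^+ 6 * omega eps ^+ 4) beta F U W v))%:E.
Proof.
move=> lu uU r cF fF; have [dU cW vi v2i Wv] := r.
have wd k V : is_weak_derivative I01 k U V ->
    measurable_fun I01 (weak_derivative I01 k u) /\
    {ae mu, forall x, 0 < x < 1 -> weak_derivative I01 k u x = V x}.
  move=> /(ae_eq_weak_derivative lu uU) h.
  have h' : is_weak_derivative I01 k u (weak_derivative I01 k u).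
    by apply: (@getPex _ [set v | is_weak_derivative I01 k u v]); exists V.
  by split; [case: h' => _ []|exact: weak_derivative_unique h' h].
have [m1 e1] := wd _ _ (H2_rep_weak1 r).
have [m2 e2] := wd _ _ (H2_rep_weak2 r).
have mcont (g : R -> R) : continuous g -> measurable_fun I01 g.
  by move=> cg; apply: (measurable_funS measurableT) => //; exact: continuous_measurable_fun.
have di := locint_density (eps ^+ 6 * omega eps ^+ 4) beta cF r.
have di01 : mu.-integrable I01
    (EFin \o density (eps ^+ 6 * omega eps ^+ 4) beta F U W v).
  by apply: integrableS (di 0 1) => //; apply: subset_itv; rewrite bnd_simp.
rewrite Int_open// /Rintegral fineK; last exact: integrable_fin_num.
apply: ae_eq_integral => //.
- apply/measurable_EFinP.
  apply: measurable_funD; first apply: measurable_funD.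
  + by apply: measurable_funM => //; exact: measurable_funX.
  + apply: measurableT_comp => //.
    by apply: measurable_funD => //; exact: measurable_funX.
  + apply: measurable_funM => //; apply: measurable_funX.
    apply: measurable_funB; first by case: lu.
    apply: (eq_measurable_fun F); last exact: mcont.
    by move=> x; rewrite inE/= in_itv/= => /fF ->.
- by case/integrableP: di01.
- have : {ae mu, forall x : R, [/\ 0 < x < 1 -> u x = U x,
      0 < x < 1 -> weak_derivative I01 1 u x = W x &
      0 < x < 1 -> weak_derivative I01 2 u x = v x]}.
    apply: filterS3 uU e1 e2; first exact: (ae_filter_ringOfSetsType mu).
    by move=> x; split.
  apply: ae_imp => x [h0 h1 h2] /=; rewrite in_itv/= => x01.
  by rewrite h0// h1// h2// fF// /density addrA.
Qed.

Lemma sobolev_H2_density u : sobolev_H2 I01 u -> exists U W v,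
  H2_rep U W v /\
  forall eps beta f F, continuous F -> (forall x, 0 < x < 1 -> f x = F x) ->
    PMF eps beta f I01 u =
      (Int 0 1 (density (eps ^+ 6 * omega eps ^+ 4) beta F U W v))%:E.
Proof.
move=> su; have [U [W [v [r uU]]]] := sobolev_H2_rep su.
exists U, W, v; split => // eps beta f F cF fF.
by apply: PMF_rep => //; case: su => _ /(_ 1%N isT)[? _ []].
Qed.

Lemma square_integrable_continuous f : continuous f -> square_integrable I01 f.
Proof.
move=> cf; split.
  by apply: (measurable_funS measurableT) => //; exact: continuous_measurable_fun.
have i : Itg 0 1 (fun x => f x ^+ 2).
  exact/Itg_cont/continuous_sqr.
by apply: integrableS i => //; apply: subset_itv; rewrite bnd_simp.
Qed.

Lemma C2_sobolev_H2 U W v : derives U W -> derives W v -> continuous v ->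
  sobolev_H2 I01 U /\
  forall eps beta f F, continuous F -> (forall x, 0 < x < 1 -> f x = F x) ->
    PMF eps beta f I01 U =
      (Int 0 1 (density (eps ^+ 6 * omega eps ^+ 4) beta F U W v))%:E.
Proof.
move=> dU dW cv; have cW := derives_continuous dW; have cU := derives_continuous dU.
have r : H2_rep U W v.
  split => //; [by move=> a b; exact: Itg_cont| |].
    by move=> a b; exact/Itg_cont/continuous_sqr.
  by move=> a b ab; rewrite (Int_derives ab cv dW).
split.
  split; first exact: square_integrable_continuous.
  move=> [|[|[|k]]]// _.
    by exists W; [exact: square_integrable_continuous|exact: H2_rep_weak1 r].
  by exists v; [exact: square_integrable_continuous|exact: H2_rep_weak2 r].
move=> eps beta f F cF fF; apply: PMF_rep => //.
  exact/Itg_locally_integrable/Itg_cont.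
exact: aeW.
Qed.

End H2_representatives.

(** * Excursions of the derivative *)

Section Excursions.
Variable R : realType.
Implicit Types (f F G H U W g q v : R -> R) (a b l m r s t x y : R).

Lemma continuous_lt_near f k x : continuous f -> f x < k ->
  exists2 e : R, 0 < e & forall y, `|y - x| < e -> f y < k.
Proof.
move=> cf fx; have [e /= e0 he] : \forall y \near x, f y < k.
  by apply: (cvgr_lt _ (cf x)).
by exists e => // y yx; apply: he; rewrite /ball/= distrC.
Qed.

Lemma exists_last q a b : continuous q -> a <= b -> q a <= 0 ->
  exists m, [/\ a <= m, m <= b, q m <= 0 & forall x, m < x <= b -> 0 < q x].
Proof.
move=> cq ab qa; pose S : set R := [set x | a <= x <= b /\ q x <= 0].
have Sa : S a by split => //; rewrite lexx.
have ubS : ubound S b by move=> x [/andP[]].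
have hS : has_sup S by split; [exists a|exists b].
have am : a <= sup S by exact: ub_le_sup hS.2 _ Sa.
have mb : sup S <= b by apply: ge_sup => //; exists a.
exists (sup S); split=> // [|x /andP[mx xb]]; last first.
  rewrite ltNge; apply/negP => qx; move: (mx); rewrite ltNge => /negP; apply.
  have Sx : S x by split => //; rewrite xb (le_trans am)// ltW.
  exact: ub_le_sup hS.2 _ Sx.
rewrite leNgt; apply/negP => qm.
have [e /= e0 he] : \forall y \near sup S, 0 < q y by exact: cvgr_gt (cq (sup S)) _ qm.
have [x Sx mx] := sup_adherent e0 hS.
have xm : x <= sup S by exact: ub_le_sup hS.2 _ Sx.
have := he x; rewrite /ball/= => /(_ _) h.
by case: Sx => _; rewrite leNgt h// ger0_norm ?subr_ge0// ltrBlDr -ltrBlDl.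
Qed.

Lemma exists_first q a b : continuous q -> a <= b -> q b <= 0 ->
  exists m, [/\ a <= m, m <= b, q m <= 0 & forall x, a <= x < m -> 0 < q x].
Proof.
move=> cq ab qb.
have [|||m [am mb qm h]] := @exists_last (fun x => q (- x)) (- b) (- a).
- move=> x; apply: continuous_comp; first exact: opp_continuous.
  exact: cq.
- by rewrite lerN2.
- by rewrite opprK.
exists (- m); split=> [|||x /andP[ax xm]]; [by rewrite lerNr|by rewrite lerNl|exact: qm|].
by rewrite -[x]opprK; apply: h; rewrite ltrNr xm lerN2.
Qed.

Lemma ge_on_closure f k a b : continuous f -> a < b ->
  (forall x, a < x < b -> k <= f x) -> forall x, a <= x <= b -> k <= f x.
Proof.
move=> cf ab H x /andP[]; rewrite le_eqVlt => /predU1P[<- _|ax].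
  apply: (cvgr_to_ge (cvg_at_right_filter (cf a))).
  near=> y; apply: H; apply/andP; split; near: y.
    exact: nbhs_right_gt.
  exact: nbhs_right_lt.
rewrite le_eqVlt => /predU1P[->|xb]; last by rewrite H// ax.
apply: (cvgr_to_ge (cvg_at_left_filter (cf b))).
near=> y; apply: H; apply/andP; split; near: y.
  exact: nbhs_left_gt.
exact: nbhs_left_lt.
Unshelve. all: by end_near. Qed.

Lemma continuousB f g : continuous f -> continuous g ->
  continuous (fun x => f x - g x).
Proof. by move=> cf cg x; exact: (cvgB (cf x) (cg x)). Qed.

Lemma continuous_compR f g : continuous f -> continuous g ->
  continuous (fun x => f (g x)).
Proof. by move=> cf cg x; apply: continuous_comp; [exact: cg|exact: cf]. Qed.

Lemma continuousMR f g : continuous f -> continuous g ->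
  continuous (fun x => f x * g x).
Proof. by move=> cf cg x; exact: (cvgM (cf x) (cg x)). Qed.

Lemma continuous_maxR f g : continuous f -> continuous g ->
  continuous (fun x => Num.max (f x) (g x)).
Proof. by move=> cf cg x; exact: (continuous_max (cf x) (cg x)). Qed.

(** The Cauchy-Schwarz inequality for [v] and [x - (l + r) / 2]. Equality holds
    for affine [v], that is for a parabolic [W]: the optimal transition. *)
Lemma Int_sqr_ge_parabola W v l r (A theta : R) : 0 < A -> l < r -> continuous W ->
  locint v -> locint (fun x => v x ^+ 2) ->
  (forall a b, a <= b -> W b - W a = Int a b v) ->
  W l = theta -> W r = theta ->
  12 * A * (Int l r (fun x => W x - theta)) ^+ 2 / (r - l) ^+ 3 <=
  Int l r (fun x => A * v x ^+ 2).
Proof.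
move=> A0 lr cW vi v2i Wv Wl Wr; set J := Int l r _.
pose d := r - l; have d0 : 0 < d by rewrite subr_gt0.
pose m := (l + r) / 2; pose lam := 12 * A * J / d ^+ 3.
have did : derives (fun x => x - m) (fun=> 1).
  have := derivesD (@derives_id R) (derives_cst (- m)).
  by apply: eq_derives => // x; rewrite addr0.
have cid := derives_continuous did.
have c1 : continuous (fun _ : R => 1 : R) by move=> x; exact: cvg_cst.
have iW : Itg l r W by exact: Itg_cont.
have vxm : Int l r (fun x => v x * (x - m)) = - J.
  have := @Int_by_parts R W v _ _ l r (ltW lr) cW (vi _ _) _ did c1.
  rewrite Wl Wr (@eq_Int _ _ _ (fun x => W x * 1) W); last by move=> x _; rewrite mulr1.
  rewrite /J IntB//; last exact: Itg_cst.
  rewrite Int_cst ?ltW// => H.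
  have {}H : Int l r W + Int l r (fun x => v x * (x - m)) =
      theta * (r - m) - theta * (l - m).
    by apply: H => x /andP[lx _]; rewrite -Wl -Wv//; ring.
  by rewrite -[LHS](addKr (Int l r W)) H; ring.
have xm2 : Int l r (fun x => (x - m) ^+ 2) = d ^+ 3 / 12.
  have dc : derives (fun x => (x - m) ^+ 3 / 3) (fun x => (x - m) ^+ 2).
    have := derivesZ (1 / 3) (derivesM did (derivesM did did)).
    by apply: eq_derives => x; field.
  rewrite (Int_derives (ltW lr) _ dc); last exact: continuous_sqr.
  by rewrite /m /d; field.
have ivx : Itg l r (fun x => v x * (x - m)).
  by apply: eq_Itg (ItgM cid (vi l r)) => x; rewrite mulrC.
have ix2 : Itg l r (fun x => (x - m) ^+ 2) by exact/Itg_cont/continuous_sqr.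
have -> : 12 * A * J ^+ 2 / d ^+ 3 = Int l r (fun x =>
    (- (2 * lam)) * (v x * (x - m)) - (lam ^+ 2 / A) * (x - m) ^+ 2).
  rewrite IntB; [|exact: ItgZ|exact: ItgZ]; rewrite !IntZ// vxm xm2 /lam.
  by field; rewrite !gt_eqF.
apply: ler_Int; [by apply: ItgB; exact: ItgZ|exact: ItgZ|].
move=> x _; rewrite -subr_ge0.
have -> : A * v x ^+ 2 - (- (2 * lam) * (v x * (x - m)) - lam ^+ 2 / A * (x - m) ^+ 2)
   = A * (v x + lam / A * (x - m)) ^+ 2 by field; rewrite gt_eqF.
by rewrite mulr_ge0 ?sqr_ge0// ltW.
Qed.

(** [H] is a bounded nondecreasing function of the error [U - F], the barrier;
    [theta] separates the slopes whose logarithm absorbs by itself the work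
    against the barrier, up to [kap], from those that belong to a jump. The
    hypothesis [jump] is the heart of the matter: a
    transition of height [J] and length [d] costs at least the increment of [H]
    that it produces. *)
Section Barrier.
Variables (F G U W v H g : R -> R) (A theta Gam M kap kap1 rng : R).
Hypotheses (A0 : 0 < A) (theta0 : 0 < theta) (kap0 : 0 <= kap) (kap10 : 0 <= kap1).
Hypotheses (dF : derives F G) (cG : continuous G) (rep : H2_rep U W v).
Hypotheses (dH : derives H g) (cg : continuous g).
Hypotheses (g0 : forall y, 0 <= g y) (gGam : forall y, g y <= Gam).
Hypothesis Hrng : forall y y', H y - H y' <= rng.
Hypothesis weak_slope : forall w y, w <= 2 * theta ->
  - kap <= ln (1 + w ^+ 2) - w * g y.
Hypothesis strong_slope : forall w, theta <= w ->
  kap1 + Gam * (theta + 2 * M) <= ln (1 + w ^+ 2).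
Hypothesis jump : forall y J d, 0 <= J -> 0 < d ->
  H (y + J) - H y <= 12 * A * J ^+ 2 / d ^+ 3 + kap1 * d.

Let Y x := U x - F x.

(** What is left of the energy, without its fidelity term, after payment of the
    work done by the slope [W] against the barrier. *)
Definition gain x : R := A * v x ^+ 2 + (ln (1 + W x ^+ 2) - W x * g (Y x)).

Let dU : derives U W. Proof. by case: rep. Qed.
Let cW : continuous W. Proof. by case: rep. Qed.
Let cU : continuous U. Proof. exact: derives_continuous dU. Qed.
Let cF : continuous F. Proof. exact: derives_continuous dF. Qed.
Let cY : continuous Y. Proof. exact: continuousB. Qed.
Let dY : derives Y (fun x => W x - G x).
Proof.
have := derivesD dU (derivesZ (-1) dF).
by apply: eq_derives => x; rewrite mulN1r.
Qed.
Let cgY : continuous (fun x => g (Y x)). Proof. exact: continuous_compR. Qed.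
Let cWg : continuous (fun x => W x * g (Y x)). Proof. exact: continuousMR. Qed.
Let cGg : continuous (fun x => G x * g (Y x)). Proof. exact: continuousMR. Qed.
Let cln : continuous (fun x => ln (1 + W x ^+ 2)). Proof. exact: continuous_ln1sq. Qed.

Lemma Int_slope_barrier l r : l <= r -> Int l r (fun x => W x * g (Y x)) =
  H (Y r) - H (Y l) + Int l r (fun x => G x * g (Y x)).
Proof.
move=> lr; have c1 : continuous (fun x => g (Y x) * (W x - G x)).
  by apply: continuousMR => //; exact: continuousB.
rewrite -(Int_derives lr c1 (derives_comp dH dY)).
rewrite -IntD; [|exact: Itg_cont|exact: Itg_cont].
by apply: eq_Int => x _; ring.
Qed.

Lemma barrier_lip y z : y <= z -> 0 <= H z - H y <= Gam * (z - y).
Proof.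
move=> yz; rewrite -(Int_derives yz cg dH); apply/andP; split; first exact: Int_ge0.
by rewrite -Int_cst//; apply: ler_Int; [exact: Itg_cont|exact: Itg_cst|].
Qed.

Lemma locint_gain : locint gain.
Proof.
have [_ _ _ v2i _] := rep.
move=> a b; apply: ItgD; first exact: ItgZ.
by apply: ItgB; exact: Itg_cont.
Qed.

Lemma Int_gain l r : Int l r gain = Int l r (fun x => A * v x ^+ 2) +
  (Int l r (fun x => ln (1 + W x ^+ 2)) - Int l r (fun x => W x * g (Y x))).
Proof.
have [_ _ _ v2i _] := rep; rewrite /gain IntD; last 2 first.
- exact: ItgZ.
- by apply: ItgB; exact: Itg_cont.
by rewrite IntB//; exact: Itg_cont.
Qed.

Lemma Int_Gg l r : l <= r -> (forall x, l <= x <= r -> G x <= M) -> 0 <= M ->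
  Int l r (fun x => G x * g (Y x)) <= M * Gam * (r - l).
Proof.
move=> lr GM M0; rewrite -Int_cst//.
apply: ler_Int; [exact: Itg_cont|exact: Itg_cst|move=> x xI].
apply: le_trans (_ : M * g (Y x) <= _); first by rewrite ler_wpM2r ?GM.
by rewrite ler_wpM2l.
Qed.

(** The height of the transition is counted above [theta], which is where [W]
    starts and ends; the margin [Gam * (theta + 2 * M)] in [strong_slope] pays
    for the part of the increment below [theta] and for the variation of [F]. *)
Lemma excursion_ge0 l r : l < r -> (forall x, l <= x <= r -> theta <= W x) ->
  W l = theta -> W r = theta -> (forall x, l <= x <= r -> `|G x| <= M) ->
  0 <= Int l r gain.
Proof.
move=> lr Wth Wl Wr GM; have [_ _ vi v2i Wv] := rep.
have M0 : 0 <= M by rewrite (le_trans (normr_ge0 (G l)))// GM// lexx ltW.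
have d0 : 0 < r - l by rewrite subr_gt0.
have lrW : l <= r := ltW lr.
pose J := Int l r (fun x => W x - theta).
have J0 : 0 <= J by apply: Int_ge0 => x xI; rewrite subr_ge0 Wth.
have h1 := Int_sqr_ge_parabola A0 lr cW vi v2i Wv Wl Wr.
rewrite -/J in h1.
have h2 : (kap1 + Gam * (theta + 2 * M)) * (r - l) <=
    Int l r (fun x => ln (1 + W x ^+ 2)).
  rewrite -Int_cst//; apply: ler_Int; [exact: Itg_cst|exact: Itg_cont|].
  by move=> x xI; apply: strong_slope; exact: Wth.
have h3 := Int_slope_barrier (ltW lr).
have GMr x : l <= x <= r -> G x <= M by move=> /GM/(le_trans (ler_norm _)).
have h4 := Int_Gg (ltW lr) GMr M0.
have Yr : Y r <= Y l + J + (theta + M) * (r - l).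
  have e1 : U r - U l = J + theta * (r - l).
    rewrite -(Int_derives (ltW lr) cW dU) /J IntB; [|exact: Itg_cont|exact: Itg_cst].
    by rewrite Int_cst//; ring.
  have e2 : - M * (r - l) <= F r - F l.
    rewrite -(Int_derives (ltW lr) cG dF) -Int_cst//.
    apply: ler_Int; [exact: Itg_cst|exact: Itg_cont|].
    by move=> x /GM; rewrite ler_norml => /andP[].
  by rewrite /Y; lra.
have h5 := jump (Y l) J0 d0.
have tM0 : 0 <= (theta + M) * (r - l) by apply: mulr_ge0; [rewrite addr_ge0// ltW|exact: ltW].
have h6 : H (Y r) <= H (Y l + J + (theta + M) * (r - l)).
  by have /andP[] := barrier_lip Yr; rewrite subr_ge0.
have h7 : H (Y l + J + (theta + M) * (r - l)) - H (Y l + J) <=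
    Gam * ((theta + M) * (r - l)).
  have /barrier_lip/andP[_] : Y l + J <= Y l + J + (theta + M) * (r - l).
    by rewrite lerDl.
  by move=> /le_trans; apply; rewrite ler_wpM2l ?(le_trans (g0 0))//; lra.
rewrite Int_gain h3.
move: h1 h2 h4 h5 h6 h7; set X := 12 * A * J ^+ 2 / _.
move: (Int l r _) (Int l r _) (Int l r _) => I1 I2 I3.
move: (H _) (H _) (H _) (H _) => H1 H2 H3 H4.
move: (r - l) => d h1 h2 h4 h5 h6 h7; nra.
Qed.

(** An excursion that is not closed at one end may cost nothing for its jump,
    but it gains at most the range of the barrier. *)
Lemma boundary_excursion l r : l <= r -> (forall x, l <= x <= r -> theta <= W x) ->
  (forall x, l <= x <= r -> `|G x| <= M) -> - rng <= Int l r gain.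
Proof.
move=> lr Wth GM; have [_ _ vi v2i Wv] := rep.
have M0 : 0 <= M by rewrite (le_trans (normr_ge0 (G l)))// GM// lexx.
have Gam0 : 0 <= Gam := le_trans (g0 0) (gGam 0).
have d0 : 0 <= r - l by rewrite subr_ge0.
have h1 : 0 <= Int l r (fun x => A * v x ^+ 2).
  by apply: Int_ge0 => x _; rewrite mulr_ge0 ?sqr_ge0// ltW.
have h2 : (Gam * M) * (r - l) <= Int l r (fun x => ln (1 + W x ^+ 2)).
  rewrite -Int_cst//; apply: ler_Int; [exact: Itg_cst|exact: Itg_cont|].
  move=> x xI; apply: le_trans (strong_slope (Wth _ xI)).
  rewrite -subr_ge0 (_ : _ - _ = kap1 + (Gam * theta + Gam * M)); last by ring.
  by rewrite !addr_ge0// mulr_ge0// ltW.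
have h3 := Int_slope_barrier lr.
have GMr x : l <= x <= r -> G x <= M by move=> /GM/(le_trans (ler_norm _)).
have h4 := Int_Gg lr GMr M0.
have h5 := Hrng (Y r) (Y l).
rewrite Int_gain h3; move: h1 h2 h4 h5.
move: (Int l r _) (Int l r _) (Int l r _) => I1 I2 I3.
move: (H _) (H _) => H1 H2; rewrite (mulrC Gam); lra.
Qed.

Lemma weak_slope_gain l r : l <= r -> (forall x, l <= x <= r -> W x <= 2 * theta) ->
  0 <= Int l r (fun x => gain x + kap).
Proof.
move=> lr Wth; apply: Int_ge0 => x xI; have := weak_slope (Y x) (Wth _ xI).
have : 0 <= A * v x ^+ 2 by rewrite mulr_ge0 ?sqr_ge0// ltW.
by rewrite /gain; lra.
Qed.

Let gk x := gain x + kap.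
Let gki : locint gk. Proof. by move=> a b; apply: ItgD; [exact: locint_gain|exact: Itg_cst]. Qed.

Lemma Int_gk l r : l <= r -> Int l r gk = Int l r gain + kap * (r - l).
Proof.
by move=> lr; rewrite /gk IntD ?Int_cst//; [exact: locint_gain|exact: Itg_cst].
Qed.

(** The last point where [W <= theta] and the integral is nonnegative can only
    be the right endpoint: just after it either [W] stays below [2 * theta], or
    an excursion starts. *)
Lemma gain_between s t : s <= t -> W s <= theta -> W t <= theta ->
  (forall x, s <= x <= t -> `|G x| <= M) -> 0 <= Int s t gk.
Proof.
move=> st Ws Wt GM.
pose Phi x := prim gk x - prim gk s.
have cPhi : continuous Phi.
  by apply: continuousB; [exact: continuous_prim|move=> x; exact: cvg_cst].
have PhiE x : s <= x -> Phi x = Int s x gk by move=> sx; rewrite /Phi primB.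
(* q x <= 0 means that W x <= theta and that Phi x >= 0 *)
pose q x := Num.max (W x - theta) (- Phi x).
have cq : continuous q.
  apply: (@continuous_maxR (fun x => W x - theta) (fun x => - Phi x)).
    by move=> x; apply: cvgB; [exact: cW|exact: cvg_cst].
  by move=> x; apply: cvgN; exact: cPhi.
have qs : q s <= 0 by rewrite ge_max subr_le0 Ws/= oppr_le0 /Phi subrr.
have [m [sm mt]] := exists_last cq st qs.
rewrite ge_max subr_le0 oppr_le0 => /andP[Wm Pm] hm.
have stop x : m < x -> x <= t -> W x <= theta -> ~ (0 <= Int m x gk).
  move=> mx xt Wx Imx; suff : q x <= 0 by rewrite leNgt hm ?mx.
  rewrite ge_max subr_le0 Wx oppr_le0 PhiE ?(le_trans sm (ltW mx))//.
  by rewrite (Int_split sm (ltW mx))// addr_ge0// -PhiE.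
move: mt; rewrite le_eqVlt => /predU1P[mt|mt]; first by rewrite -mt -PhiE.
exfalso.
have Wm2 : W m < 2 * theta by rewrite (le_lt_trans Wm)// ltr_pMl// ltr1n.
have [e e0 he] := continuous_lt_near cW Wm2.
have near_m y : m <= y -> y < m + e -> W y <= 2 * theta.
  by move=> my ye; apply/ltW/he; rewrite ger0_norm ?subr_ge0// ltrBlDl.
pose m' := Num.min (m + e / 2) t.
have mm' : m < m' by rewrite lt_min mt andbT; lra.
have m't : m' <= t by rewrite ge_min lexx orbT.
have m'e : m' < m + e by rewrite gt_min; apply/orP; left; lra.
have low x : m < x -> x <= m' -> theta < W x.
  move=> mx xm'; rewrite ltNge; apply/negP => Wx.
  apply: (stop x) => //; first exact: le_trans m't.
  apply: weak_slope_gain; first exact: ltW.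
  by move=> y /andP[my yx]; apply: near_m => //; rewrite (le_lt_trans _ m'e)// (le_trans yx).
have cWt : continuous (fun x => W x - theta).
  by move=> x; apply: cvgB; [exact: cW|exact: cvg_cst].
have [|||r [m'r rt Wr hr]] := @exists_first (fun x => W x - theta) m' t => //.
  by rewrite subr_le0.
rewrite subr_le0 in Wr.
have mr : m < r by exact: lt_le_trans m'r.
have Wmr x : m <= x <= r -> theta <= W x.
  apply: (ge_on_closure cW mr) => y /andP[my yr].
  have [ym'|m'y] := leP y m'; first exact/ltW/low.
  by have := hr y; rewrite (ltW m'y) yr subr_gt0 => /(_ isT)/ltW.
have Wm' : W m = theta by apply/eqP; rewrite eq_le Wm Wmr// lexx ltW.
have Wr' : W r = theta by apply/eqP; rewrite eq_le Wr Wmr// lexx ltW.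
have mrW := ltW mr.
apply: (stop r) => //; rewrite Int_gk//.
rewrite addr_ge0 ?mulr_ge0 ?subr_ge0//.
apply: excursion_ge0 => // x /andP[mx xr]; apply: GM.
by rewrite (le_trans sm)// (le_trans xr).
Qed.

Lemma gain_ge s t : s <= t -> (forall x, s <= x <= t -> `|G x| <= M) ->
  - (2 * rng) - kap * (t - s) <= Int s t gain.
Proof.
move=> st GM; have rng0 : 0 <= rng by have := Hrng 0 0; rewrite subrr.
have cWt : continuous (fun x => W x - theta).
  by move=> x; apply: cvgB; [exact: cW|exact: cvg_cst].
have [[x0 /andP[sx0 x0t] Wx0]|none] :=
    pselect (exists2 x, s <= x <= t & W x <= theta); last first.
  apply: le_trans (boundary_excursion st _ GM).
    by have := mulr_ge0 kap0 (_ : 0 <= t - s); rewrite subr_ge0 => /(_ st); lra.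
  move=> x xI; rewrite leNgt; apply/negP => /ltW Wx; apply: none.
  by exists x.
have Wx0' : W x0 - theta <= 0 by rewrite subr_le0.
have [l [sl lx0 Wl hl]] := @exists_first (fun x => W x - theta) s x0 cWt sx0 Wx0'.
have [r [x0r rt Wr hr]] := @exists_last (fun x => W x - theta) x0 t cWt x0t Wx0'.
rewrite !subr_le0 in Wl Wr.
have lr : l <= r := le_trans lx0 x0r.
have sub a b : s <= a -> b <= t -> forall x, a <= x <= b -> `|G x| <= M.
  by move=> sa bt x /andP[ax xb]; apply: GM; rewrite (le_trans sa)// (le_trans xb).
have edge a b : a <= b -> s <= a -> b <= t -> (forall x, a < x < b -> theta < W x) ->
    - rng <= Int a b gain.
  move=> + sa bt hW; rewrite le_eqVlt => /predU1P[->|ab]; first by rewrite Int_aa oppr_le0.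
  apply: boundary_excursion; [exact: ltW| |exact: sub].
  by apply: (ge_on_closure cW ab) => x /hW/ltW.
have h1 : - rng <= Int s l gain.
  apply: edge => //; first exact: le_trans rt.
  by move=> x /andP[sx xl]; rewrite -subr_gt0; apply: hl; rewrite xl ltW.
have h3 : - rng <= Int r t gain.
  apply: edge => //; first exact: le_trans lr.
  by move=> x /andP[rx xt]; rewrite -subr_gt0; apply: hr; rewrite rx ltW.
have h2 : - (kap * (r - l)) <= Int l r gain.
  have := gain_between lr Wl Wr (sub _ _ sl rt).
  by rewrite Int_gk//; lra.
rewrite (Int_split sl (le_trans lr rt))//; last exact: locint_gain.
rewrite (Int_split lr rt)//; last exact: locint_gain.
have : kap * (r - l) <= kap * (t - s) by rewrite ler_wpM2l//; lra.
lra.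
Qed.

(** The fidelity term is at least [c - p * g >= c - G * g], and [G * g] differs
    from [W * g] by the derivative of the barrier along [U - F]. *)
Lemma density_ge beta c p s t : s <= t ->
  (forall x, s <= x <= t -> `|G x| <= M) -> (forall x, s <= x <= t -> p <= G x) ->
  (forall y, c - p * g y <= beta * y ^+ 2) ->
  (c - kap) * (t - s) - 3 * rng <= Int s t (density A beta F U W v).
Proof.
move=> st GM pG hc.
have h1 := gain_ge st GM.
have h2 := Int_slope_barrier st; have h3 := Hrng (Y s) (Y t).
have h4 : c * (t - s) - Int s t (fun x => G x * g (Y x)) <=
    Int s t (fun x => beta * (U x - F x) ^+ 2).
  rewrite -Int_cst// -IntB; [|exact: Itg_cst|exact: Itg_cont].
  apply: ler_Int; [by apply: ItgB; [exact: Itg_cst|exact: Itg_cont]| |].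
    exact/Itg_cont/continuous_sqrB.
  move=> x xI; apply: le_trans (hc (Y x)).
  by rewrite lerD2l lerN2 ler_wpM2r ?pG.
have -> : Int s t (density A beta F U W v) = Int s t gain +
    Int s t (fun x => W x * g (Y x)) + Int s t (fun x => beta * (U x - F x) ^+ 2).
  rewrite -IntD; [|exact: locint_gain|exact: Itg_cont].
  rewrite -IntD; last 2 first.
  - by apply: ItgD; [exact: locint_gain|exact: Itg_cont].
  - exact/Itg_cont/continuous_sqrB.
  by apply: eq_Int => x _; rewrite /density /gain; ring.
lra.
Qed.

End Barrier.
End Excursions.

(** * The barrier *)

Section Clamp.
Variable R : realType.
Implicit Types (f P Q : R -> R) (r x y z : R).

Definition clamp r x : R := Num.max (- r) (Num.min x r).

Lemma clamp_ge r x : - r <= clamp r x.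
Proof. by rewrite le_max lexx. Qed.

Lemma clamp_le r x : 0 <= r -> clamp r x <= r.
Proof. by move=> r0; rewrite ge_max ge_min lexx orbT andbT; lra. Qed.

Lemma clamp_id r x : - r <= x <= r -> clamp r x = x.
Proof. by move=> /andP[a b]; rewrite /clamp (min_idPl b) (max_idPr a). Qed.

Lemma clamp_low r x : 0 <= r -> x <= - r -> clamp r x = - r.
Proof.
move=> r0 xr; have xr' : x <= r by lra.
by rewrite /clamp (min_idPl xr') (max_idPl xr).
Qed.

Lemma clamp_high r x : 0 <= r -> r <= x -> clamp r x = r.
Proof.
move=> r0 rx; rewrite /clamp (min_idPr rx); apply/max_idPr; lra.
Qed.

Lemma clamp_monoB r x y : 0 <= r -> x <= y ->
  0 <= clamp r y - clamp r x <= y - x.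
Proof.
move=> r0 xy.
have [x1|x1] := leP x (- r); have [y1|y1] := leP y (- r);
have [x2|x2] := leP r x; have [y2|y2] := leP r y;
rewrite ?(clamp_low r0 x1) ?(clamp_low r0 y1) ?(clamp_high r0 x2) ?(clamp_high r0 y2);
rewrite ?(@clamp_id r x) ?(@clamp_id r y) //; try (apply/andP; split; lra); lra.
Qed.

(** Composing with [clamp] keeps a function of class C1 when its derivative
    vanishes at both ends. *)
Lemma derives_clamp P Q r : 0 < r -> derives P Q -> Q r = 0 -> Q (- r) = 0 ->
  derives (fun x => P (clamp r x)) (fun x => Q (clamp r x)).
Proof.
move=> r0 dP Qr QNr x; have r0' := ltW r0.
have [xl|xl|->] := ltgtP x (- r).
- rewrite (clamp_low r0' (ltW xl)) QNr.
  apply: near_eq_is_derive (is_derive_cst (P (- r)) x 1).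
  near=> y; rewrite clamp_low//; apply: ltW; near: y; exact: lt_nbhsl.
- have [xr|xr|->] := ltgtP x r.
  + rewrite clamp_id ?(ltW xl) ?(ltW xr)//.
    apply: near_eq_is_derive (dP x); near=> y; rewrite clamp_id//.
    apply/andP; split; apply: ltW; near: y; [exact: lt_nbhsr|exact: lt_nbhsl].
  + rewrite (clamp_high r0' (ltW xr)) Qr.
    apply: near_eq_is_derive (is_derive_cst (P r) x 1).
    near=> y; rewrite clamp_high//; apply: ltW; near: y; exact: lt_nbhsr.
  + pose P1 y := P (Num.max (- r) y).
    have d1 : is_derive r (1 : R) P1 0.
      rewrite -Qr; apply: near_eq_is_derive (dP r); near=> y.
      rewrite /P1; congr P; apply/esym/max_idPr; apply: ltW; near: y.
      by apply: lt_nbhsr; lra.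
    rewrite clamp_high// Qr.
    apply: (is_derive_glue _ _ d1 (is_derive_cst (P r) r 1)) => y yr.
      by rewrite /clamp (min_idPl yr).
    by rewrite clamp_high.
- pose P1 y := P (Num.min y r).
  have d1 : is_derive (- r) (1 : R) P1 0.
    rewrite -QNr; apply: near_eq_is_derive (dP (- r)); near=> y.
    rewrite /P1; congr P; apply/esym/min_idPl; apply: ltW; near: y.
    by apply: lt_nbhsl; lra.
  rewrite clamp_low// QNr.
  apply: (is_derive_glue _ _ (is_derive_cst (P (- r)) (- r) 1) d1) => y yr.
    by rewrite clamp_low.
  rewrite /P1 /clamp; congr P; apply/max_idPr; rewrite le_min yr/=; lra.
Unshelve. all: by end_near. Qed.

Lemma continuous_clamp r : 0 <= r -> continuous (clamp r).
Proof.
move=> r0 x; apply/cvgrPdist_le => e e0; near=> y.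
apply: le_trans (_ : `|x - y| <= _); last first.
  by near: y; exact: cvgr_dist_le.
have [xy|yx] := leP x y.
  have /andP[h1 h2] := clamp_monoB r0 xy.
  by rewrite distrC ger0_norm// distrC ger0_norm ?subr_ge0.
have /andP[h1 h2] := clamp_monoB r0 (ltW yx).
by rewrite ger0_norm// ger0_norm// subr_ge0 ltW.
Unshelve. all: by end_near. Qed.

End Clamp.

Section Barrier_profile.
Variable R : realType.
Variables beta t p : R.
Hypotheses (beta0 : 0 < beta) (t0 : 0 < t) (p0 : 0 < p).
Implicit Types (x y z j s : R).

(** Lengths and heights are counted in units of omega, and [t ^ 2] is the
    optimal height of a jump. Then [cost] is the least energy per unit length
    in units of omega^2, and [half_range] the error at which the fidelity term
    reaches it. *)
Definition cost : R := 5 / 12 * beta * t ^+ 4.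
Definition half_range : R := Num.sqrt (5 / 12) * t ^+ 2.

(** A primitive of the positive part of [(cost - beta * z ^+ 2) / p]: the amount
    that a staircase following the slope [p] saves, on its flat parts, with
    respect to [cost], and has to give back at its jumps. *)
Definition barrier z : R :=
  (cost * clamp half_range z - beta / 3 * clamp half_range z ^+ 3) / p.
Definition barrier' z : R := (cost - beta * clamp half_range z ^+ 2) / p.

Lemma half_range_gt0 : 0 < half_range.
Proof. by rewrite mulr_gt0 ?exprn_gt0// sqrtr_gt0; lra. Qed.

Lemma cost_half_range : cost = beta * half_range ^+ 2.
Proof.
rewrite /half_range exprMn sqr_sqrtr; last by lra.
by rewrite /cost; ring.
Qed.

Lemma cost_gt0 : 0 < cost.
Proof. by rewrite /cost !mulr_gt0// ?exprn_gt0//; lra. Qed.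

Lemma derives_barrier : derives barrier barrier'.
Proof.
pose P z := (cost * z - beta / 3 * z ^+ 3) / p.
pose Q z := (cost - beta * z ^+ 2) / p.
have dP : derives P Q.
  have d1 := derivesM (@derives_id R) (derivesM (@derives_id R) (@derives_id R)).
  have := derivesZ (p^-1) (derivesD (derivesZ cost (@derives_id R))
    (derivesZ (- (beta / 3)) d1)).
  by apply: eq_derives => z; rewrite /P /Q; field; rewrite gt_eqF.
have Qr : Q half_range = 0 by rewrite /Q cost_half_range subrr mul0r.
have QNr : Q (- half_range) = 0 by rewrite /Q sqrrN cost_half_range subrr mul0r.
exact: derives_clamp half_range_gt0 dP Qr QNr.
Qed.

Lemma continuous_barrier' : continuous barrier'.
Proof.
have cc := continuous_clamp (ltW half_range_gt0).
move=> z; apply: cvgM; last exact: cvg_cst.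
apply: cvgB; first exact: cvg_cst.
by apply: cvgM; [exact: cvg_cst|exact: (continuous_sqr cc)].
Qed.

Lemma clamp_half_range_sqr z : clamp half_range z ^+ 2 <= half_range ^+ 2.
Proof.
have a := clamp_ge half_range z; have b := clamp_le z (ltW half_range_gt0); nra.
Qed.

Lemma barrier'_ge0 z : 0 <= barrier' z.
Proof.
rewrite divr_ge0 ?(ltW p0)// cost_half_range subr_ge0 ler_pM2l//.
exact: clamp_half_range_sqr.
Qed.

Lemma barrier'_le z : barrier' z <= cost / p.
Proof.
rewrite ler_pM2r ?invr_gt0// gerBl mulr_ge0 ?sqr_ge0//; exact: ltW.
Qed.

Lemma barrier'_fidelity z : cost - p * barrier' z <= beta * z ^+ 2.
Proof.
rewrite /barrier' mulrCA divff ?gt_eqF// mulr1 subKr ler_pM2l//.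
have r0 := ltW half_range_gt0.
have [x1|x1] := leP z (- half_range); first by rewrite clamp_low//; nra.
have [x2|x2] := leP half_range z; first by rewrite clamp_high//; nra.
by rewrite clamp_id// !ltW.
Qed.

Lemma barrier_le z z' : z <= z' ->
  let d := clamp half_range z' - clamp half_range z in
  0 <= barrier z' - barrier z <= (cost * d - beta / 12 * d ^+ 3) / p.
Proof.
move=> zz /=; have r0 := ltW half_range_gt0.
have /andP[h1 h2] := clamp_monoB r0 zz.
have a1 := clamp_ge half_range z; have a2 := clamp_le z r0.
have b1 := clamp_ge half_range z'; have b2 := clamp_le z' r0.
rewrite /barrier; move: (clamp _ z) (clamp _ z') h1 {h2} a1 a2 b1 b2 => x y xy a1 a2 b1 b2.
rewrite -mulrBl; apply/andP; split.
  apply: divr_ge0 (ltW p0); rewrite cost_half_range.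
  rewrite (_ : _ - _ = beta / 3 * ((y - x) * (3 * half_range ^+ 2 - (y ^+ 2 + x * y + x ^+ 2))));
    last by field.
  apply: mulr_ge0; first by rewrite divr_ge0// ltW.
  apply: mulr_ge0 => //; nra.
rewrite ler_pM2r ?invr_gt0// -subr_ge0.
rewrite (_ : _ - _ = beta / 4 * ((y - x) * (x + y) ^+ 2)); last by field.
by apply: mulr_ge0; [rewrite divr_ge0// ltW|rewrite mulr_ge0 ?sqr_ge0].
Qed.

(** If the clamped error grows by [s ^+ 2], this is the arithmetic-geometric
    mean inequality 5 t^4 s <= 4 t^5 + s^5, with equality at the optimal
    height. *)
Lemma barrier_jump z j : 0 <= j ->
  barrier (z + j) - barrier z <= beta * t ^+ 5 / (3 * p) * Num.sqrt j.
Proof.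
move=> j0; have zj : z <= z + j by rewrite lerDl.
have /andP[_] := barrier_le zj; move=> /le_trans; apply.
have /andP[d0 dj] := clamp_monoB (ltW half_range_gt0) zj.
have {dj} dj : clamp half_range (z + j) - clamp half_range z <= j by lra.
move: (clamp _ (z + j) - _) d0 dj => d d0 dj.
have s0 := sqrtr_ge0 d; have dE := sqr_sqrtr d0.
apply: le_trans (_ : beta * t ^+ 5 / (3 * p) * Num.sqrt d <= _); last first.
  apply: ler_wpM2l; last exact: ler_wsqrtr.
  by rewrite divr_ge0 ?mulr_ge0 ?exprn_ge0// ltW.
rewrite -{1 2}dE; move: (Num.sqrt d) s0 => s s0; rewrite -subr_ge0 /cost.
have -> : beta * t ^+ 5 / (3 * p) * s -
    (5 / 12 * beta * t ^+ 4 * s ^+ 2 - beta / 12 * (s ^+ 2) ^+ 3) / p =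
    beta / (12 * p) * (s * ((t - s) ^+ 2 *
      (4 * t ^+ 3 + 3 * t ^+ 2 * s + 2 * t * s ^+ 2 + s ^+ 3))).
  by field; rewrite gt_eqF.
have tW := ltW t0.
apply: mulr_ge0; first by rewrite divr_ge0 ?mulr_ge0// ltW.
apply: mulr_ge0 => //; apply: mulr_ge0; first exact: sqr_ge0.
have e1 : 0 <= t ^+ 3 by exact: exprn_ge0.
have e2 : 0 <= t ^+ 2 * s by rewrite mulr_ge0 ?sqr_ge0.
have e3 : 0 <= t * s ^+ 2 by rewrite mulr_ge0 ?sqr_ge0.
have e4 : 0 <= s ^+ 3 by exact: exprn_ge0.
lra.
Qed.

Lemma barrier_range z z' : barrier z - barrier z' <= cost / p * (2 * half_range).
Proof.
have c0 := cost_gt0; have r0 := half_range_gt0.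
have cp : 0 < cost / p by rewrite divr_gt0.
have [zz|/ltW zz] := leP z z'.
  have /andP[+ _] := barrier_le zz; move=> h.
  by apply: le_trans (_ : 0 <= _); [lra|rewrite mulr_ge0//; lra].
have /andP[_ +] := barrier_le zz; move=> /le_trans; apply.
have /andP[d0 _] := clamp_monoB (ltW r0) zz.
have d2 : clamp half_range z - clamp half_range z' <= 2 * half_range.
  by have := clamp_ge half_range z'; have := clamp_le z (ltW r0); lra.
move: (clamp _ z - _) d0 d2 => d d0 d2.
rewrite [leRHS]mulrAC ler_pM2r ?invr_gt0//.
have : 0 <= beta / 12 * d ^+ 3.
  by apply: mulr_ge0; [rewrite divr_ge0// ltW|exact: exprn_ge0].
have : cost * d <= cost * (2 * half_range) by rewrite ler_pM2l.
lra.
Qed.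

End Barrier_profile.

(** * Small parameters *)

Section Small_parameter.
Variable R : realType.
Implicit Types (eps a k L delta x w s d J Gam M th : R).

Lemma ln1D_ge x : 0 <= x -> x / (1 + x) <= ln (1 + x).
Proof.
move=> x0; have x1 : 0 < 1 + x by lra.
have := @le_ln1Dx R (- (x / (1 + x))).
have -> : 1 + - (x / (1 + x)) = (1 + x)^-1 by field; rewrite gt_eqF.
rewrite lnV ?posrE// lerN2; apply.
by rewrite ltrN2 ltr_pdivrMr//; lra.
Qed.

Lemma mul_expRN_le a L : 0 < a -> 0 < L -> L * expR (- (a * L)) <= 4 / (a ^+ 2 * L).
Proof.
move=> a0 L0; have aL : 0 < a * L by exact: mulr_gt0.
have h : a * L / 2 <= expR (a * L / 2).
  by apply: le_trans (expR_ge1Dx _); rewrite lerDr.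
have {}h : (a * L) ^+ 2 / 4 <= expR (a * L).
  rewrite [X in expR X](splitr (a * L)) expRD.
  rewrite (_ : _ / 4 = (a * L / 2) * (a * L / 2)); last by field.
  by apply: ler_pM => //; rewrite divr_ge0// ltW.
rewrite expRN ler_pdivrMr ?expR_gt0//.
apply: le_trans (_ : 4 / (a ^+ 2 * L) * ((a * L) ^+ 2 / 4) <= _).
  by rewrite [leRHS](_ : _ = L)//; field; rewrite !gt_eqF.
by rewrite ler_wpM2l// divr_ge0// mulr_ge0 ?sqr_ge0// ltW.
Qed.

Lemma near_log (K : R) : \forall eps \near (0 : R)^'+,
  [/\ 0 < eps, eps < 1, K <= `|ln eps|, 0 < `|ln eps| & eps = expR (- `|ln eps|)].
Proof.
have e1 : 0 < Num.min (1 : R) (expR (- K)) by rewrite lt_min ltr01 expR_gt0.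
near=> eps.
have eps0 : 0 < eps by near: eps; exact: nbhs_right_gt.
have : eps < Num.min 1 (expR (- K)) by near: eps; exact: nbhs_right_lt.
rewrite lt_min => /andP[eps1 epsK].
have ln0 : ln eps < 0 by rewrite -ln1 ltr_ln ?posrE.
rewrite ltr0_norm// opprK lnK ?posrE//; split=> //.
  by rewrite lerNr -[- K]expRK ler_ln ?posrE ?expR_gt0// ltW.
by rewrite oppr_gt0.
Unshelve. all: by end_near. Qed.

Lemma omega_sqr eps : omega eps ^+ 2 = eps ^+ 2 * `|ln eps|.
Proof. by rewrite /omega exprMn sqr_sqrtr. Qed.

Lemma near_omega delta : 0 < delta -> \forall eps \near (0 : R)^'+,
  0 < omega eps <= delta.
Proof.
move=> d0; near=> eps.
have [e0 e1 hK L0 eE] : [/\ 0 < eps, eps < 1, (delta ^+ 2)^-1 <= `|ln eps|,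
    0 < `|ln eps| & eps = expR (- `|ln eps|)] by near: eps; exact: near_log.
apply/andP; split; first by rewrite mulr_gt0// sqrtr_gt0.
rewrite -(@ler_pXn2r _ 2) ?nnegrE ?(ltW d0)//; last first.
  by rewrite mulr_ge0 ?sqrtr_ge0// ltW.
rewrite omega_sqr {1}eE -expRM_natl.
have := @mul_expRN_le 2 _ ltac:(by []) L0.
rewrite mulrC (_ : 2%:R * - `|ln eps| = - (2 * `|ln eps|)); last by ring.
move=> /le_trans; apply.
rewrite (_ : 4 / _ = (`|ln eps|)^-1); last by field; rewrite gt_eqF.
by rewrite invf_ple ?posrE ?exprn_gt0.
Unshelve. all: by end_near. Qed.

Lemma near_threshold k delta : k < 1 -> 0 < delta -> \forall eps \near (0 : R)^'+,
  expR ((1 + k) * `|ln eps|) * omega eps ^+ 2 <= delta.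
Proof.
move=> k1 d0; near=> eps.
have [e0 e1 hK L0 eE] : [/\ 0 < eps, eps < 1,
    4 / ((1 - k) ^+ 2 * delta) <= `|ln eps|, 0 < `|ln eps| &
    eps = expR (- `|ln eps|)] by near: eps; exact: near_log.
rewrite omega_sqr [X in X ^+ 2]eE -expRM_natl mulrA -expRD mulrC.
rewrite (_ : _ + _ = - ((1 - k) * `|ln eps|)); last by ring.
have k10 : 0 < 1 - k by rewrite subr_gt0.
apply: le_trans (mul_expRN_le k10 L0) _.
rewrite ler_pdivrMr ?mulr_gt0 ?exprn_gt0//.
move: hK; rewrite ler_pdivrMr ?mulr_gt0 ?exprn_gt0//.
by rewrite (_ : delta * _ = `|ln eps| * ((1 - k) ^+ 2 * delta))//; ring.
Unshelve. all: by end_near. Qed.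

Lemma weak_slope_ge Gam th x s : 0 <= s -> s <= Gam -> 0 < th ->
  4 * (Gam * th) <= 1 -> x <= 2 * th ->
  - (Gam ^+ 2 / 2) <= ln (1 + x ^+ 2) - x * s.
Proof.
move=> s0 sG th0 Gth xth; have x2 := sqr_ge0 x.
have ln0 : x ^+ 2 / (1 + x ^+ 2) <= ln (1 + x ^+ 2) by rewrite ln1D_ge.
have G2 : 0 <= Gam ^+ 2 / 2 by rewrite divr_ge0// sqr_ge0.
have [x0|x0] := leP x 0.
  have : 0 <= x ^+ 2 / (1 + x ^+ 2) by rewrite divr_ge0// addr_ge0.
  have : x * s <= 0 by rewrite mulr_le0_ge0.
  lra.
have xs : x * s <= x * Gam by rewrite ler_pM2l.
have [x1|x1] := leP x 1.
  have h1 : x ^+ 2 / 2 <= x ^+ 2 / (1 + x ^+ 2).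
    have x21 : x ^+ 2 <= 1 by rewrite exprn_ile1// ltW.
    by rewrite ler_wpM2l// lef_pV2 ?posrE; lra.
  have := sqr_ge0 (x - Gam); rewrite sqrrB; lra.
have h1 : 1 / 2 <= x ^+ 2 / (1 + x ^+ 2).
  have x21 : 1 <= x ^+ 2 by rewrite exprn_ege1// ltW.
  by rewrite ler_pdivlMr; lra.
have h2 : x * Gam <= 2 * th * Gam by rewrite ler_wpM2r// (le_trans s0).
lra.
Qed.

Lemma strong_slope_ge k L Gam M th x : th = expR ((1 + k) * L) -> th <= x ->
  4 * (Gam * th) <= 1 -> Gam * (2 * M) <= 1 -> 1 <= (1 - k) * L ->
  4 * k * L + Gam * (th + 2 * M) <= ln (1 + x ^+ 2).
Proof.
move=> thE thx Gth GM hK; have th0 : 0 < th by rewrite thE expR_gt0.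
have h1 : 2 * (1 + k) * L <= ln (1 + x ^+ 2).
  rewrite -[leLHS]expRK ler_ln ?posrE ?expR_gt0//; last first.
    by have := sqr_ge0 x; lra.
  rewrite (_ : expR _ = th ^+ 2); last by rewrite thE -expRM_natl mulrA.
  by apply: le_trans (_ : x ^+ 2 <= _); [rewrite ler_pXn2r ?nnegrE//; lra|lra].
rewrite mulrDr; lra.
Qed.

(** The cost of a jump [J] over an optimal length [d]: in the units of omega it
    is the inequality 4 z x^3 <= z^4 + 3 x^4. *)
Lemma jump_cost k eps w L J d : 0 < k -> k <= 1 -> 0 < eps -> 0 < w ->
  w ^+ 2 = eps ^+ 2 * L -> 0 <= J -> 0 < d ->
  w ^+ 3 * (16 / Num.sqrt 3 * k * Num.sqrt (J / w)) <=
  12 * (eps ^+ 6 * w ^+ 4) * J ^+ 2 / d ^+ 3 + 4 * k * L * d.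
Proof.
move=> k0 k1 e0 w0 wE J0 d0.
have s0 := sqrtr_ge0 (J / w).
have sE : Num.sqrt (J / w) ^+ 2 = J / w by rewrite sqr_sqrtr// divr_ge0// ltW.
set s := Num.sqrt (J / w) in s0 sE *.
have -> : J = w * s ^+ 2 by rewrite sE; field; rewrite gt_eqF.
clearbody s.
have -> : L = w ^+ 2 / eps ^+ 2 by rewrite wE; field; rewrite gt_eqF.
pose z := Num.sqrt 3 * s.
have q0 : 0 < Num.sqrt (3 : R) by rewrite sqrtr_gt0.
have qE : Num.sqrt (3 : R) ^+ 2 = 3 by rewrite sqr_sqrtr.
have zE : z ^+ 4 = 9 * s ^+ 4.
  by rewrite /z exprMn (exprM _ 2 2) qE; ring.
have z0 : 0 <= z by rewrite mulr_ge0// ltW.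
have -> : 16 / Num.sqrt 3 * k * s = 16 / 3 * k * z.
  have qV : (Num.sqrt 3)^-1 = Num.sqrt 3 / 3 :> R.
    apply: (mulfI (lt0r_neq0 q0)); rewrite divff ?gt_eqF// mulrA -expr2 qE.
    by rewrite divff// pnatr_eq0.
  by rewrite /z qV; field.
pose x := d / (eps ^+ 2 * w).
have x0 : 0 < x by rewrite divr_gt0// mulr_gt0// exprn_gt0.
have -> : d = eps ^+ 2 * w * x.
  by rewrite /x; field; rewrite !gt_eqF.
have -> : 12 * (eps ^+ 6 * w ^+ 4) * (w * s ^+ 2) ^+ 2 / (eps ^+ 2 * w * x) ^+ 3 +
    4 * k * (w ^+ 2 / eps ^+ 2) * (eps ^+ 2 * w * x) =
    w ^+ 3 * (4 / 3 * (z ^+ 4 / x ^+ 3 + 3 * k * x)).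
  by rewrite zE; field; rewrite !gt_eqF.
rewrite ler_pM2l ?exprn_gt0//.
have h : 4 * z <= z ^+ 4 / x ^+ 3 + 3 * x.
  rewrite -subr_ge0 (_ : _ - _ =
    (z - x) ^+ 2 * (z ^+ 2 + 2 * z * x + 3 * x ^+ 2) / x ^+ 3); last first.
    by field; rewrite gt_eqF.
  rewrite divr_ge0 ?exprn_ge0 ?(ltW x0)// mulr_ge0 ?sqr_ge0//.
  have := mulr_ge0 z0 (ltW x0); have := sqr_ge0 z; have := sqr_ge0 x; lra.
have h2 : k * (z ^+ 4 / x ^+ 3) <= z ^+ 4 / x ^+ 3.
  by rewrite ler_piMl// divr_ge0// exprn_ge0// ltW.
have : k * (4 * z) <= k * (z ^+ 4 / x ^+ 3 + 3 * x) by rewrite ler_pM2l.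
rewrite mulrDr; lra.
Qed.

End Small_parameter.

(** * The lower bound on a segment where the slope has a sign *)

Section Lower_bound.
Variable R : realType.
Implicit Types (F G U W v : R -> R) (beta t p k M a b tau eps : R).

(** The threshold is eps^-(1 + k): it is large enough for steeper slopes to cost
    4 k |log eps| per unit length with a margin, and small enough for the
    smaller slopes to be negligible, since theta omega^2 tends to 0. *)
Lemma lower_bound_slope beta t p k M a b F G tau :
  0 < beta -> 0 < t -> 0 < p -> 0 < k -> k < 1 -> 0 < tau -> a < b ->
  beta * t ^+ 5 / (3 * p) = 16 / Num.sqrt 3 * k ->
  derives F G -> continuous G ->
  (forall x, a <= x <= b -> `|G x| <= M) -> (forall x, a <= x <= b -> p <= G x) ->
  \forall eps \near (0 : R)^'+, forall U W v, H2_rep U W v ->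
    omega eps ^+ 2 * ((cost beta t - tau) * (b - a)) <=
    Int a b (density (eps ^+ 6 * omega eps ^+ 4) beta F U W v).
Proof.
move=> beta0 t0 p0 k0 k1 tau0 ab tE dF cG GM pG.
have c0 : 0 < cost beta t by exact: cost_gt0.
have cp : 0 < cost beta t / p by exact: divr_gt0.
have [ga gaE ga0] : exists2 ga, cost beta t / p = ga & 0 < ga.
  by exists (cost beta t / p).
have r0 : 0 < half_range t by exact: half_range_gt0.
have [rho rhoE rho0] : exists2 rho, ga * (2 * half_range t) = rho & 0 < rho.
  by exists (ga * (2 * half_range t)) => //; rewrite mulr_gt0// mulr_gt0.
have M0 : 0 <= M by rewrite (le_trans (normr_ge0 (G a)))// GM// lexx ltW.
have d1 : 0 < (4 * ga)^-1 by rewrite invr_gt0 mulr_gt0.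
have M1 : 0 < M + 1 by rewrite ltr_wpDl.
have gM1 : 0 < 2 * ga * (M + 1) by rewrite mulr_gt0// mulr_gt0.
have d2 : 0 < (2 * ga * (M + 1))^-1 by rewrite invr_gt0.
have d3 : 0 < tau / ga ^+ 2 by rewrite divr_gt0// exprn_gt0.
have ba : 0 < b - a by rewrite subr_gt0.
have rho6 : 0 < 6 * rho by rewrite mulr_gt0.
have tba : 0 < tau * (b - a) by rewrite mulr_gt0.
have d4 : 0 < tau * (b - a) / (6 * rho) by exact: divr_gt0.
near=> eps.
have [e0 e1 hK L0 eE] : [/\ 0 < eps, eps < 1, (1 - k)^-1 <= `|ln eps|,
    0 < `|ln eps| & eps = expR (- `|ln eps|)] by near: eps; exact: near_log.
have hth : expR ((1 + k) * `|ln eps|) * omega eps ^+ 2 <= (4 * ga)^-1.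
  by near: eps; exact: near_threshold.
have /andP[w0 w1] : 0 < omega eps <= 1 by near: eps; exact: near_omega.
have /andP[_ w2] : 0 < omega eps <= (2 * ga * (M + 1))^-1 by near: eps; exact: near_omega.
have /andP[_ w3] : 0 < omega eps <= tau / ga ^+ 2 by near: eps; exact: near_omega.
have /andP[_ w4] : 0 < omega eps <= tau * (b - a) / (6 * rho)
  by near: eps; exact: near_omega.
have wE := omega_sqr eps.
move: hth w0 w1 w2 w3 w4 wE hK L0; set L := `|ln eps|; set w := omega eps.
set th := expR _ => hth w0 w1 w2 w3 w4 wE hK L0 U W v rep.
have thE : th = expR ((1 + k) * L) by [].
clearbody th L w.
have th0 : 0 < th by rewrite thE expR_gt0.
have k10 : 0 < 1 - k by rewrite subr_gt0.
have w2w : w ^+ 2 <= w by rewrite expr2 ler_piMl// ltW.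
have w2_0 : 0 < w ^+ 2 by exact: exprn_gt0.
pose Gam := w ^+ 2 * ga.
have Gam0 : 0 < Gam by exact: mulr_gt0.
have Gth : 4 * (Gam * th) <= 1.
  rewrite (_ : 4 * _ = th * w ^+ 2 * (4 * ga)); last by rewrite /Gam; ring.
  by rewrite -ler_pdivlMr ?mulr_gt0// div1r.
have GM1 : Gam * (2 * M) <= 1.
  apply: le_trans (_ : w ^+ 2 * (2 * ga * (M + 1)) <= _).
    rewrite (_ : Gam * _ = w ^+ 2 * (2 * ga * M)); last by rewrite /Gam; ring.
    by rewrite ler_pM2l// ler_pM2l ?mulr_gt0// lerDl.
  by rewrite -ler_pdivlMr// div1r (le_trans w2w).
pose H y := w ^+ 3 * barrier beta t p (w^-1 * y).
pose g y := w ^+ 2 * barrier' beta t p (w^-1 * y).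
have dH : derives H g.
  have := derivesZ (w ^+ 3) (derives_comp (derives_barrier beta t0 p0)
    (derivesZ w^-1 (@derives_id R))).
  apply: eq_derives => // y; rewrite /g /= mulr1.
  by move: (barrier' _ _ _ _) => B; field; rewrite gt_eqF.
have cg : continuous g.
  move=> y; apply: cvgM; first exact: cvg_cst.
  apply: (@continuous_compR R (barrier' beta t p) (fun y => w^-1 * y)).
    exact: continuous_barrier'.
  by move=> z; apply: cvgM; [exact: cvg_cst|exact: cvg_id].
have g0 y : 0 <= g y by rewrite mulr_ge0 ?barrier'_ge0// ltW.
have gGam y : g y <= Gam by rewrite ler_pM2l// -gaE barrier'_le.
pose rng := w ^+ 3 * rho.
have w30 : 0 < w ^+ 3 by exact: exprn_gt0.
have Hrng y y' : H y - H y' <= rng.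
  by rewrite -mulrBr ler_pM2l// -rhoE -gaE barrier_range.
pose kap := Gam ^+ 2 / 2.
have kap0 : 0 <= kap by rewrite divr_ge0// sqr_ge0.
pose kap1 := 4 * k * L.
have kap10 : 0 <= kap1 by rewrite !mulr_ge0// ltW.
have weak x y : x <= 2 * th -> - kap <= ln (1 + x ^+ 2) - x * g y.
  by move=> xth; apply: weak_slope_ge Gth xth.
have strong x : th <= x -> kap1 + Gam * (th + 2 * M) <= ln (1 + x ^+ 2).
  move=> thx; apply: strong_slope_ge thE thx Gth GM1 _.
  by move: hK; rewrite -div1r ler_pdivrMr// mulrC.
have jump y J d : 0 <= J -> 0 < d ->
    H (y + J) - H y <= 12 * (eps ^+ 6 * w ^+ 4) * J ^+ 2 / d ^+ 3 + kap1 * d.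
  move=> J0 d0; apply: le_trans (jump_cost k0 (ltW k1) e0 w0 wE J0 d0).
  rewrite -mulrBr ler_pM2l// mulrDr -tE mulrC [_^-1 * J]mulrC.
  by apply: barrier_jump => //; rewrite divr_ge0// ltW.
have A0 : 0 < eps ^+ 6 * w ^+ 4 by rewrite mulr_gt0// exprn_gt0.
have fid y : w ^+ 2 * cost beta t - p * g y <= beta * y ^+ 2.
  rewrite (_ : _ - _ = w ^+ 2 * (cost beta t - p * barrier' beta t p (w^-1 * y)));
    last by rewrite /g; ring.
  rewrite (_ : beta * y ^+ 2 = w ^+ 2 * (beta * (w^-1 * y) ^+ 2)); last first.
    by field; rewrite gt_eqF.
  by rewrite ler_pM2l// barrier'_fidelity.
have := density_ge A0 th0 kap0 kap10 dF cG rep dH cg g0 gGam Hrng weak strong jump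
  (ltW ab) GM pG fid.
apply: le_trans.
have h1 : kap <= w ^+ 2 * (tau / 2).
  rewrite (_ : kap = w ^+ 2 * (w ^+ 2 * ga ^+ 2 / 2)); last by rewrite /kap /Gam; ring.
  rewrite ler_pM2l// ler_pM2r ?invr_gt0// -ler_pdivlMr ?exprn_gt0//.
  exact: le_trans w3.
have h2 : 3 * rng <= w ^+ 2 * (tau * (b - a) / 2).
  rewrite (_ : 3 * rng = w ^+ 2 * (w * (6 * rho) / 2)); last by rewrite /rng; field.
  by rewrite ler_pM2l// ler_pM2r ?invr_gt0// -ler_pdivlMr ?mulr_gt0.
have : kap * (b - a) <= w ^+ 2 * (tau / 2) * (b - a) by rewrite ler_pM2r.
rewrite mulrBl; lra.
Unshelve. all: by end_near. Qed.

End Lower_bound.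

(** * Transition profiles *)

Section Profile.
Variable R : realType.
Implicit Types (mu t x : R).

Lemma derivesX n : derives (fun x : R => x ^+ n.+1) (fun x => n.+1%:R * x ^+ n).
Proof.
elim: n => [|n IH].
  by apply: eq_derives (@derives_id R) => x; rewrite ?expr1// expr0 mulr1.
have := derivesM (@derives_id R) IH.
by apply: eq_derives => x; rewrite -?exprS// mul1r exprS [n.+2%:R]mulrS; ring.
Qed.

(** The optimal profile has the parabola 3 (1 - t^2) / 4 as its derivative;
    lowering its second derivative by a high power of t makes it of class C2
    across the ends of the transition, at the price of the factor [mu]. *)
Lemma transition_profile mu : 1 < mu -> exists S S1 S2 : R -> R,
  [/\ derives S S1, derives S1 S2, continuous S2,
      forall t, -1 <= t <= 1 -> `|S2 t| <= 3 / 2 * mu * `|t| &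
      (forall t, t <= -1 -> [/\ S t = 0, S1 t = 0 & S2 t = 0]) /\
      (forall t, 1 <= t -> [/\ S t = 1, S1 t = 0 & S2 t = 0])].
Proof.
move=> mu1.
have [m hm] : exists m : nat, 3 / (2 * (mu - 1)) < m.+1%:R.
  exists (Num.trunc (3 / (2 * (mu - 1)))).
  exact: truncnS_gt.
pose M : R := m.+1%:R.
have M0 : 0 < M by rewrite /M ltr0n.
pose nu := (2 * M + 3) / (2 * M).
have nu_mu : nu <= mu.
  rewrite ler_pdivrMr ?mulr_gt0//; move: hm.
  by rewrite ltr_pdivrMr ?mulr_gt0 ?subr_gt0// -/M; lra.
have nu0 : 0 < nu by rewrite divr_gt0//; lra.
have [k kD] : exists k, k = (2 * m.+1)%N by exists (2 * m.+1)%N.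
have kE : k%:R = 2 * M :> R by rewrite kD natrM.
pose s2 t := - (3 / 2 * nu) * (t - t ^+ k.+1).
pose s1 t := 3 / 2 * nu * ((1 - t ^+ 2) / 2 - (1 - t ^+ k.+2) / (2 * M + 2)).
pose s0 t := 3 / 2 * nu *
  ((t - t ^+ 3 / 3) / 2 - (t - t ^+ k.+3 / (2 * M + 3)) / (2 * M + 2)) + 1 / 2.
have d1 : derives s1 s2.
  have := derivesZ (3 / 2 * nu) (derivesD (derivesZ (- (1 / 2)) (@derivesX 1))
    (derivesD (derivesZ (2 * M + 2)^-1 (@derivesX k.+1))
      (derives_cst (1 / 2 - (2 * M + 2)^-1)))).
  apply: eq_derives => t; rewrite /s1 /s2.
    by field; rewrite gt_eqF//; lra.
  rewrite (_ : k.+2%:R = 2 * M + 2); last by rewrite -kE -[k.+2]addn2 natrD.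
  by field; rewrite gt_eqF//; lra.
have d0 : derives s0 s1.
  have := derivesD (derivesZ (3 / 2 * nu) (derivesD
    (derivesD (derivesZ (1 / 2 - (2 * M + 2)^-1) (@derives_id R))
       (derivesZ (- (1 / 6)) (@derivesX 2)))
     (derivesZ ((2 * M + 3) * (2 * M + 2))^-1 (@derivesX k.+2)))) (derives_cst (1/2)).
  apply: eq_derives => t; rewrite /s0 /s1.
    by field; rewrite !gt_eqF//; lra.
  rewrite (_ : k.+3%:R = 2 * M + 3); last by rewrite -kE -[k.+3]addn3 natrD.
  by field; rewrite !gt_eqF//; lra.
have kev : (-1) ^+ k = 1 :> R by rewrite kD exprM sqrrN !expr1n.
have s2_1 : s2 1 = 0 by rewrite /s2 expr1n; ring.
have s2_N1 : s2 (-1) = 0 by rewrite /s2 exprS kev; ring.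
have s1_1 : s1 1 = 0 by rewrite /s1 !expr1n; ring.
have s1_N1 : s1 (-1) = 0 by rewrite /s1 !exprS kev; ring.
have s0_1 : s0 1 = 1 by rewrite /s0 /nu !expr1n; field; rewrite !gt_eqF//; lra.
have s0_N1 : s0 (-1) = 0.
  by rewrite /s0 /nu !exprS kev; field; rewrite !gt_eqF//; lra.
have one0 : 0 < 1 :> R by [].
have one0' : 0 <= 1 :> R by [].
exists (fun t => s0 (clamp 1 t)), (fun t => s1 (clamp 1 t)), (fun t => s2 (clamp 1 t)).
split; [exact: derives_clamp|exact: derives_clamp| | |].
- apply: (@continuous_compR R s2 (clamp 1)); last exact: continuous_clamp.
  move=> t; apply: cvgM; first exact: cvg_cst.
  by apply: cvgB; [exact: cvg_id|exact: exprn_continuous].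
- move=> t tI; rewrite clamp_id// /s2 -{1}[t]mulr1 exprS -mulrBr !normrM normrN.
  have tk : 0 <= 1 - t ^+ k <= 1.
    have tk0 : 0 <= t ^+ k by rewrite kD exprM exprn_ge0// sqr_ge0.
    have t1 : `|t| <= 1 by rewrite ler_norml.
    have : t ^+ k <= 1.
      by rewrite -[t ^+ k]ger0_norm// normrX exprn_ile1.
    by move=> ?; apply/andP; split; lra.
  move: tk => /andP[tk0 tk1].
  have n0 : 0 <= 3 / 2 * nu by apply: mulr_ge0; [rewrite divr_ge0|exact: ltW].
  rewrite (ger0_norm tk0) (ger0_norm n0).
  rewrite mulrA; apply: le_trans (_ : 3 / 2 * nu * `|t| <= _).
    by rewrite ler_piMr// mulr_ge0.
  by rewrite ler_wpM2r// ler_pM2l.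
- by split=> t ht; rewrite ?(clamp_low one0' ht) ?(clamp_high one0' ht).
Qed.

End Profile.

Section Competitors.
Variable R : realType.
Implicit Types (F G u w : R -> R) (A beta P a b c h d mu x y E : R).

(** Competitors that are constant outside the segment and agree there with [F]
    at its ends can be glued together. *)
Definition admissible A beta F a b E : Prop := exists u u1 u2,
  [/\ derives u u1, derives u1 u2, continuous u2,
      (forall y, y <= a -> [/\ u y = F a, u1 y = 0 & u2 y = 0]) /\
      (forall y, b <= y -> [/\ u y = F b, u1 y = 0 & u2 y = 0]) &
      Int a b (density A beta F u u1 u2) <= E].

Lemma continuous_density A beta F u u1 u2 :
  continuous F -> derives u u1 -> derives u1 u2 -> continuous u2 ->
  continuous (density A beta F u u1 u2).
Proof.
move=> cF d1 d2 c2; have c1 := derives_continuous d2; have c0 := derives_continuous d1.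
move=> x; apply: cvgD; first by apply: cvgM; [exact: cvg_cst|exact: continuous_sqr].
by apply: cvgD; [exact: continuous_ln1sq|exact: continuous_sqrB].
Qed.

Lemma admissible_le A beta F a b E E' : E <= E' ->
  admissible A beta F a b E -> admissible A beta F a b E'.
Proof.
move=> EE [u [u1 [u2 [d1 d2 c2 out h]]]]; exists u, u1, u2; split => //.
exact: le_trans h EE.
Qed.

Lemma admissible_glue A beta F a b c E E' : continuous F -> a <= b -> b <= c ->
  admissible A beta F a b E -> admissible A beta F b c E' ->
  admissible A beta F a c (E + E').
Proof.
move=> cF ab bc [u [u1 [u2 [d1 d2 c2 [lo hi] h]]]] [w [w1 [w2 [e1 e2 k2 [lo' hi'] h']]]].
have D1 : derives (fun x => u x + w x - F b) (fun x => u1 x + w1 x).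
  have := derivesD (derivesD d1 e1) (derives_cst (- F b)).
  by apply: eq_derives => x //; rewrite addr0.
have D2 := derivesD d2 e2.
have C2 : continuous (fun x => u2 x + w2 x).
  by move=> x; exact: (cvgD (c2 x) (k2 x)).
exists (fun x => u x + w x - F b), (fun x => u1 x + w1 x), (fun x => u2 x + w2 x).
split => //.
- split=> y hy.
    have [-> -> ->] := lo _ hy; have [-> -> ->] := lo' _ (le_trans hy ab).
    by rewrite !addr0; split => //; ring.
  have [-> -> ->] := hi' _ hy; have [-> -> ->] := hi _ (le_trans bc hy).
  by rewrite !addr0; split => //; ring.
- have ci := continuous_density (A := A) (beta := beta) cF D1 D2 C2.
  rewrite (Int_split ab bc); last exact: Itg_cont.
  apply: le_trans (lerD h h'); rewrite le_eqVlt; apply/orP; left; apply/eqP.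
  congr (_ + _); apply: eq_Int => x /andP[ax xb]; rewrite /density.
    by have [-> -> ->] := lo' _ xb; rewrite !addr0 addrK.
  by have [-> -> ->] := hi _ ax; rewrite !add0r [F b + _]addrC addrK.
Qed.

(** Bound for the energy in a cell of length [h] of a competitor that goes from
    the value of [F] at one end to its value at the other end through a single
    transition, of half-length [d], in the middle. *)
Definition cell_cost A beta P mu d h : R :=
  A * (3 / 2) * mu ^+ 2 * P ^+ 2 * h ^+ 2 / d ^+ 3 +
  (2 * d * ln (1 + (3 * mu * P * h / d) ^+ 2) +
   beta * P ^+ 2 * (h ^+ 3 / 12 + 98 * mu ^+ 2 * d * h ^+ 2)).

Lemma slope_bound F G P a b : derives F G -> (forall x, a <= x <= b -> `|G x| <= P) ->
  forall x y, a <= x -> x <= y -> y <= b -> `|F y - F x| <= P * (y - x).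
Proof.
move=> dF GP x y ax xy yb.
have [z zI ->] := MVT_segment xy (fun z _ => dF z)
  (continuous_subspaceT (derives_continuous dF)).
rewrite normrM (ger0_norm (_ : 0 <= y - x)) ?subr_ge0// ler_wpM2r ?subr_ge0//.
move: zI; rewrite in_itv/= => /andP[xz zy]; apply: GP.
by rewrite (le_trans ax)// (le_trans zy).
Qed.

Lemma admissible_cell A beta F G P mu d x h :
  0 < A -> 0 < beta -> derives F G -> 1 < mu -> 0 < d -> 2 * d <= h ->
  (forall y, x <= y <= x + h -> `|G y| <= P) ->
  admissible A beta F x (x + h) (cell_cost A beta P mu d h).
Proof.
move=> A0 b0 dF mu1 d0 dh GP.
have [S [S1 [S2 [dS dS1 cS2 bS2 [lo hi]]]]] := transition_profile mu1.
have h0 : 0 < h by lra.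
have P0 : 0 <= P by rewrite (le_trans (normr_ge0 (G x)))// GP// lexx lerDl ltW.
have mu0 : 0 < mu by lra.
have xh : x <= x + h by rewrite lerDl ltW.
pose m := x + h / 2; pose J := F (x + h) - F x.
have JP : `|J| <= P * h.
  by have := slope_bound dF GP (lexx x) xh (lexx _); rewrite [x + h - x]addrAC subrr add0r.
pose z y := (y - m) / d.
have dz : derives z (fun=> d^-1).
  have := derivesZ d^-1 (derivesD (@derives_id R) (derives_cst (- m))).
  by apply: eq_derives => y; rewrite ?addr0 ?mulr1// /z mulrC.
pose u y := F x + J * S (z y).
pose u1 y := J / d * S1 (z y).
pose u2 y := J / d ^+ 2 * S2 (z y).
have du : derives u u1.
  have := derivesD (derives_cst (F x)) (derivesZ J (derives_comp dS dz)).
  by apply: eq_derives => y //; rewrite /u1; field; rewrite gt_eqF.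
have du1 : derives u1 u2.
  have := derivesZ (J / d) (derives_comp dS1 dz).
  by apply: eq_derives => y //; rewrite /u2; field; rewrite gt_eqF.
have cz := derives_continuous dz.
have cu2 : continuous u2.
  move=> y; apply: cvgM; first exact: cvg_cst.
  exact: (continuous_compR cS2 cz).
have zlo y : y <= m - d -> z y <= -1.
  by move=> hy; rewrite ler_pdivrMr//; lra.
have zhi y : m + d <= y -> 1 <= z y.
  by move=> hy; rewrite ler_pdivlMr//; lra.
have zmid y : m - d <= y <= m + d -> -1 <= z y <= 1.
  by move=> /andP[a1 a2]; rewrite ler_pdivlMr// ler_pdivrMr//; apply/andP; split; lra.
have ulo y : y <= m - d -> [/\ u y = F x, u1 y = 0 & u2 y = 0].
  move=> /zlo/lo[s0 s1 s2]; rewrite /u /u1 /u2 s0 s1 s2 !mulr0.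
  by rewrite addr0.
have uhi y : m + d <= y -> [/\ u y = F (x + h), u1 y = 0 & u2 y = 0].
  move=> /zhi/hi[s0 s1 s2]; rewrite /u /u1 /u2 s0 s1 s2 !mulr0 mulr1.
  by split => //; rewrite /J; ring.
have cF := derives_continuous dF.
have cD := continuous_density (A := A) (beta := beta) cF du du1 cu2.
have md1 : x <= m - d by rewrite /m; lra.
have md2 : m - d <= m + d by lra.
have md3 : m + d <= x + h by rewrite /m; lra.
exists u, u1, u2; split => //.
  split=> y hy; first by apply: ulo; exact: le_trans md1.
  by apply: uhi; exact: le_trans hy.
rewrite (Int_split md1 (le_trans md2 md3)); last exact: Itg_cont.
rewrite (Int_split md2 md3); last exact: Itg_cont.
have [lo0 lo1 _] := lo _ (lexx (-1)).
have bS2' t : -1 <= t <= 1 -> `|S2 t| <= 3 / 2 * mu.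
  move=> tI; apply: le_trans (bS2 _ tI) _; rewrite ler_piMr ?ler_norml//.
  by rewrite mulr_ge0 ?divr_ge0// ltW.
have bS1 t : -1 <= t <= 1 -> `|S1 t| <= 3 * mu.
  move=> /andP[t1 t2]; have := slope_bound dS1 bS2' (lexx _) t1 t2.
  rewrite lo1 subr0 => /le_trans; apply.
  rewrite (_ : 3 * mu = 3 / 2 * mu * 2); last by field.
  by rewrite ler_pM2l ?mulr_gt0//; lra.
have bS t : -1 <= t <= 1 -> `|S t| <= 6 * mu.
  move=> /andP[t1 t2]; have := slope_bound dS bS1 (lexx _) t1 t2.
  rewrite lo0 subr0 => /le_trans; apply.
  rewrite (_ : 6 * mu = 3 * mu * 2); last by ring.
  by rewrite ler_pM2l ?mulr_gt0//; lra.
have FB y : x <= y -> y <= x + h -> `|F x - F y| <= P * (y - x).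
  by move=> xy yh; rewrite distrC; apply: (slope_bound dF GP).
have FE y : x <= y -> y <= x + h -> `|F (x + h) - F y| <= P * (x + h - y).
  by move=> xy yh; apply: (slope_bound dF GP).
have sqr_mono (s r : R) : `|s| <= r -> s ^+ 2 <= r ^+ 2.
  by move=> sr; rewrite -real_normK ?num_real// ler_pXn2r ?nnegrE// (le_trans _ sr).
pose Lg := ln (1 + (3 * mu * P * h / d) ^+ 2).
have dcub c : derives (fun y => (y - c) ^+ 3 / 3) (fun y => (y - c) ^+ 2).
  have dc : derives (fun y => y - c) (fun=> 1).
    have := derivesD (@derives_id R) (derives_cst (- c)).
    by apply: eq_derives => y //; rewrite addr0.
  have := derivesZ (1 / 3) (derives_comp (@derivesX R 2) dc).
  by apply: eq_derives => y; field.
have csq c : continuous (fun y => (y - c) ^+ 2).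
  apply: continuous_sqr => y; apply: cvgB; [exact: cvg_id|exact: cvg_cst].
have h1 : Int x (m - d) (density A beta F u u1 u2) <= beta * P ^+ 2 * (h ^+ 3 / 24).
  apply: le_trans (_ : Int x (m - d) (fun y => beta * P ^+ 2 * (y - x) ^+ 2) <= _).
    apply: ler_Int; [exact: Itg_cont|exact/ItgZ/Itg_cont|].
    move=> y /andP[xy ym]; have [u0 u10 u20] := ulo _ ym.
    rewrite /density u0 u10 u20 !expr0n/= mulr0 addr0 ln1 !add0r -mulrA ler_pM2l//.
    rewrite -exprMn; apply: sqr_mono; apply: FB => //.
    by apply: le_trans ym (le_trans md2 md3).
  rewrite IntZ; last exact: Itg_cont.
  rewrite (Int_derives md1 (csq x) (dcub x)) ler_wpM2l//.
    by rewrite mulr_ge0 ?sqr_ge0// ltW.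
  rewrite subrr expr0n/= mul0r subr0.
  rewrite (_ : h ^+ 3 / 24 = (h / 2) ^+ 3 / 3); last by field.
  rewrite (_ : m - d - x = h / 2 - d); last by rewrite /m; field.
  by rewrite ler_pM2r ?invr_gt0// ler_pXn2r ?nnegrE//; move: h0 d0 dh; lra.
have h3 : Int (m + d) (x + h) (density A beta F u u1 u2) <= beta * P ^+ 2 * (h ^+ 3 / 24).
  apply: le_trans (_ : Int (m + d) (x + h) (fun y => beta * P ^+ 2 * (y - (x + h)) ^+ 2) <= _).
    apply: ler_Int; [exact: Itg_cont|exact/ItgZ/Itg_cont|].
    move=> y /andP[my yh]; have [u0 u10 u20] := uhi _ my.
    rewrite /density u0 u10 u20 !expr0n/= mulr0 addr0 ln1 !add0r -mulrA ler_pM2l//.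
    rewrite -exprMn; apply: le_trans (_ : (P * (x + h - y)) ^+ 2 <= _).
      apply: sqr_mono; apply: FE => //.
      by apply: le_trans my; exact: le_trans md2.
    by rewrite le_eqVlt; apply/orP; left; apply/eqP; ring.
  rewrite IntZ; last exact: Itg_cont.
  rewrite (Int_derives md3 (csq _) (dcub _)) ler_wpM2l//.
    by rewrite mulr_ge0 ?sqr_ge0// ltW.
  rewrite subrr expr0n/= mul0r sub0r.
  rewrite [leLHS](_ : _ = (x + h - (m + d)) ^+ 3 / 3); last by field.
  rewrite (_ : h ^+ 3 / 24 = (h / 2) ^+ 3 / 3); last by field.
  rewrite (_ : x + h - (m + d) = h / 2 - d); last by rewrite /m; field.
  by rewrite ler_pM2r ?invr_gt0// ler_pXn2r ?nnegrE//; move: h0 d0 dh; lra.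
have h2 : Int (m - d) (m + d) (density A beta F u u1 u2) <=
    A * (3 / 2) * mu ^+ 2 * P ^+ 2 * h ^+ 2 / d ^+ 3 +
    (2 * d * Lg + beta * P ^+ 2 * (98 * mu ^+ 2 * d * h ^+ 2)).
  pose K := A * (9 / 4) * mu ^+ 2 * P ^+ 2 * h ^+ 2 / d ^+ 6.
  pose C := Lg + beta * (7 * mu * P * h) ^+ 2.
  have K0 : 0 <= K.
    apply: divr_ge0; last by rewrite exprn_ge0// ltW.
    by rewrite !mulr_ge0 ?sqr_ge0// ltW.
  apply: le_trans (_ : Int (m - d) (m + d) (fun y => K * (y - m) ^+ 2 + C) <= _).
    apply: ler_Int; [exact: Itg_cont| |].
      by apply: ItgD; [exact/ItgZ/Itg_cont|exact: Itg_cst].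
    move=> y yI; have zI := zmid _ yI; have [y1 y2] := andP yI.
    have xy : x <= y := le_trans md1 y1; have yh : y <= x + h := le_trans y2 md3.
    rewrite /density; apply: lerD; last apply: lerD.
    - rewrite (_ : K * _ = A * (3 / 2 * mu * (P * h) / d ^+ 3 * (y - m)) ^+ 2); last first.
        by rewrite /K; field; rewrite gt_eqF.
      rewrite ler_pM2l//.
      rewrite -[leRHS]real_normK ?num_real//; apply: sqr_mono.
      have d20 : 0 < d ^+ 2 by exact: exprn_gt0.
      rewrite /u2 normrM normrM (gtr0_norm (_ : 0 < (d ^+ 2)^-1)) ?invr_gt0//.
      have zE : `|z y| = `|y - m| / d.
        by rewrite /z normrM (gtr0_norm (_ : 0 < d^-1)) ?invr_gt0.
      apply: le_trans (_ : P * h / d ^+ 2 * (3 / 2 * mu * `|z y|) <= _).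
        apply: ler_pM => //; first by rewrite mulr_ge0// invr_ge0 ltW.
          by rewrite ler_pM2r ?invr_gt0.
        exact: bS2.
      rewrite zE normrM ger0_norm; last first.
        by rewrite divr_ge0 ?mulr_ge0 ?exprn_ge0// ltW.
      by rewrite le_eqVlt; apply/orP; left; apply/eqP; field; rewrite gt_eqF.
    - rewrite ler_ln ?posrE; last 2 first.
      + by have := sqr_ge0 (u1 y); lra.
      + by have := sqr_ge0 (3 * mu * P * h / d); lra.
      rewrite lerD2l; apply: sqr_mono.
      rewrite /u1 normrM normrM (gtr0_norm (_ : 0 < d^-1)) ?invr_gt0//.
      rewrite (_ : 3 * mu * P * h / d = P * h / d * (3 * mu)); last by ring.
      apply: ler_pM; rewrite ?bS1 ?mulr_ge0 ?invr_ge0 ?(ltW d0)//.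
      by rewrite ler_pM2r ?invr_gt0.
    - rewrite ler_pM2l//; apply: sqr_mono.
      have mu1' := ltW mu1; have Ph : 0 <= P * h by rewrite mulr_ge0// ltW.
      apply: le_trans (_ : `|F x - F y| + `|J| * `|S (z y)| <= _).
        rewrite -normrM; apply: le_trans (ler_normD _ _).
        by rewrite /u le_eqVlt; apply/orP; left; apply/eqP; congr `|_|; ring.
      have e1 : `|F x - F y| <= mu * (P * h).
        apply: le_trans (FB _ xy yh) _.
        apply: le_trans (_ : P * h <= _); last by rewrite ler_peMl.
        by apply: ler_wpM2l => //; lra.
      have e2 : `|J| * `|S (z y)| <= P * h * (6 * mu) by apply: ler_pM => //; exact: bS.
      by rewrite (_ : 7 * mu * P * h = mu * (P * h) + P * h * (6 * mu)) ?lerD//; ring.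
  rewrite IntD; [|exact/ItgZ/Itg_cont|exact: Itg_cst].
  rewrite IntZ ?Int_cst//; last exact: Itg_cont.
  rewrite (Int_derives md2 (csq m) (dcub m)).
  rewrite /K /C le_eqVlt; apply/orP; left; apply/eqP.
  by field; rewrite gt_eqF.
rewrite /cell_cost -/Lg mulrDr.
rewrite (_ : h ^+ 3 / 12 = h ^+ 3 / 24 + h ^+ 3 / 24); last by field.
rewrite mulrDr; lra.
Qed.

Lemma admissible_point A beta F a : continuous F -> admissible A beta F a a 0.
Proof.
move=> cF; exists (fun=> F a), (fun=> 0), (fun=> 0); split.
- exact: derives_cst.
- exact: derives_cst.
- by move=> x; exact: cvg_cst.
- by split.
- by rewrite Int_aa.
Qed.

Lemma admissible_cells A beta F G P mu d a h n :
  0 < A -> 0 < beta -> derives F G -> 1 < mu -> 0 < d -> 2 * d <= h ->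
  (forall y, a <= y <= a + n%:R * h -> `|G y| <= P) ->
  admissible A beta F a (a + n%:R * h) (n%:R * cell_cost A beta P mu d h).
Proof.
move=> A0 b0 dF mu1 d0 dh; have h0 : 0 < h by lra.
have cF := derives_continuous dF.
elim: n => [|n IH] GP; first by rewrite !mul0r addr0; exact: admissible_point.
have nh : 0 <= n%:R * h by rewrite mulr_ge0// ltW.
have e1 : a + n.+1%:R * h = a + n%:R * h + h by rewrite -natr1; ring.
have e2 c : n.+1%:R * c = n%:R * c + c by rewrite -natr1; ring.
rewrite e1 e2; apply: (@admissible_glue _ _ _ _ (a + n%:R * h)) => //.
- by rewrite lerDl.
- by rewrite lerDl ltW.
- apply: IH => y /andP[ay yn]; apply: GP; rewrite ay e1/=.
  by apply: le_trans yn _; rewrite lerDl ltW.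
- apply: admissible_cell => // y /andP[ay yn]; apply: GP; rewrite e1 yn andbT.
  by apply: le_trans ay; rewrite lerDl.
Qed.

End Competitors.

(** * The upper bound on a segment *)

Section Upper_bound.
Variable R : realType.
Implicit Types (F G : R -> R) (beta t mu P k l w eps L a b tau A d h K : R).

Lemma cell_cost_mono A beta P mu d h h' : 0 < A -> 0 < beta -> 0 <= P ->
  0 < mu -> 0 < d -> 0 <= h -> h <= h' ->
  cell_cost A beta P mu d h <= cell_cost A beta P mu d h'.
Proof.
move=> A0 b0 P0 mu0 d0 h0 hh; have h0' : 0 <= h' := le_trans h0 hh.
have X n : h ^+ n <= h' ^+ n by apply: lerXn2r; rewrite ?nnegrE.
rewrite /cell_cost; apply: lerD; last apply: lerD.
- rewrite ler_pM2r ?invr_gt0 ?exprn_gt0//; apply: ler_wpM2l (X 2).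
  by rewrite !mulr_ge0 ?sqr_ge0// ltW.
- apply: ler_wpM2l; first by rewrite mulr_ge0// ltW.
  have s0 x : 0 < 1 + x ^+ 2 :> R by have := sqr_ge0 x; lra.
  rewrite ler_ln ?posrE// lerD2l; apply: lerXn2r; rewrite ?nnegrE.
  + by rewrite divr_ge0 ?mulr_ge0// ltW.
  + by rewrite divr_ge0 ?mulr_ge0// ltW.
  rewrite ler_pM2r ?invr_gt0//; apply: ler_wpM2l hh.
  by rewrite !mulr_ge0// ltW.
- apply: ler_wpM2l; first by rewrite mulr_ge0 ?sqr_ge0// ltW.
  apply: lerD; first by rewrite ler_pM2r ?invr_gt0.
  by apply: ler_wpM2l (X 2); rewrite !mulr_ge0 ?sqr_ge0// ltW.
Qed.

Lemma ln_slope_le K eps : 0 < eps -> eps < 1 ->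
  ln (1 + (K / eps ^+ 2) ^+ 2) <= ln (1 + K ^+ 2) + 4 * `|ln eps|.
Proof.
move=> e0 e1.
have ln0 : ln eps < 0 by rewrite -ln1 ltr_ln ?posrE.
have K1 : 0 < 1 + K ^+ 2 by have := sqr_ge0 K; lra.
have e4 : 0 < eps ^+ 4 by exact: exprn_gt0.
have -> : ln (1 + K ^+ 2) + 4 * `|ln eps| = ln ((1 + K ^+ 2) / eps ^+ 4).
  rewrite lnM ?posrE ?invr_gt0// lnV ?posrE// lnXn// ltr0_norm//.
  by rewrite mulrN mulr_natl.
rewrite ler_ln ?posrE ?divr_gt0//; last first.
  by have := sqr_ge0 (K / eps ^+ 2); lra.
rewrite mulrDl div1r expr_div_n -exprM lerD2r -div1r ler_pdivlMr// mul1r.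
by rewrite exprn_ile1// ltW.
Qed.

(** The ratio [k] of the length of the transition to [eps ^+ 2 * w] balances the
    two terms that a transition contributes; the last two terms of the bound are
    errors that vanish with [eps]. *)
Lemma cell_cost_le beta t mu P eps w L l k : 0 < beta -> 0 < t -> 0 < P -> 1 < mu ->
  0 < eps -> eps < 1 -> 0 < w -> L = `|ln eps| -> 0 < L -> w ^+ 2 = eps ^+ 2 * L ->
  beta * t ^+ 5 / (3 * P) = 16 / Num.sqrt 3 ->
  l = t ^+ 2 / P -> k = Num.sqrt 3 * t ->
  cell_cost (eps ^+ 6 * w ^+ 4) beta P mu (k * eps ^+ 2 * w / 2) (w * l) <=
  w ^+ 3 * (mu ^+ 2 * (l * cost beta t) +
    (k * ln (1 + (2 * mu * k) ^+ 2) / L +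
     49 * beta * mu ^+ 2 * t ^+ 4 * k * eps ^+ 2)).
Proof.
move=> b0 t0 P0 mu1 e0 e1 w0 LE L0 wE tE lE kD.
have q0 : 0 < Num.sqrt (3 : R) by rewrite sqrtr_gt0.
have qE : Num.sqrt (3 : R) ^+ 2 = 3 by rewrite sqr_sqrtr.
have k0 : 0 < k by rewrite kD mulr_gt0.
have kE : k ^+ 2 = 3 * t ^+ 2 by rewrite kD exprMn qE.
have l0 : 0 < l by rewrite lE divr_gt0// exprn_gt0.
have Pl : P * l = t ^+ 2 by rewrite lE; field; rewrite gt_eqF.
have Pl2 : P ^+ 2 * l ^+ 2 = t ^+ 4 by rewrite -exprMn Pl -exprM.
have t4 : t ^+ 4 = (k ^+ 2 / 3) ^+ 2 by rewrite kE; field.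
have tk : beta * t ^+ 4 * l = 16 * k.
  have -> : beta * t ^+ 4 * l = 3 * t * (beta * t ^+ 5 / (3 * P)).
    by rewrite lE; field; rewrite gt_eqF.
  have qV : (Num.sqrt 3)^-1 = Num.sqrt 3 / 3 :> R.
    apply: (mulfI (lt0r_neq0 q0)); rewrite divff ?gt_eqF// mulrA -expr2 qE.
    by rewrite divff// pnatr_eq0.
  by rewrite tE qV kD; field.
have mu0 : 0 < mu by lra.
have mu2 : 1 <= mu ^+ 2 by rewrite -[leLHS](expr1n _ 2) lerXn2r ?nnegrE ?(ltW mu0) ?(ltW mu1).
rewrite /cell_cost.
have -> : eps ^+ 6 * w ^+ 4 * (3 / 2) * mu ^+ 2 * P ^+ 2 * (w * l) ^+ 2 /
    (k * eps ^+ 2 * w / 2) ^+ 3 = w ^+ 3 * (4 / 3 * mu ^+ 2 * k).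
  have -> : eps ^+ 6 * w ^+ 4 * (3 / 2) * mu ^+ 2 * P ^+ 2 * (w * l) ^+ 2 =
    eps ^+ 6 * w ^+ 4 * (3 / 2) * mu ^+ 2 * w ^+ 2 * (P ^+ 2 * l ^+ 2) by ring.
  by rewrite Pl2 t4; field; rewrite !gt_eqF.
have -> : 3 * mu * P * (w * l) / (k * eps ^+ 2 * w / 2) = 2 * mu * k / eps ^+ 2.
  have -> : 3 * mu * P * (w * l) = 3 * mu * w * (P * l) by ring.
  rewrite Pl (_ : t ^+ 2 = k ^+ 2 / 3); last by rewrite kE; field.
  by field; rewrite !gt_eqF.
have -> : beta * P ^+ 2 * ((w * l) ^+ 3 / 12 +
      98 * mu ^+ 2 * (k * eps ^+ 2 * w / 2) * (w * l) ^+ 2) =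
    w ^+ 3 * (4 / 3 * k + 49 * beta * mu ^+ 2 * t ^+ 4 * k * eps ^+ 2).
  rewrite (_ : 4 / 3 * k = 16 * k / 12); last by field.
  by rewrite -tk -Pl2; field.
have hln := ln_slope_le (2 * mu * k) e0 e1; rewrite -LE in hln.
have h2 : 2 * (k * eps ^+ 2 * w / 2) * ln (1 + (2 * mu * k / eps ^+ 2) ^+ 2) <=
    w ^+ 3 * (k * ln (1 + (2 * mu * k) ^+ 2) / L + 4 * k).
  apply: le_trans (_ : 2 * (k * eps ^+ 2 * w / 2) *
      (ln (1 + (2 * mu * k) ^+ 2) + 4 * L) <= _).
    apply: ler_wpM2l hln; apply: ltW.
    by rewrite mulr_gt0// divr_gt0// !mulr_gt0// exprn_gt0.
  rewrite (_ : eps ^+ 2 = w ^+ 2 / L); last by rewrite wE; field; rewrite gt_eqF.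
  by rewrite le_eqVlt; apply/orP; left; apply/eqP; field; rewrite gt_eqF.
apply: le_trans (lerD (lexx _) (lerD h2 (lexx _))) _.
rewrite -!mulrDr ler_pM2l ?exprn_gt0// /cost.
rewrite (_ : l * (5 / 12 * beta * t ^+ 4) = 5 / 12 * (beta * t ^+ 4 * l)); last by ring.
rewrite tk.
have : 4 / 3 * k + 4 * k + 4 / 3 * k + 4 / 3 * (mu ^+ 2 - 1) * k <=
    mu ^+ 2 * (5 / 12 * (16 * k)).
  rewrite -subr_ge0 (_ : _ - _ = 16 / 3 * ((mu ^+ 2 - 1) * k)); last by field.
  by rewrite !mulr_ge0 ?divr_ge0 ?subr_ge0// ltW.
lra.
Qed.

Lemma upper_bound_slope beta t P a b F G tau :
  0 < beta -> 0 < t -> 0 < P -> 0 < tau -> a < b ->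
  beta * t ^+ 5 / (3 * P) = 16 / Num.sqrt 3 ->
  derives F G -> (forall x, a <= x <= b -> `|G x| <= P) ->
  \forall eps \near (0 : R)^'+, admissible (eps ^+ 6 * omega eps ^+ 4) beta F a b
    (omega eps ^+ 2 * ((cost beta t + tau) * (b - a))).
Proof.
move=> b0 t0 P0 tau0 ab tE dF GP.
have [c c0 cE] : exists2 c, 0 < c & cost beta t = c.
  by exists (cost beta t) => //; exact: cost_gt0.
have [l l0 lE] : exists2 l, 0 < l & l = t ^+ 2 / P.
  by exists (t ^+ 2 / P) => //; rewrite divr_gt0// exprn_gt0.
have [k k0 kE] : exists2 k, 0 < k & k = Num.sqrt 3 * t.
  by exists (Num.sqrt 3 * t) => //; rewrite mulr_gt0// sqrtr_gt0.
have [T T0 TE] : exists2 T, 0 < T & T = b - a.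
  by exists (b - a) => //; rewrite subr_gt0.
have [mu mu1 muc] : exists2 mu, 1 < mu & mu ^+ 2 * c <= c + tau / 4.
  have [s s0 [s1 sc]] : exists2 s : R, 0 < s & s <= 1 /\ s <= tau / (12 * c).
    exists (Num.min 1 (tau / (12 * c))).
      by rewrite lt_min ltr01 divr_gt0// mulr_gt0.
    by rewrite !ge_min !lexx orbT.
  exists (1 + s); first by rewrite ltrDl.
  move: sc; rewrite ler_pdivlMr ?mulr_gt0// => sc.
  have : s ^+ 2 * c <= s * c by rewrite ler_pM2r// expr2 ler_piMl// ltW.
  rewrite (_ : (1 + s) ^+ 2 * c = c + 2 * (s * c) + s ^+ 2 * c); last by ring.
  lra.
have mu0 : 0 < mu by lra.
have [Lam Lam0 LamE] : exists2 Lam, 0 <= Lam & Lam = ln (1 + (2 * mu * k) ^+ 2).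
  exists (ln (1 + (2 * mu * k) ^+ 2)) => //; rewrite ln_ge0//.
  by rewrite lerDl sqr_ge0.
have [B B0 BE] : exists2 B, 0 < B & B = 49 * beta * mu ^+ 2 * t ^+ 4 * k.
  by eexists; last reflexivity; rewrite !mulr_gt0// exprn_gt0.
have dd1 : 0 < l * tau / (8 * B) by rewrite divr_gt0 ?mulr_gt0.
have dd2 : 0 < l / (2 * k) by rewrite divr_gt0 ?mulr_gt0.
have dd3 : 0 < T / (2 * k) by rewrite divr_gt0 ?mulr_gt0.
have ct : 0 < c + tau / 2 by rewrite addr_gt0 ?divr_gt0.
have dd4 : 0 < tau * T / (2 * (c + tau / 2) * l) by rewrite divr_gt0 ?mulr_gt0.
near=> eps.
have [e0 e1 hK L0 _] : [/\ 0 < eps, eps < 1, 8 * k * Lam / (l * tau) <= `|ln eps|,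
    0 < `|ln eps| & eps = expR (- `|ln eps|)] by near: eps; exact: near_log.
have f1 : eps <= l * tau / (8 * B) by near: eps; exact: nbhs_right_le.
have f2 : eps <= l / (2 * k) by near: eps; exact: nbhs_right_le.
have f3 : eps <= T / (2 * k) by near: eps; exact: nbhs_right_le.
have /andP[w0 w1] : 0 < omega eps <= 1 by near: eps; exact: near_omega.
have /andP[_ w2] : 0 < omega eps <= tau * T / (2 * (c + tau / 2) * l).
  by near: eps; exact: near_omega.
have wE := omega_sqr eps.
have [L LE] : exists L : R, L = `|ln eps| by eexists.
rewrite -LE in wE L0 hK.
move: w0 w1 w2 wE; move: (omega eps) => w w0 w1 w2 wE.
have ee : eps ^+ 2 <= eps by rewrite expr2 ler_piMl// ltW.
have e20 : 0 < eps ^+ 2 by exact: exprn_gt0.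
have [X XE] : exists X, X = cell_cost (eps ^+ 6 * w ^+ 4) beta P mu
    (k * eps ^+ 2 * w / 2) (w * l) by eexists.
have hX : X <= w ^+ 3 * (l * (c + tau / 2)).
  rewrite XE; apply: le_trans (cell_cost_le b0 t0 P0 mu1 e0 e1 w0 LE L0 wE tE lE kE) _.
  rewrite ler_pM2l ?exprn_gt0// cE -LamE -BE.
  have g1 : k * Lam / L <= l * tau / 8.
    rewrite ler_pdivrMr//; move: hK; rewrite ler_pdivrMr ?mulr_gt0//; lra.
  have g2 : B * eps ^+ 2 <= l * tau / 8.
    apply: le_trans (_ : B * eps <= _); first by rewrite ler_pM2l.
    by move: f1; rewrite ler_pdivlMr ?mulr_gt0//; lra.
  have g3 : l * (mu ^+ 2 * c) <= l * (c + tau / 4) by rewrite ler_pM2l.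
  by move: g1 g2 g3; rewrite !mulrDr (mulrCA (mu ^+ 2)); lra.
(* n cells, of equal length h slightly smaller than w * l *)
pose n := (Num.trunc (T / (w * l))).+1.
have wl0 : 0 < w * l by exact: mulr_gt0.
have n_gt : T / (w * l) < n%:R by exact: truncnS_gt.
have n_le : n%:R <= T / (w * l) + 1.
  rewrite /n -natr1 lerD2r truncn_le.
  by rewrite divr_ge0// ltW.
have n0 : 0 < n%:R :> R by rewrite ltr0n.
clearbody n.
pose h := T / n%:R; have h0 : 0 < h by exact: divr_gt0.
have nh : n%:R * h = T by rewrite /h mulrCA divff ?gt_eqF// mulr1.
have hwl : h <= w * l.
  by rewrite ler_pdivrMr// mulrC -ler_pdivrMr// ltW.
pose d := k * eps ^+ 2 * w / 2.
have d0 : 0 < d by rewrite !mulr_gt0.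
have f2' : 2 * (k * eps ^+ 2) <= l.
  apply: le_trans (_ : 2 * (k * eps) <= _); first by rewrite ler_pM2l// ler_pM2l.
  by move: f2; rewrite ler_pdivlMr ?mulr_gt0//; lra.
have f3' : 2 * (k * eps ^+ 2) <= T.
  apply: le_trans (_ : 2 * (k * eps) <= _); first by rewrite ler_pM2l// ler_pM2l.
  by move: f3; rewrite ler_pdivlMr ?mulr_gt0//; lra.
have dh : 2 * d <= h.
  rewrite ler_pdivlMr//.
  apply: le_trans (_ : 2 * d * (T / (w * l) + 1) <= _).
    by rewrite ler_pM2l// mulr_gt0.
  have -> : 2 * d * (T / (w * l) + 1) =
      (k * eps ^+ 2 / l) * T + k * eps ^+ 2 * w.
    by rewrite /d; field; rewrite !gt_eqF.
  have g1 : k * eps ^+ 2 / l * T <= 1 / 2 * T.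
    by rewrite ler_pM2r// ler_pdivrMr//; lra.
  have g2 : k * eps ^+ 2 * w <= k * eps ^+ 2.
    by rewrite ler_piMr// mulr_ge0// ltW.
  lra.
have A0 : 0 < eps ^+ 6 * w ^+ 4 by rewrite mulr_gt0// exprn_gt0.
have abE : b = a + n%:R * h by rewrite nh TE addrC subrK.
have P0' := ltW P0.
have := @admissible_cells _ (eps ^+ 6 * w ^+ 4) beta F G P mu d a h n A0 b0 dF mu1 d0 dh.
rewrite -abE => /(_ GP); apply: admissible_le.
apply: le_trans (_ : n%:R * X <= _).
  rewrite ler_pM2l// XE; apply: cell_cost_mono => //; exact: ltW.
apply: le_trans (_ : n%:R * (w ^+ 3 * (l * (c + tau / 2))) <= _).
  by rewrite ler_pM2l.
apply: le_trans (_ : (T / (w * l) + 1) * (w ^+ 3 * (l * (c + tau / 2))) <= _).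
  by rewrite ler_pM2r// !mulr_gt0// exprn_gt0.
rewrite [leLHS](_ : _ = w ^+ 2 * ((c + tau / 2) * T + w * (l * (c + tau / 2)))); last first.
  by field; rewrite !gt_eqF.
rewrite ler_pM2l ?exprn_gt0// cE -TE.
have : w * (2 * (c + tau / 2) * l) <= tau * T.
  by move: w2; rewrite ler_pdivlMr ?mulr_gt0.
rewrite !mulrDl; lra.
Unshelve. all: by end_near. Qed.

End Upper_bound.

(** * From local to global bounds *)

Section Local_to_global.
Variable R : realType.
Implicit Types (f F G U W v : R -> R) (a b c p q t x y beta tau : R).

(** The compactness of [a, b], for a property that can be glued. *)
Lemma interval_induction (Pr : R -> R -> Prop) :
  (forall a, Pr a a) ->
  (forall a b c, a <= b -> b <= c -> Pr a b -> Pr b c -> Pr a c) ->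
  (forall x, exists2 d : R, 0 < d & forall a b, x - d < a -> a <= b -> b < x + d -> Pr a b) ->
  forall a b, a <= b -> Pr a b.
Proof.
move=> Pid Padd Ploc a b ab.
pose S : set R := [set x | a <= x <= b /\ Pr a x].
have Sa : S a by split; [rewrite lexx|exact: Pid].
have hS : has_sup S by split; [exists a|exists b => x [/andP[]]].
have as_ : a <= sup S by exact: ub_le_sup hS.2 _ Sa.
have sb : sup S <= b by apply: ge_sup; [exists a|move=> x [/andP[]]].
have [d d0 hd] := Ploc (sup S).
have [x Sx xs] := sup_adherent d0 hS.
have xsup : x <= sup S by exact: ub_le_sup hS.2 _ Sx.
have [/andP[ax xb] Pax] := Sx.
have ext y : sup S <= y -> y <= b -> y < sup S + d -> Pr a y.
  move=> sy yb yd; have xy : x <= y := le_trans xsup sy.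
  by apply: Padd Pax _ => //; exact: hd.
have [bd|bd] := ltP b (sup S + d); first exact: ext.
have sy : sup S < sup S + d / 2 by lra.
have yb : sup S + d / 2 <= b by lra.
have Sy : S (sup S + d / 2).
  split; first by rewrite yb andbT; lra.
  by apply: ext => //; lra.
have : sup S + d / 2 <= sup S by exact: ub_le_sup hS.2 _ Sy.
by rewrite leNgt sy.
Qed.

Definition energy_const beta : R := 10 * (2 * beta / 27) `^ (1 / 5).

(** The least energy per unit length of a staircase of slope [p], in units of
    omega^2; the exponent comes from the scaling of the optimal length of the
    steps. *)
Definition slope_energy beta p : R := energy_const beta * `|p| `^ (4 / 5).

Lemma energy_const_ge0 beta : 0 <= energy_const beta.
Proof. by rewrite mulr_ge0// powR_ge0. Qed.

Lemma slope_energy_ge0 beta p : 0 <= slope_energy beta p.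
Proof. by rewrite mulr_ge0 ?energy_const_ge0 ?powR_ge0. Qed.

Lemma powR_frac_expn x (m n : nat) : 0 <= x -> (0 < n)%N ->
  (x `^ (m%:R / n%:R)) ^+ n = x ^+ m.
Proof.
move=> x0 n0; rewrite -powR_mulrn ?powR_ge0// -powRrM divfK ?powR_mulrn//.
by rewrite pnatr_eq0 -lt0n.
Qed.

Lemma continuous_norm_powR : continuous (fun x : R => `|x| `^ (4 / 5)).
Proof.
move=> x; have [->|x0] := eqVneq x 0; last first.
  have d : derivable (fun y : R => y `^ (4 / 5)) `|x| 1.
    by apply: derivable_powR; rewrite in_itv/= andbT normr_gt0.
  have c : {for `|x|, continuous (fun y : R => y `^ (4 / 5))}.
    by apply: differentiable_continuous; exact/derivable1_diffP.
  exact: (cvg_comp _ _ (@norm_continuous _ R x) c).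
rewrite /continuous_at normr0 powR0; last by rewrite mulf_neq0 ?invr_eq0 ?pnatr_eq0.
apply/cvgrPdist_le => e e0.
have d0 : 0 < e `^ (5 / 4) by exact: powR_gt0.
apply/nbhs_ballP; exists (e `^ (5 / 4)) => //= y.
rewrite /ball/= sub0r normrN => /ltW yd.
rewrite sub0r normrN ger0_norm ?powR_ge0//.
apply: le_trans (_ : (e `^ (5 / 4)) `^ (4 / 5) <= _).
  by apply: ge0_ler_powR => //; rewrite nnegrE// ltW.
rewrite -powRrM (_ : 5 / 4 * (4 / 5) = 1); last by field.
by rewrite powRr1// ltW.
Qed.

Lemma continuous_slope_energy beta : continuous (slope_energy beta).
Proof. by move=> x; apply: cvgM; [exact: cvg_cst|exact: continuous_norm_powR]. Qed.

Lemma eq_expr5 x y : 0 <= x -> 0 <= y -> x ^+ 5 = y ^+ 5 -> x = y.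
Proof. by move=> x0 y0; apply: (pexpIrn (n := 5)); rewrite ?nnegrE. Qed.

(** The first equation determines [t]; fifth powers turn the second one into an
    identity between rational functions. *)
Lemma optimal_cost beta p : 0 < beta -> 0 < p -> exists t,
  [/\ 0 < t, beta * t ^+ 5 / (3 * p) = 16 / Num.sqrt 3 &
      cost beta t = slope_energy beta p].
Proof.
move=> b0 p0; have q0 : 0 < Num.sqrt (3 : R) by rewrite sqrtr_gt0.
have qE : Num.sqrt (3 : R) ^+ 2 = 3 by rewrite sqr_sqrtr.
pose X := 48 * p / (beta * Num.sqrt 3).
have X0 : 0 < X by rewrite divr_gt0 ?mulr_gt0.
pose t := X `^ (1 / 5).
have t0 : 0 < t by exact: powR_gt0.
have t5 : t ^+ 5 = X.
  by rewrite -[RHS]expr1 -(@powR_frac_expn X 1 5)// ltW.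
exists t; split=> //; first by rewrite t5 /X; field; rewrite !gt_eqF.
apply: eq_expr5; [exact/ltW/cost_gt0|exact: slope_energy_ge0|].
have tE : (t ^+ 4) ^+ 5 = X ^+ 4 by rewrite -t5 -!exprM.
have aE : ((2 * beta / 27) `^ (1 / 5)) ^+ 5 = 2 * beta / 27.
  by rewrite (@powR_frac_expn _ 1 5)// divr_ge0 ?mulr_ge0// ltW.
have bE : (`|p| `^ (4 / 5)) ^+ 5 = p ^+ 4.
  by rewrite (@powR_frac_expn _ 4 5)// (gtr0_norm p0).
rewrite /cost /slope_energy /energy_const.
move: (t ^+ 4) (_ `^ (1 / 5)) (_ `^ (4 / 5)) tE aE bE => z x y tE aE bE.
rewrite (_ : (10 * x * y) ^+ 5 = 10 ^+ 5 * x ^+ 5 * y ^+ 5); last by ring.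
rewrite (_ : (5 / 12 * beta * z) ^+ 5 = (5 / 12 * beta) ^+ 5 * z ^+ 5); last by ring.
rewrite tE aE bE /X.
have -> : (48 * p / (beta * Num.sqrt 3)) ^+ 4 =
    (48 * p) ^+ 4 / (beta ^+ 4 * (Num.sqrt 3 ^+ 2) ^+ 2).
  by field; rewrite !gt_eqF.
by rewrite qE; field; rewrite gt_eqF.
Qed.

(** The margin [k < 1] on the cost of the jumps is what the lower bound
    requires. *)
Lemma almost_optimal_cost beta p tau : 0 < beta -> 0 < p -> 0 < tau -> exists t k,
  [/\ 0 < t, 0 < k, k < 1, beta * t ^+ 5 / (3 * p) = 16 / Num.sqrt 3 * k &
      slope_energy beta p - tau <= cost beta t].
Proof.
move=> b0 p0 tau0; have [t [t0 tE cE]] := optimal_cost b0 p0.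
have c0 : 0 < cost beta t by exact: cost_gt0.
have [s s0 [s1 sc]] : exists2 s : R, 0 < s & s <= 1 / 2 /\ s <= tau / (4 * cost beta t).
  exists (Num.min (1 / 2) (tau / (4 * cost beta t))).
    by rewrite lt_min divr_gt0// divr_gt0// mulr_gt0.
  by rewrite !ge_min !lexx orbT.
have r0 : 0 < 1 - s by lra.
have r1 : 1 - s < 1 by lra.
exists (t * (1 - s)), ((1 - s) ^+ 5); split.
- exact: mulr_gt0.
- exact: exprn_gt0.
- by rewrite exprn_ilt1 ?ltW.
- rewrite -tE exprMn; field; by rewrite gt_eqF.
- have -> : cost beta (t * (1 - s)) = cost beta t * (1 - s) ^+ 4.
    by rewrite /cost exprMn; ring.
  rewrite -cE; move: sc; rewrite ler_pdivlMr ?mulr_gt0// => sc.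
  have : 1 - 4 * s <= (1 - s) ^+ 4.
    rewrite -subr_ge0 (_ : _ - _ = s ^+ 2 * (6 - 4 * s + s ^+ 2)); last by ring.
    rewrite mulr_ge0 ?sqr_ge0//; have := sqr_ge0 s; lra.
  rewrite -(ler_pM2l c0); lra.
Qed.

Lemma ball_of_near (Q : R -> Prop) x : (\forall y \near x, Q y) ->
  exists2 d : R, 0 < d & forall y, x - d < y -> y < x + d -> Q y.
Proof.
move=> [d /= d0 hd]; exists d => // y y1 y2; apply: hd.
by rewrite /ball/= ltr_norml; apply/andP; split; lra.
Qed.

End Local_to_global.

Section Gamma_limit.
Variable R : realType.
Variables (beta tau : R) (F G : R -> R).
Hypotheses (beta0 : 0 < beta) (tau0 : 0 < tau) (dF : derives F G) (cG : continuous G).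
Implicit Types (a b c x y : R).

Let psi x := slope_energy beta (G x).

Let cpsi : continuous psi.
Proof. exact: continuous_compR (@continuous_slope_energy _ beta) cG. Qed.

Let near_psi x (e : R) : 0 < e -> \forall y \near x, `|psi x - psi y| <= e.
Proof. by move=> e0; have /cvgrPdist_le := @cpsi x; apply. Qed.

Let Int_psi_le a b k : a <= b -> (forall x, a <= x <= b -> psi x <= k) ->
  Int a b psi <= k * (b - a).
Proof.
by move=> ab h; rewrite -Int_cst//; apply: ler_Int; [exact: Itg_cont|exact: Itg_cst|].
Qed.

Let Int_psi_ge a b k : a <= b -> (forall x, a <= x <= b -> k <= psi x) ->
  k * (b - a) <= Int a b psi.
Proof.
by move=> ab h; rewrite -Int_cst//; apply: ler_Int; [exact: Itg_cst|exact: Itg_cont|].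
Qed.

Lemma density_opp A U W v x :
  density A beta (fun y => - F y) (fun y => - U y) (fun y => - W y) (fun y => - v y) x =
  density A beta F U W v x.
Proof. by rewrite /density -opprD !sqrrN. Qed.

Lemma H2_repN (U W v : R -> R) : H2_rep U W v ->
  H2_rep (fun x => - U x) (fun x => - W x) (fun x => - v x).
Proof.
move=> [dU cW vi v2i Wv]; split.
- by have := derivesZ (-1) dU; apply: eq_derives => x; rewrite mulN1r.
- by move=> x; apply: cvgN; exact: cW.
- by move=> a b; apply: ItgN.
- by move=> a b; apply: eq_Itg (v2i a b) => x; rewrite sqrrN.
- by move=> a b ab; rewrite IntN// -Wv//; ring.
Qed.

Definition lower_bound_on a b : Prop := \forall eps \near (0 : R)^'+,
  forall U W v, H2_rep U W v ->
  omega eps ^+ 2 * (Int a b psi - tau * (b - a)) <=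
  Int a b (density (eps ^+ 6 * omega eps ^+ 4) beta F U W v).

Definition upper_bound_on a b : Prop := \forall eps \near (0 : R)^'+,
  admissible (eps ^+ 6 * omega eps ^+ 4) beta F a b
    (omega eps ^+ 2 * (Int a b psi + tau * (b - a))).

Let cF : continuous F. Proof. exact: derives_continuous dF. Qed.

(** Where [G] vanishes the limit energy is negligible. Elsewhere [G] keeps a
    sign, which a reflection makes positive, and [G] is bounded below by a slope
    whose limit energy is close. *)
Lemma lower_bound_local x : exists2 d : R, 0 < d &
  forall a b, x - d < a -> a <= b -> b < x + d -> lower_bound_on a b.
Proof.
have tau4 : 0 < tau / 4 by rewrite divr_gt0.
have point a : lower_bound_on a a.
  by near=> eps => U W v _; rewrite !Int_aa !subrr mulr0 subr0 mulr0.
have [Gx|Gx] := eqVneq (G x) 0.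
  have [d d0 hd] := ball_of_near (near_psi x tau4).
  exists d => // a b xa ab bx; near=> eps.
  have [e0 _ _ _ _] : [/\ 0 < eps, eps < 1, 0 <= `|ln eps|, 0 < `|ln eps| &
    eps = expR (- `|ln eps|)] by near: eps; exact: near_log.
  move=> U W v rep; apply: (@le_trans _ _ 0).
    rewrite mulr_ge0_le0 ?sqr_ge0// subr_le0.
    apply: Int_psi_le => // y /andP[ay yb].
    have := hd y (lt_le_trans xa ay) (le_lt_trans yb bx).
    rewrite {1}/psi Gx /slope_energy normr0 powR0; last first.
      by rewrite mulf_neq0 ?invr_eq0 ?pnatr_eq0.
    rewrite mulr0 sub0r normrN => /(le_trans (ler_norm _)).
    have := tau0; lra.
  apply: Int_ge0 => y _; rewrite /density.
  have w0 : 0 <= omega eps by rewrite mulr_ge0 ?sqrtr_ge0// ltW.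
  apply: addr_ge0; last apply: addr_ge0.
  - apply: mulr_ge0; last exact: sqr_ge0.
    by apply: mulr_ge0; apply: exprn_ge0 => //; exact: ltW.
  - by rewrite ln_ge0// lerDl sqr_ge0.
  - by apply: mulr_ge0; [exact: ltW|exact: sqr_ge0].
have [p [p0 pG hp]] : exists p, [/\ 0 < p, p < `|G x| &
    slope_energy beta (G x) - tau / 4 <= slope_energy beta p].
  have Gx0 : 0 < `|G x| by rewrite normr_gt0.
  have : \forall y \near `|G x|, `|slope_energy beta `|G x| - slope_energy beta y| <= tau / 4.
    by have /cvgrPdist_le := @continuous_slope_energy _ beta `|G x|; apply.
  move=> /ball_of_near[d d0 hd].
  have [e e0 [ed eG]] : exists2 e : R, 0 < e & e < d /\ e < `|G x|.
    exists (Num.min (d / 2) (`|G x| / 2)); first by rewrite lt_min !divr_gt0.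
    by rewrite !gt_min; split; apply/orP; [left|right]; lra.
  exists (`|G x| - e); split; [lra|lra|].
  have := hd (`|G x| - e); rewrite {1}/slope_energy normr_id -/(slope_energy beta (G x)).
  move=> /(_ ltac:(lra) ltac:(lra)) /(le_trans (ler_norm _)); lra.
have [t [k [t0 k0 k1 tE ct]]] := almost_optimal_cost beta0 p0 tau4.
have nG : \forall y \near x, p < `|G y|.
  have c : (fun y => `|G y|) @ x --> `|G x| by apply: cvg_norm; exact: cG.
  by apply: (cvgr_gt _ c).
have nS : \forall y \near x, 0 < G x * G y.
  have h : 0 < G x * G x by rewrite -expr2 exprn_even_gt0.
  have c : (fun y => G x * G y) @ x --> G x * G x.
    by apply: cvgM; [exact: cvg_cst|exact: cG].
  by apply: (cvgr_gt _ c).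
have [d d0 hd] := ball_of_near (near_psi x tau4).
have [d1 d10 hd1] := ball_of_near nG.
have [d2 d20 hd2] := ball_of_near nS.
exists (Num.min d (Num.min d1 d2)); first by rewrite !lt_min d0 d10.
move=> a b; rewrite ltrBlDr => xa ab bx.
move: ab; rewrite le_eqVlt => /predU1P[<-|ab]; first exact: point.
have I y : a <= y <= b -> [/\ `|psi x - psi y| <= tau / 4, p < `|G y| & 0 < G x * G y].
  move=> /andP[ay yb].
  have y1 : x < y + Num.min d (Num.min d1 d2) by apply: lt_le_trans xa _; rewrite lerD2r.
  have y2 : y < x + Num.min d (Num.min d1 d2) by exact: le_lt_trans yb bx.
  have m1 : Num.min d (Num.min d1 d2) <= d by rewrite ge_min lexx.
  have m2 : Num.min d (Num.min d1 d2) <= d1 by rewrite !ge_min lexx orbT.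
  have m3 : Num.min d (Num.min d1 d2) <= d2 by rewrite !ge_min lexx !orbT.
  by split; [apply: hd|apply: hd1|apply: hd2]; lra.
have IntI : Int a b psi - tau * (b - a) <= (cost beta t - tau / 4) * (b - a).
  rewrite lerBlDr -mulrDl; apply: Int_psi_le; first exact: ltW.
  move=> y /I[h _ _]; have {}h : psi y <= psi x + tau / 4.
    by move: h; rewrite ler_distlC => /andP[_]; lra.
  have : psi x - tau / 4 - tau / 4 <= cost beta t.
    by apply: le_trans ct; rewrite lerD2r.
  by have := tau0; lra.
have [M M0 hM] := @continuous_bounded _ _ a b cG.
have [Gp|Gn] : (forall y, a <= y <= b -> p <= G y) \/
    (forall y, a <= y <= b -> p <= - G y).
  have [G0|G0] := ltP 0 (G x); [left|right] => y /I[_ pGy s].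
    by rewrite -(gtr0_norm (_ : 0 < G y)) ?ltW// -(pmulr_rgt0 _ G0).
  have {}G0 : G x < 0 by rewrite lt_neqAle Gx.
  by rewrite -(ltr0_norm (_ : G y < 0)) ?ltW// -(nmulr_rgt0 _ G0).
- have := lower_bound_slope beta0 t0 p0 k0 k1 tau4 ab tE dF cG hM Gp.
  apply: filterS => eps H U W v rep; apply: le_trans (H _ _ _ rep).
  by apply: ler_wpM2l IntI; exact: sqr_ge0.
- have dFN : derives (fun x => - F x) (fun x => - G x).
    by have := derivesZ (-1) dF; apply: eq_derives => y; rewrite mulN1r.
  have cGN : continuous (fun x => - G x) by move=> y; apply: cvgN; exact: cG.
  have hMN y : a <= y <= b -> `|- G y| <= M by move=> /hM; rewrite normrN.
  have := lower_bound_slope beta0 t0 p0 k0 k1 tau4 ab tE dFN cGN hMN Gn.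
  apply: filterS => eps H U W v rep; have := H _ _ _ (H2_repN rep).
  rewrite (eq_Int (fun y _ => density_opp _ U W v y)); apply: le_trans.
  by apply: ler_wpM2l IntI; exact: sqr_ge0.
Unshelve. all: by end_near. Qed.

Lemma upper_bound_local x : exists2 d : R, 0 < d &
  forall a b, x - d < a -> a <= b -> b < x + d -> upper_bound_on a b.
Proof.
have tau4 : 0 < tau / 4 by rewrite divr_gt0.
have point a : upper_bound_on a a.
  near=> eps; rewrite Int_aa subrr mulr0 addr0 mulr0.
  exact: admissible_point.
have [P [P0 PG hP]] : exists P, [/\ 0 < P, `|G x| < P &
    slope_energy beta P <= slope_energy beta (G x) + tau / 4].
  have Gx0 : 0 <= `|G x| by [].
  have : \forall y \near `|G x|, `|slope_energy beta `|G x| - slope_energy beta y| <= tau / 4.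
    by have /cvgrPdist_le := @continuous_slope_energy _ beta `|G x|; apply.
  move=> /ball_of_near[d d0 hd].
  exists (`|G x| + d / 2); split; [lra|lra|].
  have := hd (`|G x| + d / 2); rewrite {1}/slope_energy normr_id -/(slope_energy beta (G x)).
  move=> /(_ ltac:(lra) ltac:(lra)); rewrite ler_distlC => /andP[_]; lra.
have [t [t0 tE ct]] := optimal_cost beta0 P0.
have nG : \forall y \near x, `|G y| < P.
  have c : (fun y => `|G y|) @ x --> `|G x| by apply: cvg_norm; exact: cG.
  by apply: (cvgr_lt _ c).
have [d d0 hd] := ball_of_near (near_psi x tau4).
have [d1 d10 hd1] := ball_of_near nG.
exists (Num.min d d1); first by rewrite !lt_min d0 d10.
move=> a b; rewrite ltrBlDr => xa ab bx.
move: ab; rewrite le_eqVlt => /predU1P[<-|ab]; first exact: point.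
have I y : a <= y <= b -> `|psi x - psi y| <= tau / 4 /\ `|G y| < P.
  move=> /andP[ay yb].
  have y1 : x < y + Num.min d d1 by apply: lt_le_trans xa _; rewrite lerD2r.
  have y2 : y < x + Num.min d d1 by exact: le_lt_trans yb bx.
  have m1 : Num.min d d1 <= d by rewrite ge_min lexx.
  have m2 : Num.min d d1 <= d1 by rewrite !ge_min lexx orbT.
  by split; [apply: hd|apply: hd1]; lra.
have IntI : (cost beta t + tau / 4) * (b - a) <= Int a b psi + tau * (b - a).
  rewrite -lerBlDr -mulrBl; apply: Int_psi_ge; first exact: ltW.
  move=> y /I[h _]; have {}h : psi x - tau / 4 <= psi y.
    by move: h; rewrite ler_distlC => /andP[]; lra.
  have : cost beta t <= psi x + tau / 4 by rewrite ct.
  by have := tau0; lra.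
have := upper_bound_slope beta0 t0 P0 tau4 ab tE dF (fun y yI => ltW (I y yI).2).
apply: filterS => eps; apply: admissible_le.
by apply: ler_wpM2l IntI; exact: sqr_ge0.
Unshelve. all: by end_near. Qed.

Lemma lower_bound_segment a b : a <= b -> lower_bound_on a b.
Proof.
move: a b; apply: (interval_induction _ _ lower_bound_local).
  by move=> a; near=> eps => U W v _; rewrite !Int_aa !subrr mulr0 subr0 mulr0.
move=> a b c ab bc h1 h2; near=> eps => U W v rep.
have H1 : forall U W v, H2_rep U W v ->
  omega eps ^+ 2 * (Int a b psi - tau * (b - a)) <=
  Int a b (density (eps ^+ 6 * omega eps ^+ 4) beta F U W v) by near: eps; exact: h1.
have H2 : forall U W v, H2_rep U W v ->
  omega eps ^+ 2 * (Int b c psi - tau * (c - b)) <=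
  Int b c (density (eps ^+ 6 * omega eps ^+ 4) beta F U W v) by near: eps; exact: h2.
rewrite (Int_split ab bc (Itg_cont _ _ cpsi)).
rewrite (Int_split ab bc (locint_density _ _ cF rep _ _)).
apply: le_trans (lerD (H1 _ _ _ rep) (H2 _ _ _ rep)).
by rewrite le_eqVlt; apply/orP; left; apply/eqP; ring.
Unshelve. all: by end_near. Qed.

Lemma upper_bound_segment a b : a <= b -> upper_bound_on a b.
Proof.
move: a b; apply: (interval_induction _ _ upper_bound_local).
  move=> a; near=> eps; rewrite Int_aa subrr mulr0 addr0 mulr0.
  exact: admissible_point.
move=> a b c ab bc h1 h2; near=> eps.
have H1 : admissible (eps ^+ 6 * omega eps ^+ 4) beta F a b
    (omega eps ^+ 2 * (Int a b psi + tau * (b - a))) by near: eps; exact: h1.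
have H2 : admissible (eps ^+ 6 * omega eps ^+ 4) beta F b c
    (omega eps ^+ 2 * (Int b c psi + tau * (c - b))) by near: eps; exact: h2.
apply: admissible_le (admissible_glue cF ab bc H1 H2).
rewrite (Int_split ab bc (Itg_cont _ _ cpsi)).
by rewrite le_eqVlt; apply/orP; left; apply/eqP; ring.
Unshelve. all: by end_near. Qed.

End Gamma_limit.

(** * The limit of the minima *)

Section Conclusion.
Variable R : realType.
Local Notation mu := (@lebesgue_measure R).
Implicit Types (f g F G : R -> R) (x y beta tau : R).

(** The derivative, extended by constants on both sides of the segment, has a
    primitive of class C1 on the whole line, which spares one-sided limits. *)
Lemma C1_extension f : C1_segment 0 1 f -> exists F G,
  [/\ derives F G, continuous G, forall x, 0 < x < 1 -> f x = F x &
      forall x, 0 < x < 1 -> derive1 f x = G x].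
Proof.
move=> [_ df [g cg fg]].
pose pr x : R := clamp (1 / 2) (x - 1 / 2) + 1 / 2.
have h0 : 0 <= 1 / 2 :> R by rewrite divr_ge0.
have pr01 x : 0 <= pr x <= 1.
  have := clamp_ge (1 / 2) (x - 1 / 2); have := clamp_le (x - 1 / 2) h0.
  by rewrite /pr => a b; apply/andP; split; lra.
have pr_id x : 0 <= x <= 1 -> pr x = x.
  move=> /andP[x0 x1]; rewrite /pr clamp_id ?subrK//.
  by apply/andP; split; lra.
have cpr : continuous pr.
  move=> x; apply: cvgD; last exact: cvg_cst.
  apply: (@continuous_compR R (clamp (1 / 2)) (fun x => x - 1 / 2)).
    exact: continuous_clamp.
  by move=> y; apply: cvgB; [exact: cvg_id|exact: cvg_cst].
pose G x := g (pr x).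
have cG : continuous G.
  move=> x; have /subspace_continuousP/(_ (pr x)) := cg.
  rewrite /= in_itv/= => /(_ (pr01 x)) h.
  move=> B hB; have H : nbhs x (pr @^-1` [set z | z \in `[0, 1] -> B (g z)]).
    exact: cpr x _ (h B hB).
  apply: filterS H => y /= hy; apply: hy.
  by rewrite in_itv/= pr01.
have fG x : 0 < x < 1 -> derive1 f x = G x.
  move=> xI; rewrite fg ?in_itv// /G pr_id//.
  by case/andP: xI => /ltW -> /ltW ->.
pose F x := f (1 / 2) - prim G (1 / 2) + prim G x.
have dF : derives F G.
  have := derivesD (derives_cst (f (1 / 2) - prim G (1 / 2))) (derives_prim cG).
  by apply: eq_derives => x //; rewrite add0r.
have dfG x : 0 < x < 1 -> is_derive x (1 : R) (fun y => f y - F y) 0.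
  move=> xI; have dfx : is_derive x (1 : R) f (G x).
    by apply: DeriveDef; [apply: df; rewrite in_itv|rewrite -derive1E fG].
  by have := is_deriveB dfx (dF x); rewrite subrr.
have const x y : 0 < x -> x <= y -> y < 1 -> f x - F x = f y - F y.
  move=> x0 xy y1.
  have D z : x <= z <= y -> is_derive z (1 : R) (fun y => f y - F y) 0.
    move=> /andP[xz zy]; apply: dfG.
    by rewrite (lt_le_trans x0 xz) (le_lt_trans zy y1).
  have [||z _] := @MVT_segment R (fun y => f y - F y) (fun=> 0) x y xy.
  - move=> z; rewrite in_itv/= => /andP[xz zy]; apply: D.
    by rewrite (ltW xz) (ltW zy).
  - apply: derivable_within_continuous => z; rewrite in_itv/= => /D d.
    exact: (@ex_derive _ _ _ _ _ _ _ d).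
  by rewrite mul0r => /eqP; rewrite subr_eq0 => /eqP ->.
have fF2 : f (1 / 2) - F (1 / 2) = 0 by rewrite /F; ring.
exists F, G; split => // x /andP[x0 x1].
apply/eqP; rewrite -subr_eq0 -fF2; apply/eqP.
have [x2|/ltW x2] := leP x (1 / 2); first by apply: const => //; lra.
by apply/esym/const => //; lra.
Qed.

Lemma minPMF_bounds beta f F G tau : 0 < beta -> 0 < tau ->
  derives F G -> continuous G -> (forall x, 0 < x < 1 -> f x = F x) ->
  \forall eps \near (0 : R)^'+,
    ((omega eps ^+ 2 * (Int 0 1 (fun x => slope_energy beta (G x)) - tau))%:E
       <= minPMF eps beta f <=
     (omega eps ^+ 2 * (Int 0 1 (fun x => slope_energy beta (G x)) + tau))%:E)%E.
Proof.
move=> beta0 tau0 dF cG fF; have cF := derives_continuous dF.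
have lo := lower_bound_segment beta0 tau0 dF cG ler01.
have up := upper_bound_segment beta0 tau0 dF cG ler01.
near=> eps.
have L : forall U W v, H2_rep U W v ->
  omega eps ^+ 2 * (Int 0 1 (fun x => slope_energy beta (G x)) - tau * (1 - 0)) <=
  Int 0 1 (density (eps ^+ 6 * omega eps ^+ 4) beta F U W v) by near: eps; exact: lo.
have [u [u1 [u2 [d1 d2 c2 _ hu]]]] : admissible (eps ^+ 6 * omega eps ^+ 4) beta F 0 1
    (omega eps ^+ 2 * (Int 0 1 (fun x => slope_energy beta (G x)) + tau * (1 - 0))).
  by near: eps; exact: up.
rewrite subr0 mulr1 in L hu; apply/andP; split.
  apply: le_ereal_inf_tmp => _ [w sw <-].
  have [U [W [v [rep hP]]]] := sobolev_H2_density sw.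
  by rewrite (hP _ _ _ F)// lee_fin; exact: L rep.
have [su hP] := C2_sobolev_H2 d1 d2 c2.
apply: (@le_trans _ _ (PMF eps beta f `]0, 1[ u)).
  by apply: ereal_inf_lbound; exists u.
by rewrite (hP _ _ _ F)// lee_fin.
Unshelve. all: by end_near. Qed.

Lemma integral_slope_energy beta f G : continuous G ->
  (forall x, 0 < x < 1 -> derive1 f x = G x) ->
  ((energy_const beta)%:E *
    \int[mu]_(x in `]0%R, 1%R[) (`|derive1 f x| `^ (4 / 5))%:E)%E =
  (Int 0 1 (fun x => slope_energy beta (G x)))%:E.
Proof.
move=> cG fG.
have cp : continuous (fun x => `|G x| `^ (4 / 5)).
  exact: continuous_compR (@continuous_norm_powR R) cG.
have ip : mu.-integrable `]0%R, 1%R[ (EFin \o (fun x => `|G x| `^ (4 / 5))).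
  by apply: integrableS (Itg_cont 0 1 cp) => //; apply: subset_itv; rewrite bnd_simp.
rewrite /slope_energy IntZ; last exact: Itg_cont.
rewrite [RHS]EFinM Int_open; last exact: Itg_cont.
rewrite /Rintegral fineK; last exact: integrable_fin_num.
congr (_ * _)%E; apply: eq_integral => x; rewrite inE/= in_itv/= => xI.
by rewrite fG.
Qed.

End Conclusion.

Theorem theorem2p2 (R : realType) (beta : R) (f : R -> R)
    (beta_gt0 : 0 < beta) (f_C1 : C1_segment 0 1 f) :
  (minPMF eps beta f * ((omega eps ^+ 2)^-1)%:E)%E @[eps --> (0 : R)^'+] -->
  ((10 * (2 * beta / 27) `^ (1 / 5))%:E *
    \int[@lebesgue_measure R]_(x in `]0%R, 1%R[) (`|derive1 f x| `^ (4 / 5))%:E)%E.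
Proof.
have [F [G [dF cG fF fG]]] := C1_extension f_C1.
rewrite -/(energy_const beta) (integral_slope_energy beta cG fG).
set I := Int 0 1 _.
have near_bound tau : 0 < tau -> \forall eps \near (0 : R)^'+, exists2 r : R,
    (minPMF eps beta f * ((omega eps ^+ 2)^-1)%:E)%E = r%:E & `|I - r| <= tau.
  move=> tau0; near=> eps.
  have /andP[lo up] : ((omega eps ^+ 2 * (I - tau))%:E <= minPMF eps beta f <=
      (omega eps ^+ 2 * (I + tau))%:E)%E.
    by near: eps; exact: minPMF_bounds.
  have /andP[w0 _] : 0 < omega eps <= 1 by near: eps; exact: near_omega.
  have w2 : 0 < omega eps ^+ 2 by exact: exprn_gt0.
  have mfin : minPMF eps beta f \is a fin_num.
    by rewrite fin_numE -ltNye -ltey (lt_le_trans _ lo) ?ltNyr// (le_lt_trans up) ?ltry.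
  exists (fine (minPMF eps beta f) / omega eps ^+ 2).
    by rewrite -[in LHS](fineK mfin) -EFinM.
  move: lo up; rewrite -(fineK mfin) !lee_fin; move: (fine _) => m lo up.
  rewrite ler_distlC; apply/andP; split.
    by rewrite ler_pdivlMr// mulrC.
  by rewrite ler_pdivrMr// mulrC.
apply: cvg_EFin.
  by apply: filterS (near_bound 1 ltr01) => eps [r -> _].
apply/cvgrPdist_le => tau tau0.
by apply: filterS (near_bound _ tau0) => eps [r /= -> h].
Unshelve. all: by end_near. Qed.
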